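(* Let $G$ be a locally compact group and let $1<p<\infty$. Then $CV_p(G)\subseteq B(L^p(G))$ is reflexive. If, in addition, $G$ is amenable, then $CV_p(G)$ is hyperreflexive and its hyperreflexivity constant is bounded by $288\pi(1+\sqrt{2})$.
   Context: $L^p(G)$ is taken with respect to a left Haar measure, and $B(L^p(G))$ is the algebra of bounded operators on it. $T\in B(L^p(G))$ is a convolution operator if $T(\delta_t*f)=\delta_t*T(f)$ for every $t\in G$ and $f\in L^p(G)$, where $(\delta_t*f)(s)=f(t^{-1}s)$; $CV_p(G)$ is the space of all convolution operators on $L^p(G)$. For a Banach space $X$, a closed subspace $\mathcal{S}\subseteq B(X)$ and $T\in B(X)$, put $\operatorname{dist}(T,\mathcal{S})=\inf_{S\in\mathcal{S}}\|T-S\|$ and $\operatorname{dist}_r(T,\mathcal{S})=\sup_{\|x\|\leq 1}\inf_{S\in\mathcal{S}}\|T(x)-S(x)\|$. $\mathcal{S}$ is reflexive if every $T\in B(X)$ with $\operatorname{dist}_r(T,\mathcal{S})=0$ (that is, $T(x)\in\overline{\{S(x):S\in\mathcal{S}\}}$ for all $x\in X$) belongs to $\mathcal{S}$. $\mathcal{S}$ is hyperreflexive with constant bounded by $K$ if $\operatorname{dist}(T,\mathcal{S})\leq K\operatorname{dist}_r(T,\mathcal{S})$ for all $T\in B(X)$. *)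

(* Defs.v *)
From HB Require Import structures.
From mathcomp Require Import all_boot all_order all_algebra.
From mathcomp Require Import all_classical all_reals all_analysis.
From mathcomp Require Import measurable_realfun complex.

Set Implicit Arguments.
Unset Strict Implicit.
Unset Printing Implicit Defensive.

Import Order.TTheory GRing.Theory Num.Theory.
Import numFieldNormedType.Exports.
Import Normc.

Local Open Scope classical_set_scope.
Local Open Scope ring_scope.
Local Open Scope complex_scope.
Local Open Scope quotient_scope.

Lemma normc_ge0 (R : realType) (z : R[i]) : 0 <= normc z.
Proof. by case: z => a b; exact: sqrtr_ge0. Qed.

Section Lp_functions.
Context d (T : measurableType d) (R : realType).
Variables (mu : {measure set T -> \bar R}) (p : R).

(** Borel measurability of a complex-valued function. *)
Definition cmeasurable (f : T -> R[i]) : Prop :=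
  measurable_fun setT (fun x => complex.Re (f x)) /\
  measurable_fun setT (fun x => complex.Im (f x)).

Definition cLnorm (f : T -> R[i]) : \bar R :=
  'N[mu]_p%:E[EFin \o (fun x => normc (f x))]%E.

Definition cLfun : {pred T -> R[i]} :=
  fun f => `[< cmeasurable f /\ (cLnorm f < +oo)%E >].

Lemma cLfunP (f : T -> R[i]) :
  reflect (cmeasurable f /\ (cLnorm f < +oo)%E) (f \in cLfun).
Proof. exact: asboolP. Qed.

Lemma cmeasurable_normc f : cmeasurable f ->
  measurable_fun setT (fun x => normc (f x)).
Proof.
move=> [mr mi].
rewrite (_ : (fun x => _) =
  (fun x => (complex.Re (f x) ^+ 2 + complex.Im (f x) ^+ 2) `^ 2^-1)); last first.
  apply/funext => x; rewrite powR12_sqrt ?addr_ge0 ?sqr_ge0//.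
  by case: (f x).
apply: (@measurableT_comp _ _ _ _ _ _ (@powR R ^~ 2^-1)) => //.
by apply: measurable_funD; apply: measurable_funX.
Qed.

Lemma cmeasurableD f g : cmeasurable f -> cmeasurable g -> cmeasurable (f + g).
Proof.
move=> [fr fi] [gr gi]; split.
- rewrite (_ : (fun x => _) = (fun x => complex.Re (f x) + complex.Re (g x))).
    exact: measurable_funD.
  by apply/funext => x /=; rewrite fctE; case: (f x); case: (g x).
- rewrite (_ : (fun x => _) = (fun x => complex.Im (f x) + complex.Im (g x))).
    exact: measurable_funD.
  by apply/funext => x /=; rewrite fctE; case: (f x); case: (g x).
Qed.

Lemma cmeasurableZ a f : cmeasurable f -> cmeasurable (a *: f).
Proof.
move=> [fr fi]; split.
- rewrite (_ : (fun x => _) = (fun x => complex.Re a * complex.Re (f x) -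
    complex.Im a * complex.Im (f x))).
    by apply: measurable_funB; apply: measurable_funM.
  by apply/funext => x /=; rewrite fctE; case: (f x); case: (a).
- rewrite (_ : (fun x => _) = (fun x => complex.Re a * complex.Im (f x) +
    complex.Im a * complex.Re (f x))).
    by apply: measurable_funD; apply: measurable_funM.
  by apply/funext => x /=; rewrite fctE; case: (f x); case: (a).
Qed.

Lemma cLnorm_ge0 f : (0 <= cLnorm f)%E.
Proof. exact: Lnorm_ge0. Qed.

Hypothesis p1 : 1 <= p.
Let p_gt0 : 0 < p. Proof. exact: lt_le_trans p1. Qed.

Let ge0_LnormE (u : T -> R) : (forall x, 0 <= u x) ->
  ('N[mu]_p%:E[EFin \o u] = (\int[mu]_x ((u x `^ p)%:E)) `^ p^-1)%E.
Proof.
move=> u0; rewrite unlock /Lnorm; congr (_ `^ _)%E.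
by apply: eq_integral => x _ /=; rewrite ger0_norm// poweR_EFin.
Qed.

Let cLnormE f :
  cLnorm f = ((\int[mu]_x ((normc (f x) `^ p)%:E)) `^ p^-1)%E.
Proof. by apply: ge0_LnormE => x; exact: normc_ge0. Qed.

Let measurable_powRp (u : T -> R) : measurable_fun setT u ->
  measurable_fun setT (fun x => (u x `^ p)%:E).
Proof.
move=> mu'; apply/measurable_EFinP.
exact: (@measurableT_comp _ _ _ _ _ _ (@powR R ^~ p)).
Qed.

Lemma eq_cLnorm f g : {ae mu, forall x, f x = g x} ->
  cmeasurable f -> cmeasurable g -> cLnorm f = cLnorm g.
Proof.
move=> fg mf mg; rewrite !cLnormE; congr (_ `^ _)%E.
apply: ae_eq_integral => //; first 2 last.
- by apply: filterS fg => x fg _; rewrite fg.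
- by apply: measurable_powRp; exact: cmeasurable_normc.
- by apply: measurable_powRp; exact: cmeasurable_normc.
Qed.

Lemma cLnormD f g : cmeasurable f -> cmeasurable g ->
  (cLnorm (f + g)%R <= cLnorm f + cLnorm g)%E.
Proof.
move=> mf mg.
have fg0 x : 0 <= normc (f x) + normc (g x) by rewrite addr_ge0 ?normc_ge0.
apply: (@le_trans _ _
  ('N[mu]_p%:E[EFin \o ((fun x => normc (f x)) \+ (fun x => normc (g x)))%R])%E);
  last by apply: minkowski_EFin => //; exact: cmeasurable_normc.
rewrite cLnormE ge0_LnormE//.
apply: gt0_ler_poweR; rewrite ?invr_ge0 ?(ltW p_gt0)//.
- by rewrite in_itv/= leey andbT; apply: integral_ge0 => x _; rewrite lee_fin powR_ge0.
- by rewrite in_itv/= leey andbT; apply: integral_ge0 => x _; rewrite lee_fin powR_ge0.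
apply: ge0_le_integral => //.
- by move=> x _; rewrite lee_fin powR_ge0.
- by apply: measurable_powRp; apply: cmeasurable_normc; exact: cmeasurableD.
- by apply: measurable_powRp; apply: measurable_funD; exact: cmeasurable_normc.
- move=> x _ /=; rewrite lee_fin.
  apply: ge0_ler_powR; rewrite ?nnegrE ?normc_ge0 ?fg0 ?(ltW p_gt0)//.
  exact: le_normcD.
Qed.

Lemma cLnormZ a f : cmeasurable f -> (cLnorm (a *: f)%R = (normc a)%:E * cLnorm f)%E.
Proof.
move=> mf; rewrite !cLnormE.
under eq_integral => x _.
  rewrite fctE normcM powRM ?normc_ge0// EFinM.
  over.
rewrite ge0_integralZl//=.
- rewrite poweRM ?lee_fin ?powR_ge0//; last first.
    by apply: integral_ge0 => x _; rewrite lee_fin powR_ge0.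
  by rewrite poweR_EFin -powRrM mulfV ?gt_eqF// powRr1 ?normc_ge0.
- apply/measurable_EFinP.
  apply: (@measurableT_comp _ _ _ _ _ _ (@powR R ^~ p)) => //.
  exact: cmeasurable_normc.
- by move=> x _; rewrite lee_fin powR_ge0.
- by rewrite lee_fin powR_ge0.
Qed.

Lemma cLnorm_eq0 f : cmeasurable f -> cLnorm f = 0%E ->
  {ae mu, forall x, f x = 0}.
Proof.
move=> mf f0.
have mnf : measurable_fun setT (EFin \o (fun x => normc (f x))).
  by apply/measurable_EFinP; exact: cmeasurable_normc.
have p0 : (0 < p%:E)%E by rewrite lte_fin.
apply: filterS (Lnorm_eq0_eq0 mnf p0 f0) => x /= /(_ I) [].
exact: eq0_normc.
Qed.

Lemma cLnorm0 : cLnorm 0 = 0%E.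
Proof.
rewrite (_ : 0 = 0 *: 0); last by rewrite scale0r.
rewrite cLnormZ ?normc0 ?mul0e//; split; exact: measurable_cst.
Qed.

End Lp_functions.

Section Lp_space.
Context d (T : measurableType d) (R : realType).
Variables (mu : {measure set T -> \bar R}) (p : R) (p1 : 1 <= p).

(** The proof [p1] only serves to attach the algebraic structures below to
    this predicate. *)
Definition cLfunp of 1 <= p : {pred T -> R[i]} := cLfun mu p.

Lemma cLfunp_submod_closed : submod_closed (cLfunp p1).
Proof.
split.
  apply/cLfunP; split; first by split; exact: measurable_cst.
  by rewrite cLnorm0.
move=> a f g /cLfunP[mf ff] /cLfunP[mg gg]; apply/cLfunP.
have maf := cmeasurableZ a mf.
split; first exact: cmeasurableD.
apply: (le_lt_trans (cLnormD mu p1 maf mg)).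
rewrite lte_add_pinfty// cLnormZ// lte_mul_pinfty// ?lee_fin ?normc_ge0//.
Qed.

HB.instance Definition _ :=
  GRing.isSubmodClosed.Build R[i] (T -> R[i]) (cLfunp p1) cLfunp_submod_closed.

Record Lpfun := MkLpfun {
  Lpfun_val :> T -> R[i] ;
  LpfunP : Lpfun_val \in cLfunp p1 }.

HB.instance Definition _ := [isSub for Lpfun_val].
HB.instance Definition _ := [Choice of Lpfun by <:].
HB.instance Definition _ := [SubChoice_isSubLmodule of Lpfun by <:].

Definition Lpfun_ae_eq (f g : Lpfun) : bool :=
  `[< {ae mu, forall x, f x = g x} >].

Let Lpfun_ae_eq_refl : reflexive Lpfun_ae_eq.
Proof. by move=> f; apply/asboolP; exact: aeW. Qed.

Let Lpfun_ae_eq_sym : symmetric Lpfun_ae_eq.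
Proof. by move=> f g; apply/idP/idP => /asboolP h; apply/asboolP; apply: filterS h. Qed.

Let Lpfun_ae_eq_trans : transitive Lpfun_ae_eq.
Proof.
move=> f g h /asboolP gf /asboolP fh; apply/asboolP.
by apply: filterS2 gf fh => x -> ->.
Qed.

Canonical Lpfun_ae_eq_equiv :=
  EquivRel Lpfun_ae_eq Lpfun_ae_eq_refl Lpfun_ae_eq_sym Lpfun_ae_eq_trans.

(** [L^p] proper: classes of p-integrable functions modulo equality a.e. *)
Definition Lp : Type := {eq_quot Lpfun_ae_eq}.
HB.instance Definition _ := Choice.on Lp.
HB.instance Definition _ := EqQuotient.on Lp.

Definition Lp_class (f : Lpfun) : Lp := \pi_Lp f.

Lemma Lp_classP (f g : Lpfun) :
  Lp_class f = Lp_class g <-> {ae mu, forall x, f x = g x}.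
Proof. by split => [/eqmodP/asboolP//|h]; apply/eqmodP/asboolP. Qed.

Lemma Lp_reprK (x : Lp) : Lp_class (repr x) = x.
Proof. exact: reprK. Qed.

Lemma repr_Lp_class (f : Lpfun) :
  {ae mu, forall x, (repr (Lp_class f) : Lpfun) x = f x}.
Proof. by apply/Lp_classP; rewrite Lp_reprK. Qed.

Definition Lp_zero : Lp := Lp_class 0.
Definition Lp_opp (x : Lp) : Lp := Lp_class (- repr x).
Definition Lp_add (x y : Lp) : Lp := Lp_class (repr x + repr y).
Definition Lp_scale (a : R[i]) (x : Lp) : Lp := Lp_class (a *: repr x).
Definition Lp_norm (x : Lp) : R[i] := (fine (cLnorm mu p (repr x)))%:C.

Lemma Lp_classD f g : Lp_add (Lp_class f) (Lp_class g) = Lp_class (f + g).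
Proof.
apply/Lp_classP; apply: filterS2 (repr_Lp_class f) (repr_Lp_class g) => x /=.
by rewrite /= !fctE => -> ->.
Qed.

Lemma Lp_classN f : Lp_opp (Lp_class f) = Lp_class (- f).
Proof.
apply/Lp_classP; apply: filterS (repr_Lp_class f) => x /=.
by rewrite /= !fctE => ->.
Qed.

Lemma Lp_classZ a f : Lp_scale a (Lp_class f) = Lp_class (a *: f).
Proof.
apply/Lp_classP; apply: filterS (repr_Lp_class f) => x /=.
by rewrite /= !fctE => ->.
Qed.

Let Lp_addA : associative Lp_add.
Proof.
move=> x y z; rewrite -[x]Lp_reprK -[y]Lp_reprK -[z]Lp_reprK.
by rewrite !Lp_classD addrA.
Qed.

Let Lp_addC : commutative Lp_add.
Proof. by move=> x y; rewrite /Lp_add addrC. Qed.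

Let Lp_add0 : left_id Lp_zero Lp_add.
Proof. by move=> x; rewrite -[x]Lp_reprK Lp_classD add0r. Qed.

Let Lp_addN : left_inverse Lp_zero Lp_opp Lp_add.
Proof. by move=> x; rewrite -[x]Lp_reprK Lp_classN Lp_classD addNr. Qed.

HB.instance Definition _ :=
  GRing.isZmodule.Build Lp Lp_addA Lp_addC Lp_add0 Lp_addN.

Let Lp_addE (x y : Lp) : x + y = Lp_add x y. Proof. by []. Qed.

Let Lp_scaleA a b x : Lp_scale a (Lp_scale b x) = Lp_scale (a * b) x.
Proof. by rewrite -[x]Lp_reprK !Lp_classZ scalerA. Qed.

Let Lp_scale1 : left_id 1 Lp_scale.
Proof. by move=> x; rewrite -[x]Lp_reprK Lp_classZ scale1r. Qed.

Let Lp_scaleDr : right_distributive Lp_scale +%R.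
Proof.
move=> a x y; rewrite -[x]Lp_reprK -[y]Lp_reprK.
by rewrite !Lp_addE !(Lp_classD, Lp_classZ) scalerDr.
Qed.

Let Lp_scaleDl x : {morph Lp_scale^~ x : a b / a + b}.
Proof.
move=> a b; rewrite -[x]Lp_reprK.
by rewrite !Lp_addE !(Lp_classD, Lp_classZ) scalerDl.
Qed.

HB.instance Definition _ := GRing.Zmodule_isLmodule.Build R[i] Lp
  Lp_scaleA Lp_scale1 Lp_scaleDr Lp_scaleDl.

Lemma Lp_class_linear (a : R[i]) (f g : Lpfun) :
  Lp_class (a *: f + g) = a *: Lp_class f + Lp_class g.
Proof. by rewrite -Lp_classD -Lp_classZ. Qed.

Lemma cLnorm_fin (f : Lpfun) : (fine (cLnorm mu p f))%:E = cLnorm mu p f.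
Proof.
have /cLfunP[_ ff] := LpfunP f.
by rewrite fineK// ge0_fin_numE// cLnorm_ge0.
Qed.

Lemma Lp_norm_class f : Lp_norm (Lp_class f) = (fine (cLnorm mu p f))%:C.
Proof.
rewrite /Lp_norm; congr (fine _)%:C.
apply: eq_cLnorm => //; first exact: repr_Lp_class.
  by have /cLfunP[] := LpfunP (repr (Lp_class f)).
by have /cLfunP[] := LpfunP f.
Qed.

Let Lp_normD x y : Lp_norm (x + y) <= Lp_norm x + Lp_norm y.
Proof.
rewrite -[x]Lp_reprK -[y]Lp_reprK -[_ + _]/(Lp_add _ _) Lp_classD !Lp_norm_class.
rewrite -rmorphD lecR -lee_fin EFinD !cLnorm_fin.
by apply: cLnormD => //; [have /cLfunP[] := LpfunP (repr x)|have /cLfunP[] := LpfunP (repr y)].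
Qed.

Let Lp_normZ a x : Lp_norm (a *: x) = `|a| * Lp_norm x.
Proof.
rewrite -[x]Lp_reprK -[_ *: _]/(Lp_scale _ _) Lp_classZ !Lp_norm_class.
rewrite -[`|a|]/((normc a)%:C) -rmorphM; congr (_%:C); apply: EFin_inj.
rewrite EFinM !cLnorm_fin cLnormZ//.
by have /cLfunP[] := LpfunP (repr x).
Qed.

Let Lp_norm0_eq0 x : Lp_norm x = 0 -> x = 0.
Proof.
rewrite -[x]Lp_reprK Lp_norm_class => -[x0].
have {}x0 : cLnorm mu p (repr x) = 0%E by rewrite -cLnorm_fin x0.
apply/Lp_classP.
apply: cLnorm_eq0 x0 => //.
by have /cLfunP[] := LpfunP (repr x).
Qed.

Let Lp_normMn x n : Lp_norm (x *+ n) = Lp_norm x *+ n.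
Proof. by rewrite -scaler_nat Lp_normZ normr_nat mulr_natl. Qed.

Let Lp_normN x : Lp_norm (- x) = Lp_norm x.
Proof. by rewrite -scaleN1r Lp_normZ normrN1 mul1r. Qed.

HB.instance Definition _ := Num.Zmodule_isNormed.Build R[i] Lp
  Lp_normD Lp_norm0_eq0 Lp_normMn Lp_normN.

Let Lp_dist (x y : Lp) : R[i] := `|y - x|.

Let Lp_distxx x : Lp_dist x x = 0.
Proof. by rewrite /Lp_dist subrr normr0. Qed.

Let Lp_dist0 x y : Lp_dist x y = 0 -> x = y.
Proof. by move=> xy; apply/esym/subr0_eq/normr0_eq0. Qed.

Let Lp_distC x y : Lp_dist x y = Lp_dist y x.
Proof. exact: distrC. Qed.

Let Lp_dist_triangle y x z : Lp_dist x z <= Lp_dist x y + Lp_dist y z.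
Proof. by rewrite /Lp_dist [leRHS]addrC; exact: ler_distD. Qed.

HB.instance Definition _ :=
  isMetric.Build R[i] Lp Lp_distxx Lp_dist0 Lp_distC Lp_dist_triangle.
HB.instance Definition _ := isPointed.Build Lp 0.

Let Lp_mdist_norm (x y : Lp) : mdist x y = `|y - x|. Proof. by []. Qed.

HB.instance Definition _ := NormedZmoduleMetric.Build R[i] Lp Lp_mdist_norm.
HB.instance Definition _ :=
  PseudoMetricNormedZmod_Lmodule_isNormedModule.Build R[i] Lp Lp_normZ.

End Lp_space.

HB.mixin Record isTopologicalGroup G of Topological G & Group G := {
  mulg_continuous : continuous (fun xy : G * G => (xy.1 * xy.2)%g) ;
  invg_continuous : continuous (fun x : G => (x^-1)%g)
}.

#[short(type="topologicalGroupType")]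
HB.structure Definition TopologicalGroup :=
  {G of Topological G & Group G & isTopologicalGroup G}.

(** [G] with its Borel sigma-algebra; measurable types must be pointed, and the
    point chosen here is the unit. *)
Definition borel (G : topologicalGroupType) : Type := G.

Section borel.
Variable G : topologicalGroupType.

HB.instance Definition _ := Group.on (borel G).
HB.instance Definition _ := Topological.on (borel G).
HB.instance Definition _ := isTopologicalGroup.Build (borel G)
  (@mulg_continuous G) (@invg_continuous G).
HB.instance Definition _ := isPointed.Build (borel G) 1%g.
HB.instance Definition _ := @isMeasurable.Build (sigma_display (@open G))
  (borel G) <<s @open G >> (@sigma_algebra0 _ setT (@open G))
  (@sigma_algebraC (borel G) (@open G)) (@sigma_algebra_bigcup _ setT (@open G)).

End borel.

(** A nonzero left-invariant Radon measure: finite on compact sets, outer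
    regular on Borel sets, inner regular on open sets.  For non-sigma-compact [G]
    other regularity conventions exist; they give the same [L^p] for
    [1 < p < oo]. *)
HB.mixin Record isLeftHaar (G : topologicalGroupType) (R : realType)
    (mu : set (borel G) -> \bar R) := {
  haar_left_invariant : forall (t : G) (A : set (borel G)), measurable A ->
    mu [set (t * s)%g | s in A] = mu A ;
  haar_neq0 : mu setT != 0%E ;
  haar_compact_fin : forall K : set (borel G), compact K -> (mu K < +oo)%E ;
  haar_outer_regular : forall A : set (borel G), measurable A ->
    mu A = ereal_inf [set mu U | U in [set U | open U /\ A `<=` U]] ;
  haar_inner_regular : forall U : set (borel G), open U ->
    mu U = ereal_sup [set mu K | K in [set K | compact K /\ K `<=` U]]
}.

#[short(type="leftHaarMeasure")]
HB.structure Definition LeftHaar (G : topologicalGroupType) (R : realType) :=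
  {mu of @Measure _ (borel G) R mu & isLeftHaar G R mu}.

Section translation.
Context (R : realType) (G : topologicalGroupType).

Definition translate (t : G) (f : borel G -> R[i]) : borel G -> R[i] :=
  fun s => f (t^-1 * s)%g.

Variable mu : leftHaarMeasure G R.

Lemma mulg_continuousr (t : G) : continuous (fun s : borel G => (t * s)%g).
Proof.
move=> s; apply: (@continuous2_cvg _ _ _ _ _ _ (fun=> t) id (fun x y : G => (x * y)%g)).
- exact: (@mulg_continuous G (t, s)).
- exact: cvg_cst.
- exact: cvg_id.
Qed.

Lemma measurable_mulg (t : G) :
  measurable_fun [set: borel G] (fun s : borel G => (t * s)%g : borel G).
Proof.
apply: (@measurability _ _ _ _ _ _ (@open (borel G))) => //.
move=> _ [U oU <-]; rewrite setTI; apply: sub_sigma_algebra.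
by move/continuousP : (@mulg_continuousr t); exact.
Qed.

Lemma haar_preimage (t : G) (A : set (borel G)) : measurable A ->
  mu ((fun s => (t * s)%g) @^-1` A) = mu A.
Proof.
move=> mA; rewrite -[RHS](haar_left_invariant t^-1%g A mA); congr (mu _).
apply/seteqP; split => [s /= As|_ [s As <-]/=].
  by exists (t * s)%g => //; rewrite mulKg.
by rewrite mulVKg.
Qed.

Lemma ae_translate (t : G) (P : borel G -> Prop) :
  {ae mu, forall s, P s} -> {ae mu, forall s, P (t * s)%g}.
Proof.
move=> [N [mN N0 PN]]; exists ((fun s => (t * s)%g) @^-1` N); split.
- by rewrite -[_ @^-1` _]setTI; exact: measurable_mulg.
- by rewrite haar_preimage.
- by move=> s Ps; exact: PN.
Qed.

Lemma cmeasurable_translate (t : G) f :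
  cmeasurable f -> cmeasurable (translate t f).
Proof.
move=> [fr fi]; split.
  exact: (measurableT_comp fr (@measurable_mulg t^-1%g)).
exact: (measurableT_comp fi (@measurable_mulg t^-1%g)).
Qed.

Variables (p : R) (p1 : 1 <= p).

Lemma cLnorm_translate (t : G) f : cmeasurable f ->
  cLnorm mu p (translate t f) = cLnorm mu p f.
Proof.
move=> mf; rewrite /cLnorm unlock /Lnorm; congr (_ `^ _)%E.
pose phi (s : borel G) : borel G := (t^-1 * s)%g.
pose F (s : borel G) : \bar R := (`|(normc (f s))%:E| `^ p)%E.
rewrite -[LHS]/(\int[mu]_s (F \o phi) s)%E -[RHS]/(\int[mu]_s F s)%E.
have mphi : measurable_fun setT phi by exact: measurable_mulg.
have mF : measurable_fun setT F.
  rewrite (_ : F = EFin \o (fun s => normc (f s) `^ p)).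
    apply/measurable_EFinP.
    apply: (@measurableT_comp _ _ _ _ _ _ (@powR R ^~ p)) => //.
    exact: cmeasurable_normc.
  by apply/funext => s; rewrite /F/= ger0_norm ?poweR_EFin// normc_ge0.
have := @ge0_integral_pushforward _ _ _ _ _ phi mphi mu setT F measurableT mF.
rewrite preimage_setT => <-; last by move=> s _; exact: poweR_ge0.
apply: eq_measure_integral => A mA _.
exact: (@haar_preimage t^-1%g).
Qed.

Lemma translate_Lpfun_subproof (t : G) (f : Lpfun mu p1) :
  translate t f \in cLfunp mu p1.
Proof.
have /cLfunP[mf ff] := LpfunP f.
apply/cLfunP; split; first exact: cmeasurable_translate.
by rewrite cLnorm_translate.
Qed.

Definition translate_Lpfun (t : G) (f : Lpfun mu p1) : Lpfun mu p1 :=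
  MkLpfun (translate_Lpfun_subproof t f).

Definition Lp_translate (t : G) (x : Lp mu p1) : Lp mu p1 :=
  Lp_class (translate_Lpfun t (repr x)).

Lemma Lp_translate_class (t : G) (f : Lpfun mu p1) :
  Lp_translate t (Lp_class f) = Lp_class (translate_Lpfun t f).
Proof.
by apply/Lp_classP; apply: (@ae_translate t^-1%g) (repr_Lp_class f).
Qed.

End translation.

Section amenability.
Context (R : realType) (G : topologicalGroupType) (mu : leftHaarMeasure G R).

(** [L^oo(G)] is taken modulo locally null sets, so that it is the dual of
    [L^1(G)] also when [mu] is not sigma-finite. *)
Definition locally_ae (P : borel G -> Prop) : Prop :=
  forall K : set (borel G), compact K -> mu.-negligible (K `&` [set s | ~ P s]).

Definition ess_bounded_by (c : R) (f : borel G -> R[i]) : Prop :=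
  locally_ae (fun s => normc (f s) <= c).

Definition Linfty (f : borel G -> R[i]) : Prop :=
  cmeasurable f /\ exists c : R, ess_bounded_by c f.

(** A functional [m] on [L^oo(G)] with [||m|| = m(1) = 1], written on
    representatives: by linearity, [mean_bounded] with [c = 0] makes it
    insensitive to changes on locally null sets.  The values of [m] outside
    [Linfty] are irrelevant. *)
Record left_invariant_mean (m : (borel G -> R[i]) -> R[i]) : Prop := {
  mean_linear : forall (a : R[i]) f g, Linfty f -> Linfty g ->
    m (a *: f + g) = a * m f + m g ;
  mean_bounded : forall c f, Linfty f -> ess_bounded_by c f -> normc (m f) <= c ;
  mean1 : m (fun=> 1) = 1 ;
  mean_left_invariant : forall (t : G) f, Linfty f -> m (translate t f) = m f
}.

Definition amenable : Prop := exists m, left_invariant_mean m.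

End amenability.

Section hyperreflexivity.
Context (R : realType) (X : normedModType R[i]).

Record boundedOp := MkBoundedOp {
  boundedOp_linear :> {linear X -> X} ;
  boundedOpP : exists M : R[i], forall x, `|boundedOp_linear x| <= M * `|x| }.

(** The library's norm on a [normedModType R[i]] takes (nonnegative real) values
    in [R[i]]. *)
Definition enorm (x : X) : \bar R := (complex.Re `|x|)%:E.

Definition opnorm (T : X -> X) : \bar R :=
  ereal_sup [set enorm (T x) | x in [set x | `|x| <= 1]].

Definition dist (T : boundedOp) (S : set boundedOp) : \bar R :=
  ereal_inf [set opnorm (fun x => T x - A x) | A in S].

Definition dist_r (T : boundedOp) (S : set boundedOp) : \bar R :=
  ereal_sup [set ereal_inf [set enorm (T x - A x) | A in S]
            | x in [set x | `|x| <= 1]].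

Record closed_subspace (S : set boundedOp) : Prop := {
  closed_subspace0 : exists2 A, S A & forall x, A x = 0 ;
  closed_subspaceZD : forall (a : R[i]) (A B C : boundedOp), S A -> S B ->
    (forall x, C x = a *: A x + B x) -> S C ;
  closed_subspace_closed : forall T, dist T S = 0%E -> S T }.

Definition reflexive_space (S : set boundedOp) : Prop :=
  forall T, dist_r T S = 0%E -> S T.

Definition hyperreflexive_with (S : set boundedOp) (K : R) : Prop :=
  forall T, (dist T S <= K%:E * dist_r T S)%E.

End hyperreflexivity.

Section convolution_operators.
Context (R : realType) (G : topologicalGroupType) (mu : leftHaarMeasure G R).
Variables (p : R) (p1 : 1 <= p).

Definition CV : set (boundedOp (Lp mu p1)) :=
  [set T | forall (t : G) f, T (Lp_translate t f) = Lp_translate t (T f)].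

Lemma Lp_translate_linear (t : G) (a : R[i]) (x y : Lp mu p1) :
  Lp_translate t (a *: x + y) = a *: Lp_translate t x + Lp_translate t y.
Proof.
rewrite -[x]Lp_reprK -[y]Lp_reprK -Lp_class_linear !Lp_translate_class.
by rewrite -Lp_class_linear; congr Lp_class; apply: val_inj.
Qed.

Lemma Lp_translate_norm (t : G) (x : Lp mu p1) : `|Lp_translate t x| = `|x|.
Proof.
rewrite -[x]Lp_reprK Lp_translate_class.
rewrite -[LHS]/(Lp_norm _) -[RHS]/(Lp_norm _) !Lp_norm_class cLnorm_translate//.
by have /cLfunP[] := LpfunP (repr x).
Qed.

Lemma Lp_translate0 (t : G) : Lp_translate t (0 : Lp mu p1) = 0.
Proof.
have := Lp_translate_linear t (-1) (0 : Lp mu p1) 0.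
by rewrite !scaleN1r !addNr.
Qed.

Lemma Lp_translateZ (t : G) (a : R[i]) (x : Lp mu p1) :
  Lp_translate t (a *: x) = a *: Lp_translate t x.
Proof. by rewrite -[a *: x]addr0 Lp_translate_linear Lp_translate0 addr0. Qed.

Lemma Lp_translateB (t : G) (x y : Lp mu p1) :
  Lp_translate t (x - y) = Lp_translate t x - Lp_translate t y.
Proof. by rewrite addrC -scaleN1r Lp_translate_linear scaleN1r addrC. Qed.

Lemma CV_closed_subspace : closed_subspace CV.
Proof.
split.
- pose Z : {linear Lp mu p1 -> Lp mu p1} := \0.
  have b0 : exists M : R[i], forall x, `|Z x| <= M * `|x|.
    by exists 0 => x; rewrite normr0 mul0r.
  by exists (MkBoundedOp b0) => // t f /=; rewrite Lp_translate0.
- move=> a A B C cA cB CE t f.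
  by rewrite !CE cA cB Lp_translate_linear.
move=> T T0 t f; apply/eqP; rewrite -subr_eq0 -normr_eq0.
have [->|f0] := eqVneq f 0.
  by rewrite linear0 !Lp_translate0 linear0 subrr normr0.
pose g := `|f|^-1 *: f.
have g1 : `|g| = 1.
  by rewrite /g normrZ normfV normr_id mulVf// normr_eq0.
suff : `|T (Lp_translate t g) - Lp_translate t (T g)| = 0.
  rewrite /g linearZ !Lp_translateZ linearZ -scalerBr normrZ => /eqP.
  rewrite mulf_eq0 => /orP[|//].
  by rewrite normfV normr_id invr_eq0 => /eqP/normr0_eq0/eqP; rewrite (negbTE f0).
set N := `|_|.
have NE (x : Lp mu p1) : `|x| = (complex.Re `|x|)%:C by [].
suff N0 : forall e : R, 0 < e -> complex.Re N <= e *+ 2.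
  rewrite /N NE; congr (_%:C); apply/eqP; rewrite eq_le; apply/andP; split.
    apply/ler_addgt0Pr => e e0; rewrite add0r.
    have e2 : 0 < e / 2 by rewrite divr_gt0.
    by rewrite [leRHS]splitr -mulr2n; exact: N0.
  by rewrite -lecR -NE; exact: normr_ge0.
move=> e e0.
have [A [cA Ae]] : exists A, CV A /\ (opnorm (fun x => T x - A x)%R <= e%:E)%E.
  apply: contrapT => /forallNP h.
  have : (e%:E <= dist T CV)%E.
    apply: le_ereal_inf_tmp => _ [A cA <-]; rewrite leNgt; apply/negP => /ltW Ae.
    by apply: (h A).
  by rewrite T0 lee_fin leNgt e0.
have TA (x : Lp mu p1) : `|x| <= 1 -> complex.Re `|T x - A x| <= e.
  move=> x1; rewrite -lee_fin; apply: le_trans Ae.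
  by apply: ereal_sup_ubound; exists x.
rewrite -lecR -NE mulr2n rmorphD/= /N.
rewrite -(subrKA (A (Lp_translate t g))) cA -Lp_translateB -cA.
apply: (le_trans (ler_normD _ _)); rewrite Lp_translate_norm distrC -[`|A g - _|]distrC.
rewrite lerD// NE lecR.
  by rewrite distrC TA// Lp_translate_norm g1.
by rewrite TA// g1.
Qed.

End convolution_operators.

Arguments CV {R G} mu {p} p1 _.

(* Main.v *)
From HB Require Import structures.
Require Import Defs.
From mathcomp Require Import all_boot all_order all_algebra.
From mathcomp Require Import all_classical all_reals all_analysis.
From mathcomp Require Import measurable_realfun complex ring lra zify.

Set Implicit Arguments.
Unset Strict Implicit.
Unset Printing Implicit Defensive.

Import Order.TTheory GRing.Theory Num.Theory.
Import numFieldNormedType.Exports.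
Import Normc.

Local Open Scope classical_set_scope.
Local Open Scope ring_scope.
Local Open Scope complex_scope.

(** Let [alpha] be the distance [dist_r] from [T] to the convolution operators,
    and let [delta] be the supremum over [t] of the norms of the differences
    between [T] and its conjugate by the translation by [t]. The heart of the
    proof is the bound [delta <= 288 pi (1 + sqrt 2) alpha], which holds for
    every group ([conjugation_estimate]). When [alpha] is 0 it says that [T]
    commutes with translations, which is reflexivity. When [G] is amenable, the
    average of the conjugates of [T] over the group is a convolution operator at
    distance at most [delta] from [T], which is hyperreflexivity.

    The bound on [delta]. Fix a translation and let [U n] be its powers, an
    isometric action of the integers. A trigonometric polynomial with
    coefficients [c n] has a value at this action, the sum of the [c n] times
    [U n]. If two such functions have disjoint supports on the circle, and [S]
    commutes with the action, then composing [S] with the value of one on the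
    left and the value of the other on the right gives 0. Therefore, with [T] in
    place of [S], this product is controlled by [alpha] ([phiop_T_qop]). Take
    for the left factor a triangle supported by a short arc, and for the right
    one the complement of a trapezoid equal to 1 on that arc. What is left of
    [T] is supported close to the diagonal of the torus. There, the function
    [z - 1], which gives the difference between the conjugate of [T] and [T],
    agrees with a function with coefficients [kw n] of total mass at most [1/2],
    and so this part contributes at most [delta / 2]. The [2 N'] rotations of
    the triangle add up to 1, so these estimates together give
    [delta <= 15 N' alpha + delta / 2] as soon as [20 pi <= N']
    ([commutator_estimate]).

    Infinite sums are avoided by working on the [M]-th roots of unity, with
    finite Fourier coefficients indexed by a window of [M] integers. The
    functions above then satisfy their identities exactly, in terms of cyclic
    convolutions, and the difference with convolutions over the integers is of
    order [1 / M] ([wrap2], [wrap3]). The convolution operators given by [dist_r]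
    come without any uniform bound, so for them [M] has to be sent to infinity at
    a fixed vector, which uses the completeness of [L^p]
    ([Lp_rapidly_complete]).

    The average ([average]). The mean is applied to the pairings of the
    conjugates of [T] with the elements of the dual exponent. These are
    continuous functions of the translation because translations are strongly
    continuous on [L^p] ([Lp_translate_continuous1]), by the regularity of the
    Haar measure. The resulting functional is represented by an element of [L^p]
    ([riesz_representation]); since the Haar measure need not be sigma-finite,
    this is proved by minimizing a uniformly convex functional instead of using
    densities. *)

(** * Characters of the integers *)

Section sine.
Context {R : realType}.
Implicit Types x : R.

Lemma sin_mvt x : 0 <= x -> exists2 c, 0 <= c <= x & sin x = cos c * x.
Proof.
move=> x0.
have [c cx] : exists2 c, c \in `[0, x] & sin x - sin 0 = cos c * (x - 0).
  by apply: MVT_segment => //; apply: continuous_subspaceT => y; exact: continuous_sin.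
rewrite sin0 !subr0 => ->; by exists c.
Qed.

Lemma ler_norm_sin x : `|sin x| <= `|x|.
Proof.
wlog x0 : x / 0 <= x.
  move=> h; have [/h//|/ltW x0] := leP 0 x.
  by rewrite -normrN -sinN -[leRHS]normrN; apply: h; rewrite oppr_ge0.
have [c _ ->] := sin_mvt x0.
by rewrite normrM ler_piMl// ler_norml cos_geN1 cos_le1.
Qed.

(** Doubling the angle turns [x / 2 <= sin x] into [1 / 2 <= cos y * cos c] for
    two angles below [pi / 4]. *)
Lemma ger_norm_sin x : `|x| <= pi / 2 -> `|x| / 2 <= `|sin x|.
Proof.
wlog x0 : x / 0 <= x.
  move=> h; have [/h//|/ltW x0] := leP 0 x.
  rewrite -[`|sin x|]normrN -sinN -[`|x|]normrN; apply: h.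
  by rewrite oppr_ge0.
rewrite ger0_norm// => xpi.
have pi0 := pi_gt0 R.
rewrite ger0_norm; last by apply: sin_ge0_pi; lra.
pose y := x / 2.
have y0 : 0 <= y by rewrite /y; lra.
have yp : y <= pi / 4 by rewrite /y; lra.
have cq : cos (pi / 4 : R) ^+ 2 = 1 / 2.
  have := cos_mulr2n (pi / 4 : R).
  rewrite (_ : (pi / 4 : R) *+ 2 = pi / 2); last by rewrite mulr2n; lra.
  by rewrite cos_pihalf mulr2n => h; lra.
have q0 : 0 <= cos (pi / 4 : R) by apply: cos_ge0_pihalf; lra.
have ccos c : 0 <= c -> c <= y -> cos (pi / 4) <= cos c.
  move=> c0 cy; rewrite leNgt; apply/negP.
  rewrite ltr_cos ?in_itv/=; [lra|apply/andP; split; lra|apply/andP; split; lra].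
have [c /andP[c0 cy] sy] := sin_mvt y0.
have -> : x = y *+ 2 by rewrite /y mulr2n; lra.
rewrite sin_mulr2n sy.
have h1 := ccos _ c0 cy; have h2 := ccos _ y0 (lexx y).
have : cos (pi / 4) ^+ 2 <= cos y * cos c.
  by rewrite expr2; apply: ler_pM.
rewrite cq => h3.
have : 1 / 2 * y <= (cos y * cos c) * y by rewrite ler_wpM2r.
rewrite !mulr2n -mulrA; lra.
Qed.

End sine.

Section complex_norm.
Context {R : realType}.
Implicit Types z : R[i].

Lemma normcC (x : R) : normc (x%:C : R[i]) = `|x|.
Proof. by rewrite /= expr0n/= addr0 sqrtr_sqr. Qed.

Lemma normc_sqr z : (normc z ^+ 2)%:C = z * z^*%C.
Proof. by rewrite -sqr_normc rmorphXn. Qed.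

Lemma normc_conj z : normc z^*%C = normc z.
Proof. by case: z => a b /=; rewrite sqrrN. Qed.

Lemma normcB z1 z2 : normc (z1 - z2) = normc (z2 - z1).
Proof. by rewrite -normcN opprB. Qed.

End complex_norm.

Section characters.
Context {R : realType}.
Local Notation C := R[i].

Definition cis (x : R) : C := cos x +i* sin x.

Lemma cisD x y : cis (x + y) = cis x * cis y.
Proof. by rewrite /cis sinD cosD; apply/eqP; rewrite eq_complex /=; apply/andP; split; apply/eqP; ring. Qed.

Lemma cis0 : cis 0 = 1. Proof. by rewrite /cis cos0 sin0. Qed.

Lemma normc_cis x : normc (cis x) = 1.
Proof. by rewrite /= cos2Dsin2 sqrtr1. Qed.

Lemma normc_cisB1 x : normc (cis x - 1) = 2 * `|sin (x / 2)|.
Proof.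
have -> : cis x - 1 = cis (x / 2) * ((sin (x / 2))%:C * (0 +i* 2)).
  rewrite {1}(splitr x) cisD /cis; have := cos2Dsin2 (x / 2).
  set c := cos _; set s := sin _ => h.
  apply/eqP; rewrite eq_complex /=; apply/andP; split; apply/eqP; last by ring.
  rewrite (_ : _ - 1 = c * c - s * s - (c ^+ 2 + s ^+ 2)); last by rewrite h.
  by ring.
rewrite 2!normcM normc_cis mul1r normcC mulrC; congr (_ * _).
by rewrite /= expr0n/= add0r sqrtr_sqr ger0_norm.
Qed.

(** The character of the integers sending 1 to [exp (2 i pi / M)]. *)
Definition chi (M : nat) (n : int) : C := cis (2 * pi * n%:~R / M%:R).

Lemma chiD M m n : chi M (m + n) = chi M m * chi M n.
Proof. by rewrite /chi -cisD; congr cis; rewrite intrD; ring. Qed.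

Lemma chi0 M : chi M 0 = 1.
Proof. by rewrite /chi mulr0 mul0r cis0. Qed.

Lemma normc_chi M n : normc (chi M n) = 1.
Proof. exact: normc_cis. Qed.

Lemma chi_conj M n : (chi M n)^*%C = chi M (- n).
Proof.
rewrite /chi /cis /= -cosN -sinN.
by rewrite (_ : - (2 * pi * n%:~R / M%:R) = 2 * pi * (- n)%:~R / M%:R)// intrN; ring.
Qed.

Lemma chi_unit M n : chi M n * chi M (- n) = 1.
Proof. by rewrite -chiD subrr chi0. Qed.

Lemma chiMM M n : (0 < M)%N -> chi M (M%:Z * n) = 1.
Proof.
move=> M0; rewrite /chi.
have -> : 2 * pi * (M%:Z * n)%:~R / M%:R = (pi *+ 2) *~ n :> R.
  rewrite intrM -mulrzl; field.
  by rewrite pnatr_eq0 -lt0n.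
have aux (m : nat) : cis ((pi *+ 2) *+ m) = 1.
  by elim: m => [|m IH]; rewrite ?mulr0n ?cis0// mulrS cisD IH /cis cos2pi sin2pi mulr1.
case: n => m; first exact: aux.
rewrite NegzE mulrNz; have := aux m.+1; set y := _ *+ m.+1 => hy.
have : cis (y + - y) = 1 by rewrite subrr cis0.
by rewrite cisD hy mul1r.
Qed.

Lemma chi_per M n k : (0 < M)%N -> chi M (n + M%:Z * k) = chi M n.
Proof. by move=> M0; rewrite chiD chiMM// mulr1. Qed.

Lemma chi_scale k M n : (0 < k)%N -> chi (k * M) (k%:Z * n) = chi M n.
Proof.
move=> k0; rewrite /chi; congr cis; rewrite natrM intrM.
have [->|M0] := eqVneq M 0%N; first by rewrite mulr0 invr0 !mulr0.
field; by rewrite !pnatr_eq0 M0 -lt0n.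
Qed.

Lemma chiB1_le M n : (0 < M)%N -> normc (chi M n - 1) <= 2 * pi * `|n|%:~R / M%:R.
Proof.
move=> M0; rewrite normc_cisB1.
have h := ler_norm_sin (2 * pi * n%:~R / M%:R / 2 : R).
apply: (@le_trans _ _ (2 * `|2 * pi * n%:~R / M%:R / 2|)); first by rewrite ler_pM2l.
rewrite !normrM !normfV (@ger0_norm _ 2)// (@ger0_norm _ pi) ?pi_ge0//.
by rewrite (@ger0_norm _ M%:R)// intr_norm; lra.
Qed.

Lemma chiB1_ge M n : (0 < M)%N -> 2 * `|n| <= M%:Z ->
  2 * `|n|%:~R / M%:R <= normc (chi M n - 1) :> R.
Proof.
move=> M0 nM; rewrite normc_cisB1.
have M0' : 0 < M%:R :> R by rewrite ltr0n.
set y : R := 2 * pi * n%:~R / M%:R / 2.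
have yE : `|y| = pi * (`|n|%:~R / M%:R).
  rewrite /y !normrM !normfV (@ger0_norm _ 2)// (@ger0_norm _ pi) ?pi_ge0//.
  by rewrite (@ger0_norm _ M%:R)// intr_norm; lra.
have nM' : `|n|%:~R / M%:R <= 1 / 2 :> R.
  have : ((2 * `|n|)%:~R <= (M%:Z)%:~R :> R) by rewrite ler_int.
  rewrite intrM => h; rewrite ler_pdivrMr//; lra.
have pi0 := pi_gt0 R; have pi2 := pi_ge2 R.
have h : `|y| <= pi / 2.
  by rewrite yE; have := ler_wpM2l (ltW pi0) nM'; lra.
have := ger_norm_sin h; rewrite yE -[_ * _ / _ in X in _ -> X]mulrA.
set r : R := `|n|%:~R / M%:R => h1.
have r0 : 0 <= r by rewrite divr_ge0// ler0z.
have : 2 * r <= pi * r by rewrite ler_wpM2r.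
by lra.
Qed.

Lemma chi_neq1 M n : (0 < M)%N -> ~~ (M%:Z %| n)%Z -> chi M n != 1.
Proof.
move=> M0 nM.
have Mz : M%:Z != 0 by rewrite -lt0n.
rewrite (divz_eq n M%:Z) mulrC addrC chi_per//.
set r := (n %% M%:Z)%Z.
have r0 : 0 <= r by exact: modz_ge0.
have rM : r < M%:Z by rewrite ltz_mod.
have rn0 : r != 0 by apply: contra nM => /eqP h; apply/dvdz_mod0P.
rewrite -subr_eq0; apply/eqP => h.
have := normc0 R; rewrite -h normc_cisB1 => /eqP.
rewrite mulf_eq0 pnatr_eq0/= normr_eq0 => /eqP; apply/eqP; rewrite gt_eqF//.
have M0' : 0 < M%:R :> R by rewrite ltr0n.
apply: sin_gt0_pi.
have -> : 2 * pi * r%:~R / M%:R / 2 = pi * (r%:~R / M%:R) :> R by lra.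
have pi0 := pi_gt0 R.
have rgt0 : 0 < r by rewrite lt_neqAle eq_sym rn0.
rewrite mulr_gt0//= ?divr_gt0 ?ltr0z//.
have : r%:~R / M%:R < 1 :> R by rewrite ltr_pdivrMr// mul1r -[M%:R]/((M%:Z)%:~R) ltr_int.
by rewrite -(@ltr_pM2l _ pi)// mulr1.
Qed.

End characters.

(** * Finite Fourier analysis *)

Section window_sums.
Variable H : nat.

(** [wix i] runs through the window [-H, H) of integers, a centred set of
    representatives modulo [H.*2]. *)
Definition wix (i : 'I_(H.*2)) : int := i%:Z - H%:Z.

Definition psum (V : zmodType) (F : int -> V) : V := \sum_(i < H.*2) F (wix i).

Definition periodic_int (V : Type) (F : int -> V) : Prop :=
  forall n, F (n + (H.*2)%:Z) = F n.

Lemma wix_bound i : 2 * `|wix i| <= (H.*2)%:Z.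
Proof. by rewrite /wix; case: i => i /= iH; lia. Qed.

Lemma psumD (V : zmodType) (F G : int -> V) :
  psum (fun n => F n + G n) = psum F + psum G.
Proof. exact: big_split. Qed.

Lemma psumB (V : zmodType) (F G : int -> V) :
  psum (fun n => F n - G n) = psum F - psum G.
Proof. by rewrite /psum sumrB. Qed.

Lemma eq_psum (V : zmodType) (F G : int -> V) : F =1 G -> psum F = psum G.
Proof. by move=> FG; apply: eq_bigr => i _. Qed.

Lemma psum_shift (V : zmodType) (F : int -> V) a : periodic_int F ->
  psum (fun n => F (n + a)) = psum F.
Proof.
have s1 (G : int -> V) : periodic_int G -> psum (fun n => G (n + 1)) = psum G.
  move=> pG; rewrite /psum /wix.
  have -> : \sum_(i < H.*2) G (i%:Z - H%:Z + 1) =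
            \sum_(0 <= i < H.*2) G (i.+1%:Z - H%:Z).
    by rewrite big_mkord; apply: eq_bigr => i _; congr G; lia.
  have -> : \sum_(i < H.*2) G (i%:Z - H%:Z) = \sum_(0 <= i < H.*2) G (i%:Z - H%:Z).
    by rewrite big_mkord.
  have [->|H0] := posnP H; first by rewrite !big_geq.
  have H2 : (0 < H.*2)%N by rewrite double_gt0.
  rewrite -[in LHS](prednK H2) -[in RHS](prednK H2) big_nat_recr//= big_nat_recl//=.
  rewrite addrC; congr (_ + _).
  by rewrite (prednK H2) -(pG (0%:Z - H%:Z)); congr G; lia.
move=> pF.
have sn (m : nat) (G : int -> V) : periodic_int G -> psum (fun n => G (n + m%:Z)) = psum G.
  elim: m G => [|m IH] G pG; first by apply: eq_psum => n; rewrite addr0.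
  rewrite -(s1 G)// -(IH (fun n => G (n + 1))); last by move=> n; rewrite -addrA (addrC _ 1) addrA pG.
  by apply: eq_psum => n; congr G; lia.
case: a => m; first exact: sn.
rewrite -(sn m.+1 (fun n => F (n + Negz m))); last first.
  by move=> n; rewrite -addrA (addrC _ (Negz m)) addrA pF.
by apply: eq_psum => n; congr F; lia.
Qed.

Lemma psum_opp (V : zmodType) (F : int -> V) : periodic_int F ->
  psum (fun n => F (- n)) = psum F.
Proof.
move=> pF; rewrite -[RHS](@psum_shift _ F (1))// /psum (reindex_inj rev_ord_inj).
apply: eq_bigr => i _; congr F; rewrite /wix /=.
by case: i => i /= iH; lia.
Qed.

End window_sums.

Section finite_fourier.
Context {R : realType}.
Local Notation C := R[i].
Variables (H : nat).
Hypothesis H0 : (0 < H)%N.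
Local Notation M := (H.*2).

Let M0 : (0 < M)%N. Proof. by rewrite double_gt0. Qed.

Lemma psum_chi x : psum H (fun n => chi M (x * n) : C) =
  if (M%:Z %| x)%Z then M%:R else 0.
Proof.
case: ifPn => [/dvdzP[q ->]|Mx].
  rewrite (@eq_psum _ _ _ (fun=> 1)); last first.
    by move=> n; rewrite mulrAC mulrC chiMM.
  by rewrite /psum sumr_const card_ord.
have /eqP : psum H (fun n => chi M (x * n) : C) * chi M x =
    psum H (fun n => chi M (x * n) : C).
  rewrite -[RHS](@psum_shift _ _ _ 1); last first.
    by move=> n; rewrite mulrDr (mulrC x M%:Z) chi_per.
  rewrite /psum mulr_suml; apply: eq_bigr => i _.
  by rewrite -chiD; congr chi; ring.
rewrite -subr_eq0 -{2}[psum _ _]mulr1 -mulrBr mulf_eq0 => /orP[/eqP//|].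
by rewrite subr_eq0 (negbTE (chi_neq1 M0 Mx)).
Qed.

(** A trigonometric sum with frequencies in the block [a, a + L). *)
Definition trig (a : int) (L : nat) (u : 'I_L -> C) (n : int) : C :=
  \sum_(i < L) u i * chi M ((a + i%:Z) * n).

(** The frequencies of the block are distinct modulo [M], so the characters
    involved are orthogonal by [psum_chi]. *)
Lemma parseval a L (u : 'I_L -> C) : (L <= M)%N ->
  psum H (fun n => normc (trig a u n) ^+ 2) = M%:R * \sum_(i < L) normc (u i) ^+ 2.
Proof.
move=> LM.
suff : psum H (fun n => trig a u n * (trig a u n)^*%C) =
       M%:R * \sum_(i < L) (u i * (u i)^*%C).
  under eq_psum do rewrite -normc_sqr.
  have -> : \sum_(i < L) (u i * (u i)^*%C) = (\sum_(i < L) normc (u i) ^+ 2)%:C.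
    by rewrite rmorph_sum /=; apply: eq_bigr => i _; rewrite normc_sqr.
  rewrite (_ : psum H _ = (psum H (fun n => normc (trig a u n) ^+ 2))%:C); last first.
    by rewrite /psum rmorph_sum.
  move=> h; suff [] : (psum H (fun n => normc (trig a u n) ^+ 2))%:C =
    (M%:R * \sum_(i < L) normc (u i) ^+ 2)%:C by [].
  by rewrite h rmorphM/= rmorph_nat.
have E n : trig a u n * (trig a u n)^*%C =
    \sum_(i < L) \sum_(j < L) u i * (u j)^*%C * chi M ((i%:Z - j%:Z) * n).
  rewrite /trig rmorph_sum mulr_suml; apply: eq_bigr => i _.
  rewrite mulr_sumr; apply: eq_bigr => j _.
  rewrite -[X in _ * X = _]/((u j * chi M ((a + j%:Z) * n))^*%C).
  have cM (z1 z2 : C) : (z1 * z2)^*%C = z1^*%C * z2^*%C by exact: rmorphM.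
  rewrite cM chi_conj.
  rewrite (_ : (i%:Z - j%:Z) * n = (a + i%:Z) * n - (a + j%:Z) * n); last by ring.
  by rewrite chiD; ring.
under eq_psum do rewrite E.
rewrite /psum.
rewrite exchange_big/= mulr_sumr; apply: eq_bigr => i _.
rewrite exchange_big/= (bigD1 i)//= [X in _ + X]big1 ?addr0 => [|j ji].
  rewrite -mulr_sumr; have := psum_chi (i%:Z - i%:Z).
  by rewrite /psum => ->; rewrite subrr dvdz0 mulrC.
rewrite -mulr_sumr; have := psum_chi (i%:Z - j%:Z); rewrite /psum => ->.
case: ifPn => [|_]; last by rewrite mulr0.
move=> /dvdzP[q hq]; exfalso; move: ji => /eqP; apply; apply/val_inj.
have iL := ltn_ord i; have jL := ltn_ord j.
have q0 : q = 0 by nia.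
by move: hq; rewrite q0 mul0r /=; lia.
Qed.

Definition blk (a : int) (L : nat) : int -> C := trig a (fun _ : 'I_L => 1).

Lemma trig_periodic a L (u : 'I_L -> C) : periodic_int H (trig a u).
Proof.
move=> n; rewrite /trig; apply: eq_bigr => i _; congr (_ * _).
by rewrite mulrDr (mulrC _ M%:Z) chi_per.
Qed.

Lemma blk_periodic a L : periodic_int H (blk a L).
Proof. exact: trig_periodic. Qed.

Lemma parseval_blk a L : (L <= M)%N ->
  psum H (fun n => normc (blk a L n) ^+ 2) = M%:R * L%:R.
Proof.
move=> LM; rewrite parseval//; congr (_ * _).
by under eq_bigr do rewrite normc1 expr1n; rewrite sumr_const card_ord.
Qed.

Lemma blk_telescope a L n :
  blk a L n * (chi M n - 1) = chi M ((a + L%:Z) * n) - chi M (a * n).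
Proof.
rewrite /blk /trig; elim: L => [|L IH]; first by rewrite big_ord0 mul0r addr0 subrr.
rewrite big_ord_recr/= mulrDl IH mul1r.
rewrite (_ : (a + L.+1%:Z) * n = (a + L%:Z) * n + n); last by rewrite -addn1 PoszD; ring.
by rewrite chiD; ring.
Qed.

(** A geometric sum: multiplied by the common ratio minus 1, it telescopes. *)
Lemma blk_decay a L n : normc (blk a L n) * normc (chi M n - 1 : C) <= 2.
Proof.
rewrite -normcM blk_telescope (le_trans (le_normcD _ _))//.
by rewrite normcN !normc_chi.
Qed.

Lemma trigB1 a L n : blk a L n - blk a L (n - 1) =
  trig a (fun i : 'I_L => 1 - chi M (- (a + i%:Z))) n.
Proof.
rewrite /blk /trig -sumrB; apply: eq_bigr => i _.
rewrite (_ : (a + i%:Z) * (n - 1) = (a + i%:Z) * n - (a + i%:Z)); last by ring.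
by rewrite chiD; ring.
Qed.

Lemma parseval_blkB a L B : (L <= M)%N ->
  (forall i, (i < L)%N -> `|a + i%:Z| <= B%:Z) ->
  psum H (fun n => normc (blk a L n - blk a L (n - 1)) ^+ 2) <=
  M%:R * L%:R * (2 * pi * B%:R / M%:R) ^+ 2.
Proof.
move=> LM LB; under eq_psum do rewrite trigB1.
rewrite parseval// -mulrA ler_pM2l ?ltr0n//.
apply: (@le_trans _ _ (\sum_(i < L) (2 * pi * B%:R / M%:R) ^+ 2)); last first.
  by rewrite sumr_const card_ord -[X in X <= _]mulr_natl.
apply: ler_sum => i _.
rewrite ler_sqr ?nnegrE ?normc_ge0//; last first.
  by rewrite !mulr_ge0 ?pi_ge0// ?ler0n// invr_ge0.
rewrite normcB; apply: le_trans (chiB1_le _ M0) _.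
rewrite ler_pM2r ?invr_gt0 ?ltr0n// ler_pM2l ?mulr_gt0 ?pi_gt0// normrN.
by rewrite -[B%:R]/((B%:Z)%:~R) ler_int LB.
Qed.

(** The Fourier coefficients, on the group of [M]-th roots of unity, of the
    normalized correlation of the blocks [a, a + L) and [b, b + L'): a
    triangle when [L = L'], a trapezoid in general. *)
Definition kf a L b L' (n : int) : C :=
  (M%:R * L'%:R)^-1%:C * (blk a L n * (blk b L' n)^*%C).

Lemma kf_periodic a L b L' : periodic_int H (kf a L b L').
Proof. by move=> n; rewrite /kf !blk_periodic. Qed.

Let normc_scale (x : R) : 0 <= x -> normc (x%:C : C) = x.
Proof. by move=> x0; rewrite normcC ger0_norm. Qed.

Lemma normc_kf a L b L' n : normc (kf a L b L' n) =
  (M%:R * L'%:R)^-1 * (normc (blk a L n) * normc (blk b L' n)).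
Proof. by rewrite /kf !normcM normc_scale ?normc_conj// invr_ge0 mulr_ge0. Qed.

(** The sum evaluates at [x] the function with Fourier coefficients [kf]: the
    proportion of the block [x + b, x + b + L') covered by [a, a + L). *)
Lemma kf_one a L b L' (x : int) : (L <= M)%N -> (0 < L')%N ->
  (forall j, (j < L')%N -> a <= x + b + j%:Z < a + L%:Z) ->
  psum H (fun n => kf a L b L' n * chi M (- x * n)) = 1.
Proof.
move=> LM L0 xab.
have E n : kf a L b L' n * chi M (- x * n) = (M%:R * L'%:R)^-1%:C *
    \sum_(j < L') \sum_(i < L) chi M ((a + i%:Z - (x + b + j%:Z)) * n).
  rewrite /kf -mulrA; congr (_ * _).
  rewrite /blk /trig rmorph_sum mulr_sumr mulr_suml; apply: eq_bigr => j _.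
  rewrite mulr_suml mulr_suml; apply: eq_bigr => i _.
  rewrite -[X in _ * X * _]/((1 * chi M ((b + j%:Z) * n))^*%C) !mul1r chi_conj -!chiD; congr chi; ring.
under eq_psum do rewrite E.
rewrite /psum -mulr_sumr exchange_big/= (eq_bigr (fun=> M%:R)) => [|j _].
  rewrite sumr_const card_ord -[X in _ * X = _]mulr_natr.
  have -> : M%:R * L'%:R = (M%:R * L'%:R : R)%:C :> C by rewrite rmorphM/= !rmorph_nat.
  rewrite -rmorphM mulVf ?rmorph1// mulf_neq0// pnatr_eq0 -lt0n//.
rewrite exchange_big/=.
have [/andP[jl jr]] := (xab j (ltn_ord j)).
have [k kE iL] : exists2 k : nat, k%:Z = x + b + j%:Z - a & (k < L)%N.
  by case E' : (x + b + j%:Z - a) => [k|k]; [exists k|exists 0%N]; lia.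
rewrite (bigD1 (Ordinal iL))//= [X in _ + X]big1 ?addr0 => [|i ji].
  have := psum_chi (a + k%:Z - (x + b + j%:Z)).
  rewrite /psum => ->; rewrite (_ : _ - _ = 0) ?dvdz0//.
  by rewrite kE; ring.
have := psum_chi (a + i%:Z - (x + b + j%:Z)); rewrite /psum => ->.
case: ifPn => // /dvdzP[q hq]; exfalso; move: ji => /eqP; apply; apply/val_inj.
have iL' := ltn_ord i.
have q0 : q = 0 by nia.
by move: hq; rewrite q0 mul0r /=; lia.
Qed.

(** Parseval for the two blocks, after bounding their products by half the sum
    of their squares. *)
Lemma kf_l1 a L b L' : (L <= M)%N -> (L' <= M)%N -> (0 < L')%N ->
  psum H (fun n => normc (kf a L b L' n)) <= (L%:R / L'%:R + 1) / 2.
Proof.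
move=> LM LM' L0.
have M0' : 0 < M%:R :> R by rewrite ltr0n.
have L0' : 0 < L'%:R :> R by rewrite ltr0n.
apply: (@le_trans _ _ (psum H (fun n => (M%:R * L'%:R)^-1 / 2 *
    (normc (blk a L n) ^+ 2 + normc (blk b L' n) ^+ 2)))).
  apply: ler_sum => i _; rewrite normc_kf -mulrA ler_pM2l ?invr_gt0 ?mulr_gt0//.
  set s := normc _; set t := normc _.
  by have := sqr_ge0 (s - t); nra.
rewrite /psum -mulr_sumr big_split/=.
have := parseval_blk a LM; have := parseval_blk b LM'; rewrite /psum => -> ->.
by rewrite le_eqVlt; apply/orP; left; apply/eqP; field; rewrite !gt_eqF.
Qed.

(** Both factors of [kf] are geometric sums, each of order [M / n]. *)
Lemma kf_decay a L b L' n : (0 < L')%N -> 2 * `|n| <= M%:Z ->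
  normc (kf a L b L' n) * `|n|%:~R ^+ 2 <= M%:R / L'%:R.
Proof.
move=> L0 nM.
have M0' : 0 < M%:R :> R by rewrite ltr0n.
have L0' : 0 < L'%:R :> R by rewrite ltr0n.
have := @chiB1_ge R _ _ M0 nM; have := blk_decay a L n; have := blk_decay b L' n.
rewrite normc_kf; move: (normc_ge0 (blk a L n)) (normc_ge0 (blk b L' n)).
set s := normc (blk a L n); set t := normc (blk b L' n).
set c := normc (chi M n - 1) => s0 t0 tc sc nc.
have n0 : 0 <= `|n|%:~R :> R by rewrite ler0z.
set m := `|n|%:~R in nc n0 *.
have sm : s * m <= M%:R.
  have : s * (2 * m / M%:R) <= 2 by apply: le_trans sc; rewrite ler_wpM2l.
  by rewrite mulrA ler_pdivrMr//; lra.
have tm : t * m <= M%:R.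
  have : t * (2 * m / M%:R) <= 2 by apply: le_trans tc; rewrite ler_wpM2l.
  by rewrite mulrA ler_pdivrMr//; lra.
have -> : (M%:R * L'%:R)^-1 * (s * t) * m ^+ 2 =
  (M%:R * L'%:R)^-1 * ((s * m) * (t * m)) by ring.
have -> : M%:R / L'%:R = (M%:R * L'%:R)^-1 * (M%:R * M%:R) :> R.
  by field; rewrite !gt_eqF.
by rewrite ler_pM2l ?invr_gt0 ?mulr_gt0// ler_pM// mulr_ge0.
Qed.

(** Bounding the products by the weighted AM-GM inequality, with weights
    balancing the two norms given by Parseval. *)
Lemma kf_tv a L b L' B B' : (L <= M)%N -> (L' <= M)%N -> (0 < L)%N -> (0 < L')%N ->
  (0 < B)%N -> (0 < B')%N -> forall w : R, 0 < w -> w ^+ 2 = L%:R / L'%:R ->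
  (forall i, (i < L)%N -> `|a + i%:Z| <= B%:Z) ->
  (forall i, (i < L')%N -> `|b + i%:Z| <= B'%:Z) ->
  psum H (fun n => normc (kf a L b L' n - kf a L b L' (n - 1))) <=
  w * (2 * pi * (B%:R + B'%:R) / M%:R).
Proof.
move=> LM LM' L0 L0' B0 B0' w w0 wE LB LB'.
have M0' : 0 < M%:R :> R by rewrite ltr0n.
have l0 : 0 < L%:R :> R by rewrite ltr0n.
have l0' : 0 < L'%:R :> R by rewrite ltr0n.
have pi0 := pi_gt0 R.
set x : R := 2 * pi * B%:R / M%:R; set y : R := 2 * pi * B'%:R / M%:R.
have x0 : 0 < x by rewrite !mulr_gt0 ?invr_gt0 ?ltr0n.
have y0 : 0 < y by rewrite !mulr_gt0 ?invr_gt0 ?ltr0n.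
set k : R := (M%:R * L'%:R)^-1.
have k0 : 0 < k by rewrite invr_gt0 mulr_gt0.
set s := blk a L; set t := blk b L'.
pose F n := k * (1 / (2 * (w * x)) * normc (s n - s (n - 1)) ^+ 2 + w * x / 2 * normc (t n) ^+ 2) +
            k * (y / (2 * w) * normc (s (n - 1)) ^+ 2 + w / (2 * y) * normc (t n - t (n - 1)) ^+ 2).
have amgm (c u v : R) : 0 < c -> u * v <= 1 / (2 * c) * u ^+ 2 + c / 2 * v ^+ 2.
  move=> c0; rewrite -subr_ge0.
  have -> : 1 / (2 * c) * u ^+ 2 + c / 2 * v ^+ 2 - u * v =
            (u - c * v) ^+ 2 / (2 * c) by field; rewrite gt_eqF.
  by rewrite divr_ge0 ?sqr_ge0// mulr_ge0// ltW.
apply: (@le_trans _ _ (psum H F)).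
  apply: ler_sum => i _; set n := wix i; rewrite /kf -/s -/t -/k.
  have -> : k%:C * (s n * (t n)^*%C) - k%:C * (s (n - 1) * (t (n - 1))^*%C) =
    k%:C * ((s n - s (n - 1)) * (t n)^*%C) + k%:C * (s (n - 1) * (t n - t (n - 1))^*%C).
    by rewrite rmorphB/=; ring.
  apply: (le_trans (le_normcD _ _)); rewrite !normcM !normc_scale ?(ltW k0)// !normc_conj.
  apply: lerD; rewrite ler_pM2l//; first exact/amgm/mulr_gt0.
  have := @amgm (w / y) (normc (s (n - 1))) (normc (t n - t (n - 1))) (divr_gt0 w0 y0).
  have -> : 1 / (2 * (w / y)) = y / (2 * w) by field; rewrite !gt_eqF.
  by have -> : w / y / 2 = w / (2 * y) by field; rewrite gt_eqF.
rewrite /F psumD /psum -!mulr_sumr !big_split/= -!mulr_sumr.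
have := parseval_blkB LM LB; have := parseval_blkB LM' LB'.
have := parseval_blk a LM; have := parseval_blk b LM'.
have <- := @psum_shift H _ (fun n => normc (blk a L n) ^+ 2) (- 1); last first.
  by move=> n; rewrite blk_periodic.
rewrite /psum -/s -/t -/x -/y.
move: (\sum_(i < M) _) => e1.
move: (\sum_(i < M) _) => e2.
move: (\sum_(i < M) _) => e3.
move: (\sum_(i < M) _) => e4.
move=> -> -> h3 h4.
have -> : w * (2 * pi * (B%:R + B'%:R) / M%:R) = w * x + w * y.
  by rewrite /x /y; field; rewrite gt_eqF.
have LE : L%:R = w ^+ 2 * L'%:R :> R by rewrite wE divfK// gt_eqF.
have p1 : 1 / (2 * (w * x)) * e4 <= w * x / 2 * (M%:R * L'%:R).
  apply: (@le_trans _ _ (1 / (2 * (w * x)) * (M%:R * L%:R * x ^+ 2))).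
    by apply: ler_wpM2l h4; rewrite divr_ge0// ltW// mulr_gt0// mulr_gt0.
  by rewrite LE le_eqVlt; apply/orP; left; apply/eqP; field; rewrite !gt_eqF.
have p2 : w / (2 * y) * e3 <= w * y / 2 * (M%:R * L'%:R).
  apply: (@le_trans _ _ (w / (2 * y) * (M%:R * L'%:R * y ^+ 2))).
    by apply: ler_wpM2l h3; rewrite divr_ge0// ltW// mulr_gt0// mulr_gt0.
  by rewrite le_eqVlt; apply/orP; left; apply/eqP; field; rewrite !gt_eqF.
have p3 : y / (2 * w) * (M%:R * L%:R) = w * y / 2 * (M%:R * L'%:R).
  by rewrite LE; field; rewrite !gt_eqF.
apply: lerD.
  apply: (@le_trans _ _ (k * (w * x * (M%:R * L'%:R)))); first by rewrite ler_pM2l//; lra.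
  by rewrite le_eqVlt /k; apply/orP; left; apply/eqP; field; rewrite !gt_eqF.
apply: (@le_trans _ _ (k * (w * y * (M%:R * L'%:R)))); first by rewrite ler_pM2l//; lra.
by rewrite le_eqVlt /k; apply/orP; left; apply/eqP; field; rewrite !gt_eqF.
Qed.

End finite_fourier.

Section doubling.
Context {R : realType}.
Local Notation C := R[i].
Variable H : nat.
Hypothesis H0 : (0 < H)%N.
Local Notation M := (H.*2).

Let M0 : (0 < M)%N. Proof. by rewrite double_gt0. Qed.

Lemma chi_half : chi M.*2 M%:Z = -1 :> C.
Proof.
rewrite /chi; have -> : 2 * pi * (M%:Z)%:~R / (M.*2)%:R = pi :> R.
  rewrite -[M.*2]muln2 natrM -[(M%:Z)%:~R]/(M%:R); field.
  by rewrite pnatr_eq0 -lt0n.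
by rewrite /cis cospi sinpi; apply/eqP; rewrite eq_complex/= oppr0 !eqxx.
Qed.

Lemma blk_double a L n :
  blk M (2 * a) L.*2 n = (1 + chi M.*2 n) * blk H a L n :> C.
Proof.
rewrite /blk /trig; elim: L => [|L IH]; first by rewrite !big_ord0 mulr0.
rewrite doubleS !big_ord_recr/= IH !mul1r mulrDr -addrA; congr (_ + _).
have -> : (2 * a + L.*2%:Z) * n = 2%:Z * ((a + L%:Z) * n) by rewrite -muln2 PoszM; ring.
have -> : (2 * a + L.*2.+1%:Z) * n = 2%:Z * ((a + L%:Z) * n) + n.
  have -> : L.*2.+1%:Z = 2%:Z * L%:Z + 1 by lia.
  by ring.
by rewrite chiD -[M.*2]mul2n chi_scale//; ring.
Qed.

(** Sampling the same shape on the [M]-th roots of unity instead of the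
    [M.*2]-th ones folds the two aliased coefficients together. *)
Lemma kf_double a L b L' n :
  kf M (2 * a) L.*2 (2 * b) L'.*2 n + kf M (2 * a) L.*2 (2 * b) L'.*2 (n + M%:Z) =
  kf H a L b L' n :> C.
Proof.
rewrite /kf !blk_double !blk_periodic// chiD chi_half.
set w := chi M.*2 n; set s := blk H a L n; set t := blk H b L' n.
have cM (z1 z2 : C) : (z1 * z2)^*%C = z1^*%C * z2^*%C by exact: rmorphM.
have cD (z1 z2 : C) : (z1 + z2)^*%C = z1^*%C + z2^*%C by exact: rmorphD.
have w1 : w * w^*%C = 1 by rewrite /w chi_conj chi_unit.
rewrite !cM !cD cM.
have -> : (1 : C)^*%C = 1 by exact: rmorph1.
have -> : (-1 : C)^*%C = -1 by exact: rmorphN1.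
have -> : ((M.*2)%:R * (L'.*2)%:R)^-1%:C = 4^-1 * (M%:R * L'%:R)^-1%:C :> C.
  rewrite (_ : 4^-1 = (4^-1)%:C) -?rmorphM/=; last by rewrite fmorphV rmorph_nat.
  congr (_%:C); rewrite -!muln2 !natrM -invfM; congr (_^-1); ring.
set c := (_)%:C.
have -> : 4^-1 * c * ((1 + w) * s * ((1 + w^*%C) * t^*%C)) +
  4^-1 * c * ((1 + w * -1) * s * ((1 + w^*%C * -1) * t^*%C)) =
  c * (s * t^*%C) * ((1 + w * w^*%C) / 2).
  have h4 : 4^-1 * 2 = 2^-1 :> C.
    by rewrite (_ : 4 = 2 * 2) ?invfM ?divfK ?pnatr_eq0// -natrM.
  by rewrite -h4; ring.
by rewrite w1 divff ?mulr1// pnatr_eq0.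
Qed.

End doubling.

Section periodic_closure.
Variables (H : nat) (V : zmodType) (A : pzRingType).

Lemma periodicB (F G : int -> V) : periodic_int H F -> periodic_int H G ->
  periodic_int H (fun n => F n - G n).
Proof. by move=> pF pG n; rewrite pF pG. Qed.

Lemma periodicM (F G : int -> A) : periodic_int H F -> periodic_int H G ->
  periodic_int H (fun n => F n * G n).
Proof. by move=> pF pG n; rewrite pF pG. Qed.

Lemma periodic_shift (T : Type) (F : int -> T) a : periodic_int H F ->
  periodic_int H (fun n => F (n + a)).
Proof. by move=> pF n; rewrite addrAC pF. Qed.

Lemma periodic_refl (T : Type) (F : int -> T) a : periodic_int H F ->
  periodic_int H (fun n => F (a - n)).
Proof. by move=> pF n; rewrite -(pF (a - (n + _))) opprD addrA addrNK. Qed.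

End periodic_closure.

Section periodic_delta.
Context {R : realType}.
Local Notation C := R[i].
Variable H : nat.
Hypothesis H0 : (0 < H)%N.
Local Notation M := (H.*2).

Definition pdelta (n : int) : C := if (M%:Z %| n)%Z then 1 else 0.

Lemma pdelta_periodic : periodic_int H pdelta.
Proof. by move=> n; rewrite /pdelta rpredDr ?dvdzz. Qed.

Lemma pdelta_window n : `|n| < M%:Z -> pdelta n = (n == 0)%:R.
Proof.
move=> nM; rewrite /pdelta; case: ifPn => [/dvdzP[q qE]|].
  have q0 : q = 0 by nia.
  by rewrite qE q0 mul0r eqxx.
by case: eqVneq => // ->; rewrite dvdz0.
Qed.

Lemma psum_pdelta (V : lmodType C) (F : int -> V) (a : int) : periodic_int H F ->
  psum H (fun n => pdelta (n - a) *: F n) = F a.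
Proof.
move=> pF.
have -> : psum H (fun n => pdelta (n - a) *: F n) =
          psum H (fun n => pdelta n *: F (n + a)).
  rewrite -(@psum_shift H _ (fun n => pdelta (n - a) *: F n) a).
    by apply: eq_psum => n; rewrite addrK.
  by move=> n; rewrite pF addrAC pdelta_periodic.
have Hlt : (H < M)%N by rewrite -addnn; lia.
rewrite /psum (bigD1 (Ordinal Hlt))//= big1 ?addr0 => [|i iH].
  by rewrite /wix/= subrr /pdelta dvdz0 scale1r add0r.
rewrite pdelta_window.
  case: eqVneq => [w0|]; last by rewrite scale0r.
  by move: iH => /eqP; case; apply/val_inj => /=; move: w0; rewrite /wix; lia.
by have := wix_bound i; lia.
Qed.

End periodic_delta.

(** * Triangle and trapezoid kernels *)

Section tails.
Context {R : realType}.
Variable H : nat.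

(** If neither [m] nor [n] is far from 0, then [m + n] stays in the window. *)
Definition far (n : int) : bool := H%:Z <= 2 * `|n|.

Definition tail (F : int -> R[i]) : R :=
  psum H (fun n => if far n then normc (F n) else 0).

End tails.

Section kernels.
Context {R : realType}.
Local Notation C := R[i].
Variables N' K : nat.
Hypothesis N4 : (4 <= N')%N.
Hypothesis K0 : (0 < K)%N.

Local Notation H := (N' * K)%N.
Local Notation M := (H.*2).
Local Notation N := (N'.*2).

Let H0 : (0 < H)%N. Proof. by rewrite muln_gt0 K0 (leq_trans _ N4). Qed.
Let M0 : (0 < M)%N. Proof. by rewrite double_gt0. Qed.
Let N0 : (0 < N)%N. Proof. by rewrite double_gt0 (leq_trans _ N4). Qed.
Let K1M : (K <= M)%N. Proof. by nia. Qed.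
Let K2M : (2 * K <= M)%N. Proof. by nia. Qed.
Let K3M : (3 * K <= M)%N. Proof. by nia. Qed.
Let K8M : (8 * K <= M)%N. Proof. by nia. Qed.

(** With [N = N'.*2] arcs of length [K] around the [M]-th roots of unity, [kphi]
    are the coefficients of a triangle supported by the two arcs next to 1, and
    [kpsi] those of a trapezoid equal to 1 on them. The trapezoid of [kvee]
    equals 1 on the differences of a point of the support of the former and one
    of the support of the latter; its coefficients have small variation when
    [N'] is large. *)
Definition kphi : int -> C := kf H 0 K 0 K.
Definition kpsi : int -> C := kf H (- K%:Z) (3 * K) 0 K.
Definition kvee : int -> C := kf H (- (4 * K)%:Z) (8 * K) (- K%:Z) (2 * K).

Definition kq n : C := pdelta H n - kpsi n.
(** The coefficients of the trapezoid of [kvee] times [z - 1]. Hence [kh], with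
    the coefficients of [z - 1] minus those of [kw], corresponds to a function
    vanishing where that trapezoid equals 1. *)
Definition kw n : C := kvee (n - 1) - kvee n.
Definition kh n : C := pdelta H (n - 1) - pdelta H n - kw n.

Lemma kphi_periodic : periodic_int H kphi. Proof. exact: kf_periodic. Qed.
Lemma kpsi_periodic : periodic_int H kpsi. Proof. exact: kf_periodic. Qed.
Lemma kvee_periodic : periodic_int H kvee. Proof. exact: kf_periodic. Qed.
Lemma kq_periodic : periodic_int H kq.
Proof. apply: periodicB; [exact: pdelta_periodic|exact: kpsi_periodic]. Qed.
Lemma kw_periodic : periodic_int H kw.
Proof. apply: periodicB; [exact/periodic_shift/kvee_periodic|exact: kvee_periodic]. Qed.
Lemma kh_periodic : periodic_int H kh.
Proof.
apply: periodicB; last exact: kw_periodic.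
by apply: periodicB; [exact/periodic_shift/pdelta_periodic|exact: pdelta_periodic].
Qed.

(** Summing over the rotations by the [N]-th roots of unity keeps only the
    multiples of [N]; at these, the geometric sum in [kphi] runs over whole
    periods and vanishes, unless the index is 0. *)
Lemma kphi_partition n : 2 * `|n| <= M%:Z ->
  psum N' (fun j => chi N (n * j) * kphi n) = (n == 0)%:R.
Proof.
move=> nM; rewrite /psum -mulr_suml.
have := @psum_chi R N' (leq_trans (isT : 0 < 4)%N N4) n; rewrite /psum => ->.
case: ifPn => [/dvdzP[q nE]|nN]; last first.
  by case: eqVneq nN => [->|_ _]; rewrite ?dvdz0// mul0r.
have [n0|n0] := eqVneq n 0.
  rewrite n0 /kphi /kf /blk /trig.
  rewrite (eq_bigr (fun=> 1)) => [|i _]; last by rewrite mulr0 chi0 mul1r.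
  rewrite sumr_const card_ord.
  have -> : (K%:R : C)^*%C = K%:R by exact: rmorph_nat.
  rewrite fmorphV rmorphM/= !rmorph_nat -[M]muln2 -[N]muln2 !natrM.
  by field; rewrite !pnatr_eq0 -!lt0n K0/=; lia.
suff -> : kphi n = 0 by rewrite mulr0.
have : blk H 0 K n * (chi M n - 1) = 0 :> C.
  rewrite blk_telescope mul0r chi0 add0r.
  have -> : M = (K * N)%N by rewrite -!muln2; lia.
  by rewrite chi_scale// nE mulrC chiMM// subrr.
move=> /eqP; rewrite mulf_eq0 subr_eq0.
have /negbTE -> : chi M n != 1 :> C.
  apply: chi_neq1 => //; apply/negP => /dvdzP[r rE].
  have r0 : r = 0 by nia.
  by move: n0; rewrite rE r0 mul0r eqxx.
by rewrite orbF => /eqP b0; rewrite /kphi /kf b0 mul0r mulr0.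
Qed.

Lemma kpsi_one (x : int) : `|x| < K%:Z ->
  psum H (fun n => kpsi n * chi M (- x * n)) = 1.
Proof. by move=> xK; apply: kf_one => // j jK; lia. Qed.

Lemma kvee_one (x : int) : `|x| <= 3 * K%:Z ->
  psum H (fun n => kvee n * chi M (- x * n)) = 1.
Proof. by move=> xK; apply: kf_one => // [|j jK]; lia. Qed.

Lemma kf_expand a L b L' n : kf H a L b L' n = (M%:R * L'%:R)^-1%:C *
  \sum_(i < L) \sum_(j < L') chi M ((a + i%:Z - (b + j%:Z)) * n) :> C.
Proof.
rewrite /kf; congr (_ * _).
rewrite /blk /trig rmorph_sum mulr_suml; apply: eq_bigr => i _.
rewrite mulr_sumr; apply: eq_bigr => j _.
rewrite -[X in _ * X = _]/((1 * chi M ((b + j%:Z) * n))^*%C) !mul1r chi_conj -chiD.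
by congr chi; ring.
Qed.

(** A sum against [kf] vanishes as soon as it does on the characters in the
    spectrum of [kf]. *)
Lemma psum_kf_eq0 a L b L' (F : int -> C) :
  (forall i j, (i < L)%N -> (j < L')%N ->
    psum H (fun m => chi M ((a + i%:Z - (b + j%:Z)) * m) * F m) = 0) ->
  psum H (fun m => kf H a L b L' m * F m) = 0.
Proof.
move=> F0; under eq_psum => m do rewrite kf_expand -mulrA mulr_suml.
rewrite /psum -mulr_sumr exchange_big/= big1 ?mulr0// => i _.
under eq_bigr do rewrite mulr_suml.
rewrite exchange_big/= big1// => j _; exact: F0.
Qed.

Lemma psum_refl (V : zmodType) (F : int -> V) a : periodic_int H F ->
  psum H (fun n => F (a - n)) = psum H F.
Proof.
move=> pF; rewrite -(@psum_shift H _ F a)// -(@psum_opp H _ (fun n => F (n + a))).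
  by apply: eq_psum => n; rewrite addrC.
by move=> n; rewrite addrAC pF.
Qed.

Lemma chi_periodic x : periodic_int H (fun m => chi M (x * m) : C).
Proof. by move=> m; rewrite mulrDr (mulrC x M%:Z) chi_per. Qed.

Lemma psum_chi_pdelta x a :
  psum H (fun n => chi M (x * n) * pdelta H (n - a)) = chi M (x * a) :> C.
Proof.
rewrite -(psum_pdelta H0 a (chi_periodic x)); apply: eq_psum => n; exact: mulrC.
Qed.

(** The product of the triangle with 1 minus the trapezoid is 0, the trapezoid
    being 1 on the support of the triangle. *)
Lemma kphi_kq_conv n : psum H (fun i => kphi i * kq (n - i)) = 0.
Proof.
apply: psum_kf_eq0 => i j iK jK; set x := _ - _.
have xK : `|x| < K%:Z by rewrite /x; lia.
rewrite -(@psum_refl _ _ n); last first.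
  by apply: periodicM; [exact: chi_periodic|exact/periodic_refl/kq_periodic].
under eq_psum => m do rewrite subKr mulrBr.
rewrite psumB; apply/eqP; rewrite subr_eq0.
have E m : chi M (x * (n - m)) = chi M (x * n) * chi M (- x * m) :> C.
  by rewrite -chiD; congr chi; ring.
under eq_psum do rewrite E -mulrA -[m in pdelta _ m]subr0.
under [X in _ == X]eq_psum do rewrite E -mulrA (mulrC (chi M (- x * _))).
have := kpsi_one xK; have := psum_chi_pdelta (- x) 0.
by rewrite /psum -!mulr_sumr => -> ->; rewrite mulr0 chi0.
Qed.

Lemma kh_chi z : `|z| <= 3 * K%:Z -> psum H (fun k => chi M (z * k) * kh k) = 0.
Proof.
move=> zK; have zK' : `|- z| <= 3 * K%:Z by rewrite normrN.
have v1 := kvee_one zK'; rewrite opprK in v1.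
have v2 : psum H (fun k => kvee (k - 1) * chi M (z * k)) = chi M z.
  rewrite -(@psum_shift H _ _ 1); last first.
    by apply: periodicM; [exact/periodic_shift/kvee_periodic|exact: chi_periodic].
  rewrite -[RHS]mulr1 -v1 /psum mulr_sumr; apply: eq_bigr => i _.
  by rewrite addrK mulrDr mulr1 chiD; ring.
have E k : chi M (z * k) * kh k = (chi M (z * k) * pdelta H (k - 1) -
    chi M (z * k) * pdelta H (k - 0)) -
    (kvee (k - 1) * chi M (z * k) - kvee k * chi M (z * k)).
  by rewrite /kh /kw subr0; ring.
under eq_psum do rewrite E.
by rewrite !psumB v1 v2 !psum_chi_pdelta mulr1 mulr0 chi0 subrr.
Qed.

(** The function with coefficients [kh] vanishes at the differences of a point
    of the support of the triangle and a point of that of the trapezoid. *)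
Lemma kh_kphi_kpsi m l :
  psum H (fun k => kh k * kphi (m - k) * kpsi (l + k)) = 0.
Proof.
pose F k := kphi k * (kh (m - k) * kpsi (l + m - k)).
have pF : periodic_int H F.
  apply: periodicM; first exact: kphi_periodic.
  by apply: periodicM; [exact/periodic_refl/kh_periodic|exact/periodic_refl/kpsi_periodic].
have -> : psum H (fun k => kh k * kphi (m - k) * kpsi (l + k)) = psum H F.
  rewrite -(psum_refl m pF); apply: eq_psum => k; rewrite /F subKr.
  have -> : l + m - (m - k) = l + k by ring.
  by ring.
apply: psum_kf_eq0 => i j iK jK; set x := _ - _.
have xK : `|x| < K%:Z by rewrite /x; lia.
pose G k := kpsi k * (chi M (x * (l + m - k)) * kh (k - l)).
have pG : periodic_int H G.
  apply: periodicM; first exact: kpsi_periodic.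
  by apply: periodicM; [exact: (@periodic_refl H _ _ (l + m) (chi_periodic x))|exact/periodic_shift/kh_periodic].
have -> : psum H (fun k => chi M (x * k) * (kh (m - k) * kpsi (l + m - k))) = psum H G.
  rewrite -(psum_refl (l + m) pG); apply: eq_psum => k; rewrite /G subKr.
  by rewrite (_ : l + m - k - l = m - k); [ring|ring].
apply: psum_kf_eq0 => i' j' iK' jK'; set y := _ - _.
have yxK : `|y - x| <= 3 * K%:Z by rewrite /y; lia.
rewrite -(@psum_shift H _ _ l); last first.
  apply: periodicM; first exact: chi_periodic.
  by apply: periodicM; [exact: (@periodic_refl H _ _ (l + m) (chi_periodic x))|exact/periodic_shift/kh_periodic].
rewrite (@eq_psum _ _ _ (fun k => chi M (y * l + x * m) * (chi M ((y - x) * k) * kh k))).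
  by have := kh_chi yxK; rewrite /psum -mulr_sumr => ->; rewrite mulr0.
move=> k; rewrite addrK !mulrA -!chiD; congr (chi M _ * _); ring.
Qed.

Lemma psum_const (c : R) : psum H (fun=> c) = M%:R * c.
Proof. by rewrite /psum sumr_const card_ord mulr_natl. Qed.

Lemma ler_psum (F G : int -> R) : (forall n, 2 * `|n| <= M%:Z -> F n <= G n) ->
  psum H F <= psum H G.
Proof. by move=> FG; apply: ler_sum => i _; apply/FG/wix_bound. Qed.

Lemma pdelta_l1 a : psum H (fun n => normc (pdelta H (n - a) : C)) = 1.
Proof.
pose F (n : int) : R := normc (pdelta H n : C).
have pF : periodic_int H F by move=> n; rewrite /F pdelta_periodic.
have -> : psum H (fun n => normc (pdelta H (n - a))) = psum H F.
  exact: (@psum_shift _ _ F (- a) pF).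
have Hlt : (H < M)%N by rewrite -addnn; lia.
rewrite /psum (bigD1 (Ordinal Hlt))//= big1 ?addr0 => [|i iH].
  by rewrite /wix/= subrr /F /pdelta dvdz0 normc1.
rewrite /F (pdelta_window H0); last by have := wix_bound i; lia.
case: eqVneq => [w0|_]; last by rewrite normc0.
by move: iH => /eqP; case; apply/val_inj => /=; move: w0; rewrite /wix; lia.
Qed.

Lemma kphi_l1 : psum H (fun n => normc (kphi n)) <= 1.
Proof.
have := @kf_l1 R _ H0 0 K 0 K K1M K1M K0.
by rewrite divff ?pnatr_eq0 -?lt0n// -[1 + 1]/2 divff ?pnatr_eq0.
Qed.

Lemma kpsi_l1 : psum H (fun n => normc (kpsi n)) <= 2.
Proof.
have := @kf_l1 R _ H0 (- K%:Z) (3 * K) 0 K K3M K1M K0.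
by rewrite natrM mulfK ?pnatr_eq0 -?lt0n//; move=> h; apply: (le_trans h); lra.
Qed.

Lemma kq_l1 : psum H (fun n => normc (kq n)) <= 3.
Proof.
apply: (@le_trans _ _ (psum H (fun n => normc (pdelta H (n - 0) : C) + normc (kpsi n)))).
  by apply: ler_psum => n _; rewrite subr0 -(normcN (kpsi n)) le_normcD.
by rewrite psumD pdelta_l1; have := kpsi_l1; lra.
Qed.

(** [kw] is the discrete derivative of [kvee], so [kf_tv] bounds it by
    [10 pi / N']: the requirement [20 pi <= N'] is what makes this a
    contraction factor. *)
Lemma kw_l1 : 20 * pi <= N'%:R :> R -> psum H (fun n => normc (kw n)) <= 1 / 2.
Proof.
move=> hN.
have K20 : (0 < 2 * K)%N by rewrite muln_gt0.
have K80 : (0 < 8 * K)%N by rewrite muln_gt0.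
have K40 : (0 < 4 * K)%N by rewrite muln_gt0.
have k0 : 0 < K%:R :> R by rewrite ltr0n.
have w2 : (2 : R) ^+ 2 = (8 * K)%:R / (2 * K)%:R.
  by rewrite !natrM; field; rewrite gt_eqF.
have B1 i : (i < 8 * K)%N -> `|- (4 * K)%:Z + i%:Z| <= (4 * K)%N%:Z by lia.
have B2 i : (i < 2 * K)%N -> `|- K%:Z + i%:Z| <= K%:Z by lia.
have := @kf_tv R _ H0 _ _ _ _ _ _ K8M K2M K80 K20 K40 K0 2 (ltr0n _ _) w2 B1 B2.
under eq_psum do rewrite normcB.
move=> h; apply: (le_trans h).
have n0 : 0 < N'%:R :> R by rewrite ltr0n (leq_trans _ N4).
rewrite -muln2 !natrM.
have -> : 2 * (2 * pi * (4 * K%:R + K%:R) / (N'%:R * K%:R * 2)) = 10 * pi / N'%:R :> R.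
  by field; rewrite !gt_eqF.
by rewrite ler_pdivrMr//; lra.
Qed.

Lemma psum_kw : psum H kw = 0.
Proof. by rewrite psumB psum_shift ?subrr//; exact: kvee_periodic. Qed.

(** [2 + 1 / 2], for the two point masses and [kw]. *)
Lemma kh_l1 : 20 * pi <= N'%:R :> R -> psum H (fun n => normc (kh n)) <= 5 / 2.
Proof.
move=> hN.
apply: (@le_trans _ _ (psum H (fun n => (normc (pdelta H (n - 1) : C) +
    normc (pdelta H (n - 0) : C)) + normc (kw n)))).
  apply: ler_psum => n _; rewrite subr0 /kh.
  apply: (le_trans (le_normcD _ _)); rewrite normcN lerD2r.
  by apply: (le_trans (le_normcD _ _)); rewrite normcN.
by rewrite !psumD !pdelta_l1; have := kw_l1 hN; lra.
Qed.

Lemma kf_far a L b L' n : (K <= L')%N -> 2 * `|n| <= M%:Z -> H%:Z <= 4 * `|n| ->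
  normc (kf H a L b L' n : C) <= 16 * N%:R / H%:R ^+ 2.
Proof.
move=> KL nM nH.
have L0 : (0 < L')%N by exact: leq_trans KL.
have := @kf_decay R _ H0 a L b L' n L0 nM.
have k0 : 0 < K%:R :> R by rewrite ltr0n.
have h0 : 0 < H%:R :> R by rewrite ltr0n.
have : M%:R / L'%:R <= N%:R :> R.
  rewrite ler_pdivrMr ?ltr0n// -natrM ler_nat -!muln2 mulnAC.
  by rewrite leq_mul.
have : H%:R <= 4 * `|n|%:~R :> R.
  have : (H%:Z)%:~R <= (4 * `|n|)%:~R :> R by rewrite ler_int.
  by rewrite intrM.
set m : R := `|n|%:~R; set s := normc _ => hm h1 h2.
rewrite ler_pdivlMr ?exprn_gt0//.
have s0 : 0 <= s by exact: normc_ge0.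
have : s * H%:R ^+ 2 <= s * (4 * m) ^+ 2.
  by rewrite ler_wpM2l// ler_sqr ?nnegrE//; lra.
by rewrite exprMn; lra.
Qed.

Lemma far_kphi n : 2 * `|n| <= M%:Z -> far H n -> normc (kphi n) <= 16 * N%:R / H%:R ^+ 2.
Proof. by rewrite /far => nM nf; apply: kf_far => //; lia. Qed.

Lemma far_kpsi n : 2 * `|n| <= M%:Z -> far H n -> normc (kpsi n) <= 16 * N%:R / H%:R ^+ 2.
Proof. by rewrite /far => nM nf; apply: kf_far => //; lia. Qed.

Lemma far_kq n : 2 * `|n| <= M%:Z -> far H n -> normc (kq n) <= 16 * N%:R / H%:R ^+ 2.
Proof.
move=> nM nf; have nn0 : n != 0 by move: nf; rewrite /far; lia.
have nlt : `|n| < M%:Z by lia.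
by rewrite /kq pdelta_window// (negbTE nn0) sub0r normcN; exact: far_kpsi.
Qed.

Lemma far_kh n : (4 <= H)%N -> 2 * `|n| <= M%:Z -> far H n ->
  normc (kh n) <= 32 * N%:R / H%:R ^+ 2.
Proof.
move=> H4 nM nf; have nn0 : n != 0 by move: nf; rewrite /far; lia.
have nn1 : n - 1 != 0 by move: nf; rewrite /far; lia.
rewrite /kh !pdelta_window ?(negbTE nn0) ?(negbTE nn1) ?subr0 ?sub0r ?normcN; try lia.
rewrite /kw (le_trans (le_normcD _ _))// normcN.
have K2 : (K <= 2 * K)%N by lia.
have h1 : normc (kvee n) <= 16 * N%:R / H%:R ^+ 2.
  by apply: kf_far => //; move: nf; rewrite /far; lia.
have h2 : normc (kvee (n - 1)) <= 16 * N%:R / H%:R ^+ 2.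
  have [nH|nH] := eqVneq n (- H%:Z).
    rewrite -kvee_periodic; apply: kf_far => //; rewrite nH; lia.
  by apply: kf_far => //; move: nf; rewrite /far; lia.
lra.
Qed.

(** There are [2 N' K] indices in the window, with a bound of order
    [N' / (N' K) ^ 2] on each coefficient. *)
Lemma tail_le (F : int -> C) : (forall n, 2 * `|n| <= M%:Z -> far H n ->
  normc (F n) <= 32 * N%:R / H%:R ^+ 2) -> tail H F <= 128 / K%:R.
Proof.
move=> hF; apply: (@le_trans _ _ (psum H (fun=> 32 * N%:R / H%:R ^+ 2))).
  apply: ler_psum => n nM; case: ifP => [|_]; first exact: hF.
  by rewrite divr_ge0 ?mulr_ge0 ?exprn_ge0.
rewrite psum_const -!muln2 !natrM le_eqVlt; apply/orP; left; apply/eqP; field.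
by rewrite !pnatr_eq0 -!lt0n K0 (leq_trans _ N4).
Qed.

End kernels.

(** * Convolutions on the integers with values in a normed space *)

Section real_norm.
Context {R : realType} {X : normedModType R[i]}.
Implicit Types x y : X.

(** The norm of [X] takes its values in the partially ordered [R[i]]. *)
Definition rn x : R := complex.Re `|x|.

Lemma rnE x : `|x| = (rn x)%:C.
Proof. by rewrite /rn RRe_real// normr_real. Qed.

Lemma rn_ge0 x : 0 <= rn x.
Proof. by rewrite -lecR -rnE; exact: normr_ge0. Qed.

Lemma rnD x y : rn (x + y) <= rn x + rn y.
Proof. by rewrite -lecR rmorphD/= -!rnE ler_normD. Qed.

Lemma rnZ a x : rn (a *: x) = normc a * rn x.
Proof.
suff [] : (rn (a *: x))%:C = (normc a * rn x)%:C by [].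
by rewrite -rnE normrZ rmorphM/= -rnE.
Qed.

Lemma rnN x : rn (- x) = rn x.
Proof. by rewrite /rn normrN. Qed.

Lemma rn0 : rn (0 : X) = 0.
Proof. by rewrite /rn normr0. Qed.

Lemma rn_eq0 x : rn x = 0 -> x = 0.
Proof. by move=> x0; apply: normr0_eq0; rewrite rnE x0. Qed.

Lemma rnB x y : rn (x - y) <= rn x + rn y.
Proof. by rewrite -(rnN y) rnD. Qed.

Lemma rn_distC x y : rn (x - y) = rn (y - x).
Proof. by rewrite -rnN opprB. Qed.

Lemma rn_dist_triangle y x z : rn (x - z) <= rn (x - y) + rn (y - z).
Proof. by rewrite -(subrKA y) addrC (le_trans (rnD _ _))// addrC. Qed.

Lemma rn_sum I (r : seq I) (P : pred I) (F : I -> X) :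
  rn (\sum_(i <- r | P i) F i) <= \sum_(i <- r | P i) rn (F i).
Proof.
elim/big_ind2 : _ => [|x1 x2 y1 y2 h1 h2|//]; first by rewrite rn0.
by apply: (le_trans (rnD _ _)); rewrite lerD.
Qed.

Lemma rn_psum H (F : int -> X) : rn (psum H F) <= psum H (rn \o F).
Proof. exact: rn_sum. Qed.

End real_norm.

Section wrap.
Context {R : realType} {X : normedModType R[i]}.
Local Notation C := R[i].
Variable H : nat.
Hypothesis H0 : (0 < H)%N.
Local Notation M := (H.*2).

(** The representative of [n] modulo [M] in the window. *)
Definition red (n : int) : int := ((n + H%:Z) %% M%:Z)%Z - H%:Z.

Lemma red_periodic : periodic_int H red.
Proof. by move=> n; rewrite /red [n + _ + H%:Z]addrAC modzDr. Qed.

Lemma red_id n : - H%:Z <= n < H%:Z -> red n = n.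
Proof. by move=> nH; rewrite /red modz_small ?addrK//; lia. Qed.

Let red_near m n : ~~ far H m -> ~~ far H n -> red (m + n) = m + n.
Proof. by move=> fm fn; apply: red_id; move: fm fn; rewrite /far; lia. Qed.

Lemma red_wix i : red (@wix H i) = wix i.
Proof. by apply: red_id; rewrite /wix; case: i => i /= iH; lia. Qed.

Lemma psum_red (V : zmodType) (F : int -> int -> V) :
  psum H (fun n => F n (red n)) = psum H (fun n => F n n).
Proof. by apply: eq_bigr => i _; rewrite red_wix. Qed.

Let l1 (a : int -> C) := psum H (fun n => normc (a n)).

Let ffar (a : int -> C) n := if far H n then normc (a n) else 0.

Let ffar_ge0 a n : 0 <= ffar a n.
Proof. by rewrite /ffar; case: ifP => // _; exact: normc_ge0. Qed.

(** If the cyclic convolution of [a] and [b] vanishes, then their convolution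
    over the integers is controlled by their tails, since wrapping around the
    window involves one index far from 0. *)
Lemma wrap2 (a b : int -> C) (E : int -> X) (B : R) :
  periodic_int H b -> (forall n, rn (E n) <= B) ->
  (forall l, psum H (fun i => a i * b (l - i)) = 0) ->
  rn (psum H (fun i => psum H (fun j => (a i * b j) *: E (i + j)))) <=
  2 * B * (tail H a * l1 b + l1 a * tail H b).
Proof.
move=> pb EB ab0.
have B0 : 0 <= B by exact: le_trans (rn_ge0 _) (EB 0).
have Z : psum H (fun i => psum H (fun j => (a i * b j) *: E (red (i + j)))) = 0.
  have -> : psum H (fun i => psum H (fun j => (a i * b j) *: E (red (i + j)))) =
      psum H (fun i => psum H (fun l => (a i * b (l - i)) *: E l)).
    apply: eq_psum => i.
    rewrite -[RHS](@psum_red _ (fun l l' => (a i * b (l - i)) *: E l')).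
    rewrite -(@psum_shift H _ (fun l => (a i * b (l - i)) *: E (red l)) i).
      by apply: eq_psum => j; rewrite addrK addrC.
    by move=> n; rewrite red_periodic [n + _ - i]addrAC pb.
  rewrite /psum exchange_big/= big1// => l _.
  by rewrite -scaler_suml; have := ab0 (wix l); rewrite /psum => ->; rewrite scale0r.
rewrite -[psum _ _]subr0 -[0 in X in rn X]Z -psumB.
under eq_psum => i do rewrite -psumB.
apply: (@le_trans _ _ (psum H (fun i => psum H (fun j =>
    2 * B * (ffar a i * normc (b j) + normc (a i) * ffar b j))))); last first.
  rewrite /psum; under eq_bigr do rewrite -mulr_sumr big_split/= -!mulr_sumr.
  by rewrite -mulr_sumr big_split/= -!mulr_suml.
apply: (le_trans (rn_psum _ _)); apply: ler_sum => i _ /=.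
apply: (le_trans (rn_psum _ _)); apply: ler_sum => j _ /=.
set m := wix i; set l := wix j; rewrite -scalerBr rnZ normcM.
have [am bl] : 0 <= normc (a m) /\ 0 <= normc (b l) by rewrite !normc_ge0.
have h2B : rn (E (m + l) - E (red (m + l))) <= 2 * B.
  by apply: (le_trans (rnB _ _)); have := EB (m + l); have := EB (red (m + l)); lra.
have [fm|nfm] := boolP (far H m).
  rewrite {1}/ffar fm; apply: (@le_trans _ _ (normc (a m) * normc (b l) * (2 * B))).
    by rewrite ler_wpM2l// mulr_ge0.
  by rewrite mulrC ler_wpM2l// ?mulr_ge0// lerDl mulr_ge0// ffar_ge0.
have [fl|nfl] := boolP (far H l).
  rewrite {2}/ffar fl; apply: (@le_trans _ _ (normc (a m) * normc (b l) * (2 * B))).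
    by rewrite ler_wpM2l// mulr_ge0.
  by rewrite mulrC ler_wpM2l// ?mulr_ge0// lerDr mulr_ge0// ffar_ge0.
rewrite (red_near nfm nfl).
rewrite subrr rn0 mulr0 mulr_ge0// ?mulr_ge0// addr_ge0// mulr_ge0// ffar_ge0//.
Qed.

(** The trilinear version of [wrap2]: the arguments [k + m] and [n - k] leave
    the window only if one of [k], [m], [n] is far from 0. *)
Lemma wrap3 (h a b : int -> C) (F : int -> int -> X) (B : R) :
  periodic_int H a -> periodic_int H b -> (forall m n, rn (F m n) <= B) ->
  (forall m l, psum H (fun k => h k * a (m - k) * b (l + k)) = 0) ->
  rn (psum H (fun k => psum H (fun m => psum H (fun n =>
    (h k * a m * b n) *: F (k + m) (n - k))))) <=
  2 * B * (tail H h * l1 a * l1 b + l1 h * tail H a * l1 b + l1 h * l1 a * tail H b).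
Proof.
move=> pa pb FB hab0.
have B0 : 0 <= B by exact: le_trans (rn_ge0 _) (FB 0 0).
have Z : psum H (fun k => psum H (fun m => psum H (fun n =>
    (h k * a m * b n) *: F (red (k + m)) (red (n - k))))) = 0.
  have -> : psum H (fun k => psum H (fun m => psum H (fun n =>
      (h k * a m * b n) *: F (red (k + m)) (red (n - k))))) =
      psum H (fun k => psum H (fun m => psum H (fun l =>
      (h k * a (m - k) * b (l + k)) *: F m l))).
    apply: eq_psum => k.
    rewrite -[RHS](@psum_red _ (fun m m' => psum H (fun l => (h k * a (m - k) * b (l + k)) *: F m' l))).
    rewrite -(@psum_shift H _ (fun m => psum H (fun l =>
      (h k * a (m - k) * b (l + k)) *: F (red m) l)) k); last first.
      by move=> n; apply: eq_psum => l; rewrite red_periodic addrAC pa.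
    apply: eq_psum => m.
    rewrite -[RHS](@psum_red _ (fun l l' => (h k * a (m + k - k) * b (l + k)) *: F (red (m + k)) l')).
    rewrite -(@psum_shift H _ (fun l => (h k * a (m + k - k) * b (l + k)) *:
      F (red (m + k)) (red l)) (- k)); last first.
      by move=> n; rewrite red_periodic [n + _ + k]addrAC pb.
    by apply: eq_psum => l; rewrite addrK addrNK (addrC k).
  rewrite /psum exchange_big/= big1// => m _.
  rewrite exchange_big/= big1// => l _.
  rewrite -scaler_suml; have := hab0 (wix m) (wix l).
  by rewrite /psum => ->; rewrite scale0r.
rewrite -[psum _ _]subr0 -[0 in X in rn X]Z -psumB.
under eq_psum => k.
  rewrite -psumB.
  under eq_psum => m do rewrite -psumB.
  over.
pose G k m n := 2 * B * ((ffar h k * normc (a m)) * normc (b n) +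
  ((normc (h k) * ffar a m) * normc (b n) + (normc (h k) * normc (a m)) * ffar b n)).
apply: (@le_trans _ _ (psum H (fun k => psum H (fun m => psum H (G k m))))); last first.
  have -> : psum H (fun k => psum H (fun m => psum H (G k m))) =
    psum H (fun k => psum H (fun m =>
     2 * B * ((ffar h k * normc (a m)) * l1 b + ((normc (h k) * ffar a m) * l1 b +
     (normc (h k) * normc (a m)) * tail H b)))).
    apply: eq_psum => k; apply: eq_psum => m.
    by rewrite /psum /G -mulr_sumr !big_split/= -!mulr_sumr.
  have -> : psum H (fun k => psum H (fun m =>
     2 * B * ((ffar h k * normc (a m)) * l1 b + ((normc (h k) * ffar a m) * l1 b +
     (normc (h k) * normc (a m)) * tail H b)))) = psum H (fun k =>
     2 * B * (ffar h k * l1 a * l1 b + (normc (h k) * tail H a * l1 b +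
      normc (h k) * l1 a * tail H b))).
    apply: eq_psum => k.
    by rewrite /psum -mulr_sumr !big_split/= -!mulr_suml -!mulr_sumr.
  by rewrite /psum -mulr_sumr !big_split/= -!mulr_suml addrA.
apply: (le_trans (rn_psum _ _)); apply: ler_sum => i1 _ /=.
apply: (le_trans (rn_psum _ _)); apply: ler_sum => i2 _ /=.
apply: (le_trans (rn_psum _ _)); apply: ler_sum => i3 _ /=.
set k := wix i1; set m := wix i2; set n := wix i3; rewrite -scalerBr rnZ !normcM.
have [hk am bn] : [/\ 0 <= normc (h k), 0 <= normc (a m) & 0 <= normc (b n)].
  by rewrite !normc_ge0.
have h2B : rn (F (k + m) (n - k) - F (red (k + m)) (red (n - k))) <= 2 * B.
  apply: (le_trans (rnB _ _)).
  by have := FB (k + m) (n - k); have := FB (red (k + m)) (red (n - k)); lra.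
have P1 : 0 <= ffar h k * normc (a m) * normc (b n) by rewrite !mulr_ge0.
have P2 : 0 <= normc (h k) * ffar a m * normc (b n) by rewrite !mulr_ge0.
have P3 : 0 <= normc (h k) * normc (a m) * ffar b n by rewrite !mulr_ge0.
have Q : normc (h k) * normc (a m) * normc (b n) *
    rn (F (k + m) (n - k) - F (red (k + m)) (red (n - k))) <=
    2 * B * (normc (h k) * normc (a m) * normc (b n)).
  by rewrite [leRHS]mulrC ler_wpM2l// !mulr_ge0.
have B2 : 0 <= 2 * B by rewrite mulr_ge0.
have [fk|nfk] := boolP (far H k).
  apply: (le_trans Q); rewrite ler_wpM2l// {1}/ffar fk lerDl addr_ge0//.
have [fm|nfm] := boolP (far H m).
  apply: (le_trans Q); rewrite ler_wpM2l// {2}/ffar fm.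
  by rewrite addrCA lerDl addr_ge0//.
have [fn|nfn] := boolP (far H n).
  apply: (le_trans Q); rewrite ler_wpM2l// {3}/ffar fn.
  by rewrite addrA lerDr addr_ge0//.
have nfNk : ~~ far H (- k) by rewrite /far normrN.
rewrite (red_near nfk nfm) (red_near nfn nfNk).
by rewrite subrr rn0 mulr0 /G mulr_ge0// !addr_ge0.
Qed.

End wrap.

Section limits.
Context {R : realType}.

Lemma le_pow2_lim (A B c : R) (m : nat) :
  (forall n, (m <= n)%N -> A <= B + c / 2 ^+ n) -> A <= B.
Proof.
move=> h; rewrite leNgt; apply/negP => AB.
have d0 : 0 < A - B by rewrite subr_gt0.
pose n := (m + Num.bound `|c / (A - B)|)%N.
have := h n (leq_addr _ _); rewrite leNgt => /negP; apply.
rewrite -ltrBrDl ltr_pdivrMr ?exprn_gt0// mulrC -ltr_pdivrMr//.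
apply: (le_lt_trans (ler_norm _)); apply: (lt_le_trans (archi_boundP (normr_ge0 _))).
have : (Num.bound `|c / (A - B)| <= 2 ^ n)%N.
  apply: ltnW; apply: leq_trans (ltn_expl _ (isT : 1 < 2)%N) _.
  by rewrite leq_exp2l// leq_addl.
by rewrite -(ler_nat R) natrX.
Qed.

End limits.

(** * Isometric actions of the integers *)

Section actions.
Context {R : realType} {X : normedModType R[i]}.
Local Notation C := R[i].

Definition linear_map (S : X -> X) : Prop :=
  forall a x y, S (a *: x + y) = a *: S x + S y.

Lemma linear_map0 S : linear_map S -> S 0 = 0.
Proof. by move=> lS; have := lS (-1) 0 0; rewrite !scaleN1r !addNr. Qed.

Lemma linear_mapD S x y : linear_map S -> S (x + y) = S x + S y.
Proof. by move=> lS; have := lS 1 x y; rewrite !scale1r. Qed.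

Lemma linear_mapZ S a x : linear_map S -> S (a *: x) = a *: S x.
Proof. by move=> lS; have := lS a x 0; rewrite (linear_map0 lS) !addr0. Qed.

Lemma linear_mapB S x y : linear_map S -> S (x - y) = S x - S y.
Proof. by move=> lS; rewrite linear_mapD// -scaleN1r linear_mapZ// scaleN1r. Qed.

Lemma linear_map_sum S I (r : seq I) (P : pred I) (F : I -> X) :
  linear_map S -> S (\sum_(i <- r | P i) F i) = \sum_(i <- r | P i) S (F i).
Proof.
move=> lS; elim/big_rec2 : _ => [|i x y _ <-]; first exact: linear_map0.
exact: linear_mapD.
Qed.

Lemma linear_map_psum S H (c : int -> C) (F : int -> X) : linear_map S ->
  S (psum H (fun n => c n *: F n)) = psum H (fun n => c n *: S (F n)).
Proof.
move=> lS; rewrite /psum linear_map_sum//.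
by apply: eq_bigr => i _; rewrite linear_mapZ.
Qed.

Record isometric_action (U : int -> X -> X) : Prop := {
  act_linear : forall n, linear_map (U n) ;
  act_rn : forall n x, rn (U n x) = rn x ;
  act_add : forall m n x, U m (U n x) = U (m + n) x ;
  act0 : forall x, U 0 x = x }.

(** The value at the action [U] of the trigonometric polynomial with
    coefficients [c] over the window. *)
Definition op (U : int -> X -> X) H (c : int -> C) (x : X) : X :=
  psum H (fun n => c n *: U n x).

Section op.
Variables (U : int -> X -> X) (aU : isometric_action U).
Implicit Types (c : int -> C) (H : nat).

Lemma op_linear H c : linear_map (op U H c).
Proof.
move=> a x y; rewrite /op /psum scaler_sumr -big_split/=; apply: eq_bigr => i _.
by rewrite (act_linear aU) scalerDr !scalerA mulrC.
Qed.

Lemma rn_op H c x : rn (op U H c x) <= psum H (fun n => normc (c n)) * rn x.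
Proof.
apply: (le_trans (rn_psum _ _)); rewrite /psum mulr_suml; apply: ler_sum => i _ /=.
by rewrite rnZ (act_rn aU).
Qed.

Lemma op_commute H c S x : linear_map S -> (forall n x, S (U n x) = U n (S x)) ->
  S (op U H c x) = op U H c (S x).
Proof.
move=> lS SU; rewrite /op linear_map_psum//.
by apply: eq_psum => n; rewrite SU.
Qed.

Lemma op_op H a b x : op U H a (op U H b x) =
  psum H (fun i => psum H (fun j => (a i * b j) *: U (i + j) x)).
Proof.
apply: eq_psum => i; rewrite (linear_map_psum _ _ _ (act_linear aU i)).
rewrite /psum scaler_sumr; apply: eq_bigr => j _.
by rewrite (act_add aU) scalerA.
Qed.

Lemma psum_double (V : zmodType) H (F : int -> V) : psum H.*2 F =
  psum H (fun n => F n + F (if n < 0 then n + (H.*2)%:Z else n - (H.*2)%:Z)).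
Proof.
have E (G : int -> V) h : psum h G = \sum_(0 <= i < h.*2) G (i%:Z - h%:Z).
  by rewrite big_mkord.
rewrite psumD !E.
have sh (G : nat -> V) m n : \sum_(m <= i < m + n) G i = \sum_(0 <= i < n) G (i + m)%N.
  by rewrite -{1}(add0n m) big_addn addKn.
rewrite (_ : H.*2.*2 = (H + (H.*2 + H))%N); last by lia.
rewrite (@big_cat_nat _ _ _ H)//=; last by lia.
rewrite [X in _ + X]sh [X in _ + X](@big_cat_nat _ _ _ H.*2)//=; last by lia.
rewrite [X in _ + (_ + X)]sh addrCA; congr (_ + _).
  by apply: eq_bigr => i _; congr F; lia.
rewrite (_ : index_iota 0 H.*2 = index_iota 0 (H + H)); last by rewrite addnn.
rewrite [RHS](@big_cat_nat _ _ _ H)//=; last by lia.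
rewrite -{1 2}[H.*2]addnn; rewrite [X in _ = _ + X](_ : _ = \sum_(H <= i < H + H) (if i%:Z - H%:Z < 0 then F (i%:Z - H%:Z + (H.*2)%:Z) else F (i%:Z - H%:Z - (H.*2)%:Z))); last by apply: eq_bigr => i _; case: ifP.
rewrite [X in _ = _ + X]sh addrC; congr (_ + _).
  rewrite [in RHS]big_nat [in LHS]big_nat; apply: eq_bigr => i /andP[_ iH].
  by rewrite ifT; [congr F; lia|lia].
rewrite [in RHS]big_nat [in LHS]big_nat; apply: eq_bigr => i /andP[_ iH].
by rewrite ifF; [congr F; lia|apply/negbTE; lia].
Qed.

(** Sampling a function at twice as many points adds an aliasing error, which
    only involves coefficients outside the smaller window. *)
Lemma rn_op_double H a b x (D : R) : periodic_int H.*2 b ->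
  (forall n, b n + b (n + (H.*2)%:Z) = a n) -> 
  (forall n, H%:Z <= `|n| <= (H.*2)%:Z -> normc (b n) <= D) ->
  rn (op U H.*2 b x - op U H a x) <= (H.*2)%:R * (2 * D) * rn x.
Proof.
move=> pb ab bD; rewrite /op psum_double -psumB.
set s := fun n : int => if n < 0 then n + (H.*2)%:Z else n - (H.*2)%:Z.
have bs n : b (n + (H.*2)%:Z) = b (s n).
  rewrite /s; case: ifP => // _; rewrite -(pb (n - _)); congr b.
  by rewrite -[H.*2.*2]addnn; lia.
apply: (le_trans (rn_psum _ _)) => /=.
apply: (@le_trans _ _ (psum H (fun=> 2 * D * rn x))); last first.
  by rewrite /psum sumr_const card_ord -[leRHS]mulrA [leRHS]mulr_natl.
apply: ler_sum => i _ /=; set n := wix i; rewrite -/(s n) -ab scalerDl bs opprD addrACA subrr add0r.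
rewrite -scalerBr rnZ.
have D0 : normc (b (s n)) <= D.
  by apply: bD; have := wix_bound i; rewrite -/n /s; case: ifP; lia.
have x2 : rn (U (s n) x - U n x) <= 2 * rn x.
  by apply: (le_trans (rnB _ _)); rewrite !(act_rn aU); lra.
by rewrite -mulrA [leRHS]mulrCA ler_pM ?normc_ge0 ?rn_ge0.
Qed.

End op.
End actions.

(** * The commutator of an operator with an isometric action *)

Section local_estimate.
Context {R : realType} {X : normedModType R[i]}.
Local Notation C := R[i].
Variable N' : nat.
Hypothesis N4 : (4 <= N')%N.

(** Completeness, in the form that produces a rate of convergence. *)
Definition rapidly_complete : Prop :=
  forall (u : nat -> X) (c : R), (forall n, rn (u n.+1 - u n) <= c / 2 ^+ n) ->
  exists l, forall n, rn (u n - l) <= 2 * c / 2 ^+ n.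

Local Notation Hk k := (N' * 2 ^ k)%N.

Let pow0 k : (0 < 2 ^ k)%N. Proof. by rewrite expn_gt0. Qed.
Let H0 k : (0 < Hk k)%N. Proof. by rewrite muln_gt0 pow0 (leq_trans _ N4). Qed.

Let pow2R k : (2 ^ k)%:R = 2 ^+ k :> R. Proof. exact: natrX. Qed.

Let Hk_double k : Hk k.+1 = (Hk k).*2.
Proof. by rewrite expnS -mul2n mulnCA. Qed.

Lemma psum_pdelta_window (V : lmodType C) H (F : int -> V) a : (0 < H)%N ->
  - H%:Z <= a < H%:Z -> psum H (fun n => pdelta H (n - a) *: F n) = F a.
Proof.
move=> h0 aH; have iH : (`|(a + H%:Z)%R|%N < H.*2)%N by lia.
rewrite /psum (bigD1 (Ordinal iH))//= big1 ?addr0 => [|i ni].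
  have -> : wix (Ordinal iH) = a by rewrite /wix/=; lia.
  by rewrite subrr /pdelta dvdz0 scale1r.
rewrite (pdelta_window h0).
  case: eqVneq => [w0|]; last by rewrite scale0r.
  by move: ni => /eqP; case; apply/val_inj => /=; move: w0; rewrite /wix; lia.
by rewrite /wix; case: i {ni} => i /= ; lia.
Qed.

Section one_action.
Variables (U : int -> X -> X) (aU : isometric_action U).

(** The operators obtained by evaluating the triangle, the trapezoid, and 1
    minus the trapezoid at the action, approximated by sums over
    [N'.*2 * 2 ^ k] indices. *)
Definition phiop k : X -> X := op U (Hk k) (kphi N' (2 ^ k)).
Definition psiop k : X -> X := op U (Hk k) (kpsi N' (2 ^ k)).
Definition qop k : X -> X := op U (Hk k) (kq N' (2 ^ k)).

Let alias_bound k : ((Hk k).*2)%:R * (2 * (16 * (N'.*2)%:R / ((Hk k).*2)%:R ^+ 2)) =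
  32 / 2 ^+ k :> R.
Proof.
rewrite -!muln2 !natrM natrX; field.
by rewrite expf_neq0 ?pnatr_eq0 -?lt0n ?(leq_trans _ N4).
Qed.

Lemma rn_phiop k x : rn (phiop k x) <= rn x.
Proof.
apply: (le_trans (rn_op aU _ _ _)); rewrite -[leRHS]mul1r ler_wpM2r ?rn_ge0//.
exact: kphi_l1.
Qed.

Lemma rn_qop k x : rn (qop k x) <= 3 * rn x.
Proof.
by apply: (le_trans (rn_op aU _ _ _)); rewrite ler_wpM2r ?rn_ge0//; exact: kq_l1.
Qed.

Lemma phiop_linear k : linear_map (phiop k). Proof. exact: op_linear. Qed.
(** Refining the sampling moves the operator by the size of the aliased
    coefficients, which [kf_decay] makes of order [1 / 2 ^ k]. *)
Lemma phiop_step k x : rn (phiop k.+1 x - phiop k x) <= 32 / 2 ^+ k * rn x.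
Proof.
have E : kphi N' (2 ^ k.+1) =1 kf (Hk k).*2 (2 * 0) (2 ^ k).*2 (2 * 0) (2 ^ k).*2 :> (int -> C).
  by move=> n; rewrite /kphi Hk_double expnS mul2n mulr0.
rewrite /phiop Hk_double -alias_bound; apply: rn_op_double => //.
- by rewrite -Hk_double; apply: kphi_periodic.
- by move=> n; rewrite !E kf_double.
- by move=> n nH; rewrite -Hk_double; apply: kf_far => //; rewrite Hk_double; lia.
Qed.

Lemma psiop_step k x : rn (psiop k.+1 x - psiop k x) <= 32 / 2 ^+ k * rn x.
Proof.
have E : kpsi N' (2 ^ k.+1) =1 kf (Hk k).*2 (2 * - (2 ^ k)%N%:Z) (3 * 2 ^ k).*2 (2 * 0) (2 ^ k).*2 :> (int -> C).
  move=> n; rewrite /kpsi Hk_double expnS mul2n mulr0 -doubleMr.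
  by rewrite (_ : - (2 ^ k).*2%:Z = 2 * - (2 ^ k)%N%:Z)// -mul2n PoszM mulrN.
rewrite /psiop Hk_double -alias_bound; apply: rn_op_double => //.
- by rewrite -Hk_double; apply: kpsi_periodic.
- by move=> n; rewrite !E kf_double.
- by move=> n nH; rewrite -Hk_double; apply: kf_far => //; rewrite Hk_double; lia.
Qed.

Lemma qopE k x : qop k x = x - psiop k x.
Proof.
rewrite -[x in X in X - _](act0 aU).
rewrite -(@psum_pdelta_window _ (Hk k) (fun n => U n x) 0 (H0 k)); last by have := H0 k; lia.
rewrite /psiop /op -psumB; apply: eq_psum => n.
by rewrite subr0 -scalerBl.
Qed.

Lemma qop_step k x : rn (qop k.+1 x - qop k x) <= 32 / 2 ^+ k * rn x.
Proof.
rewrite !qopE (_ : _ - _ = psiop k x - psiop k.+1 x); last by rewrite opprB addrC addrA subrK.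
by rewrite rn_distC; exact: psiop_step.
Qed.

Lemma phiop_cauchy k m x : (k <= m)%N ->
  rn (phiop m x - phiop k x) <= (64 / 2 ^+ k - 64 / 2 ^+ m) * rn x.
Proof.
move=> km; rewrite -(subnK km); elim: (m - k)%N => [|n IH].
  by rewrite add0n !subrr rn0 mul0r.
rewrite addSn; apply: (le_trans (rn_dist_triangle (phiop (n + k) x) _ _)).
apply: (le_trans (lerD (phiop_step _ _) IH)); rewrite -mulrDl.
rewrite le_eqVlt; apply/orP; left; apply/eqP; congr (_ * _).
by rewrite exprS; field; rewrite !expf_neq0.
Qed.

(** The product of the two functions is 0 on the roots of unity, so only the
    wrapping error of [wrap2] remains. *)
Lemma phiop_qop k x : rn (phiop k (qop k x)) <= 1024 / 2 ^+ k * rn x.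
Proof.
rewrite /phiop /qop op_op//.
have Un n : rn (U n x) <= rn x by rewrite act_rn.
have := @wrap2 _ _ _ (H0 k) (kphi N' (2 ^ k)) (kq N' (2 ^ k)) (fun n => U n x) (rn x)
  (kq_periodic _ _) Un (kphi_kq_conv N4 (pow0 k)).
move=> h; apply: (le_trans (h N4 (pow0 k))).
have t1 : tail (Hk k) (kphi N' (2 ^ k)) <= 128 / 2 ^+ k :> R.
  rewrite -pow2R; apply: tail_le => // n nM nf.
  apply: (le_trans (far_kphi _ _ nM nf)) => //.
  by rewrite ler_wpM2r ?invr_ge0 ?exprn_ge0// ler_wpM2r ?ler0n// ler_nat.
have t2 : tail (Hk k) (kq N' (2 ^ k)) <= 128 / 2 ^+ k :> R.
  rewrite -pow2R; apply: tail_le => // n nM nf.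
  apply: (le_trans (far_kq _ _ nM nf)) => //.
  by rewrite ler_wpM2r ?invr_ge0 ?exprn_ge0// ler_wpM2r ?ler0n// ler_nat.
have l1 := @kphi_l1 R _ _ N4 (pow0 k).
have l2 := @kq_l1 R _ _ N4 (pow0 k).
have p0 (F : int -> R) : (forall n, 0 <= F n) -> 0 <= psum (Hk k) F by move=> F0; apply: sumr_ge0.
have q1 := p0 _ (fun n => normc_ge0 (kphi N' (2 ^ k) n)).
have q2 := p0 _ (fun n => normc_ge0 (kq N' (2 ^ k) n)).
have q3 : 0 <= tail (Hk k) (kphi N' (2 ^ k)) :> R.
  by apply: p0 => n; case: ifP => // _; exact: normc_ge0.
have q4 : 0 <= tail (Hk k) (kq N' (2 ^ k)) :> R.
  by apply: p0 => n; case: ifP => // _; exact: normc_ge0.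
rewrite mulrAC ler_wpM2r ?rn_ge0//.
have -> : 1024 / 2 ^+ k = 2 * (128 / 2 ^+ k * 3 + 1 * (128 / 2 ^+ k)) :> R by lra.
by rewrite ler_pM2l// lerD// ler_pM.
Qed.

Section one_operator.
Variables (T : X -> X) (t alpha : R).
Hypothesis lT : linear_map T.
Hypothesis t0 : 0 <= t.
Hypothesis Tt : forall x, rn (T x) <= t * rn x.
Hypothesis a0 : 0 <= alpha.
Hypothesis complX : rapidly_complete.

(** At every point, [T] is nearly within [alpha] of a bounded operator
    commuting with the action; no bound on these operators is available. *)
Hypothesis T_near : forall y e, 0 < e -> exists (S : X -> X) (s : R),
  [/\ linear_map S, forall x, rn (S x) <= s * rn x,
      forall n x, S (U n x) = U n (S x) & rn (T y - S y) <= alpha * rn y + e].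

(** An operator commuting with the action is annihilated between the triangle
    and the complement of the trapezoid. As it comes without a bound, this must
    be used at the exact limit [l] of the vectors [qop k y]. *)
Lemma phiop_T_qop k y :
  rn (phiop k (T (qop k y))) <= (3 * alpha + 256 * t / 2 ^+ k) * rn y.
Proof.
have [l ul] : exists l, forall n, rn (qop n y - l) <= 2 * (32 * rn y) / 2 ^+ n.
  apply: complX => n; apply: (le_trans (qop_step _ _)).
  by rewrite mulrAC.
have y0 := rn_ge0 y; have l0 := rn_ge0 l.
have l3 : rn l <= 3 * rn y.
  apply: (@le_pow2_lim _ _ _ (64 * rn y) 0) => n _.
  rewrite -[l in rn l](subKr (qop n y)); apply: (le_trans (rnB _ _)).
  by rewrite lerD ?rn_qop//; apply: (le_trans (ul n)); lra.
have main : rn (phiop k (T l)) <= alpha * rn l + 64 / 2 ^+ k * (t * rn l).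
  apply/ler_addgt0Pr => e e0.
  have [S [s [lS Ss SU Se]]] := T_near l e0.
  have s0 : 0 <= `|s| by [].
  apply: (@le_pow2_lim _ _ _ (`|s| * (1088 * rn y)) k) => m km.
  have pm0 : 0 < 2 ^+ m :> R by rewrite exprn_gt0.
  apply: (@le_trans _ _ (rn (phiop m (T l)) + 64 / 2 ^+ k * (t * rn l))).
    rewrite -[phiop k _ in leLHS](subKr (phiop m (T l))); apply: (le_trans (rnB _ _)).
    rewrite lerD2l; apply: (le_trans (phiop_cauchy _ km)).
    apply: (@le_trans _ _ (64 / 2 ^+ k * rn (T l))).
      by rewrite ler_wpM2r ?rn_ge0// lerBlDr lerDl divr_ge0// ltW.
    by rewrite ler_wpM2l// divr_ge0// exprn_ge0.
  have h1 : rn (phiop m (T l - S l)) <= alpha * rn l + e.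
    exact: (le_trans (rn_phiop _ _)).
  have h2 : rn (phiop m (S l)) <= `|s| * (1088 * rn y) / 2 ^+ m.
    rewrite /phiop -(op_commute _ _ _ lS SU) -/(phiop m l).
    apply: (le_trans (Ss _)); apply: (@le_trans _ _ (`|s| * rn (phiop m l))).
      by rewrite ler_wpM2r ?rn_ge0// ler_norm.
    rewrite -mulrA ler_wpM2l//.
    have -> : l = qop m y - (qop m y - l) by rewrite subKr.
    rewrite (linear_mapB _ _ (phiop_linear m)); apply: (le_trans (rnB _ _)).
    have := phiop_qop m y.
    have := le_trans (rn_phiop m (qop m y - l)) (ul m).
    set r := rn y / 2 ^+ m.
    have -> : 2 * (32 * rn y) / 2 ^+ m = 64 * r by rewrite /r; lra.
    have -> : 1024 / 2 ^+ m * rn y = 1024 * r by rewrite /r; lra.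
    have -> : 1088 * rn y / 2 ^+ m = 1088 * r by rewrite /r; lra.
    lra.
  have -> : phiop m (T l) = phiop m (T l - S l) + phiop m (S l).
    by rewrite -(linear_mapD _ _ (phiop_linear m)) subrK.
  have := rnD (phiop m (T l - S l)) (phiop m (S l)); lra.
have -> : qop k y = l + (qop k y - l) by rewrite addrC subrK.
rewrite (linear_mapD _ _ lT) (linear_mapD _ _ (phiop_linear k)).
apply: (le_trans (rnD _ _)).
have h3 : rn (phiop k (T (qop k y - l))) <= t * (2 * (32 * rn y) / 2 ^+ k).
  apply: (le_trans (rn_phiop _ _)); apply: (le_trans (Tt _)).
  by rewrite ler_wpM2l.
apply: (le_trans (lerD main h3)).
have e1 : alpha * rn l <= alpha * (3 * rn y) by rewrite ler_wpM2l.
have e2 : 64 / 2 ^+ k * (t * rn l) <= 64 / 2 ^+ k * (t * (3 * rn y)).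
  by rewrite ler_wpM2l ?divr_ge0 ?exprn_ge0// ler_wpM2l.
apply: (le_trans (lerD (lerD e1 e2) (lexx _))).
by rewrite le_eqVlt; apply/orP; left; apply/eqP; lra.
Qed.

Hypothesis N20 : 20 * pi <= N'%:R :> R.

(** [T] being arbitrary, the two sides of [T] behave as two independent
    variables of the torus, and the product of the three functions vanishes by
    [kh_kphi_kpsi]: only the wrapping error of [wrap3] remains. *)
Lemma kh_phiop_psiop k x :
  rn (psum (Hk k) (fun n => kh N' (2 ^ k) n *: U n (phiop k (T (psiop k (U (- n) x)))))) <=
  2432 * t / 2 ^+ k * rn x.
Proof.
pose F m n := U m (T (U n x)).
have Fb m n : rn (F m n) <= t * rn x.
  by rewrite /F (act_rn aU) (le_trans (Tt _))// (act_rn aU).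
have -> : psum (Hk k) (fun n => kh N' (2 ^ k) n *: U n (phiop k (T (psiop k (U (- n) x))))) =
  psum (Hk k) (fun i => psum (Hk k) (fun m => psum (Hk k) (fun n =>
    (kh N' (2 ^ k) i * kphi N' (2 ^ k) m * kpsi N' (2 ^ k) n) *: F (i + m) (n - i)))).
  apply: eq_psum => i; rewrite /phiop /psiop /op.
  rewrite (linear_map_psum _ _ _ (act_linear aU i)) /psum scaler_sumr.
  apply: eq_bigr => m _; rewrite scalerA.
  rewrite (linear_map_sum _ _ _ lT).
  rewrite (linear_map_sum _ _ _ (act_linear aU _)).
  rewrite (linear_map_sum _ _ _ (act_linear aU _)) scaler_sumr.
  apply: eq_bigr => n _.
  rewrite (linear_mapZ _ _ lT) !(linear_mapZ _ _ (act_linear aU _)) scalerA.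
  by rewrite !(act_add aU).
have H4 : (4 <= Hk k)%N by rewrite (leq_trans N4)// leq_pmulr.
have := @wrap3 _ _ _ (H0 k) (kh N' (2 ^ k)) (kphi N' (2 ^ k)) (kpsi N' (2 ^ k)) F (t * rn x)
  (kphi_periodic _ _) (kpsi_periodic _ _) Fb (kh_kphi_kpsi N4 (pow0 k)).
move=> h; apply: (le_trans (h N4 (pow0 k) N4 (pow0 k))).
have le1632 : 16 * N'.*2%:R / (Hk k)%:R ^+ 2 <= 32 * N'.*2%:R / (Hk k)%:R ^+ 2 :> R.
  by rewrite ler_wpM2r ?invr_ge0 ?exprn_ge0// ler_wpM2r ?ler0n// ler_nat.
have t1 : tail (Hk k) (kphi N' (2 ^ k)) <= 128 / 2 ^+ k :> R.
  rewrite -pow2R; apply: tail_le => // n nM nf.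
  exact: (le_trans (far_kphi _ _ nM nf)).
have t2 : tail (Hk k) (kpsi N' (2 ^ k)) <= 128 / 2 ^+ k :> R.
  rewrite -pow2R; apply: tail_le => // n nM nf.
  exact: (le_trans (far_kpsi _ _ nM nf)).
have t3 : tail (Hk k) (kh N' (2 ^ k)) <= 128 / 2 ^+ k :> R.
  by rewrite -pow2R; apply: tail_le => // n nM nf; exact: far_kh.
have l1 := @kphi_l1 R _ _ N4 (pow0 k).
have l2 := @kpsi_l1 R _ _ N4 (pow0 k).
have l3 := @kh_l1 R _ _ N4 (pow0 k) N20.
have p0 (G : int -> R) : (forall n, 0 <= G n) -> 0 <= psum (Hk k) G by move=> G0; apply: sumr_ge0.
have n0 (c : int -> C) : 0 <= psum (Hk k) (fun n => normc (c n)).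
  by apply: p0 => n; exact: normc_ge0.
have n1 (c : int -> C) : 0 <= tail (Hk k) c.
  by apply: p0 => n; case: ifP => // _; exact: normc_ge0.
have tx0 : 0 <= t * rn x by rewrite mulr_ge0 ?rn_ge0.
set d := 128 / 2 ^+ k in t1 t2 t3.
have b1 : tail (Hk k) (kh N' (2 ^ k)) * psum (Hk k) (fun n => normc (kphi N' (2 ^ k) n)) *
  psum (Hk k) (fun n => normc (kpsi N' (2 ^ k) n)) <= d * 1 * 2 :> R.
  by rewrite ler_pM ?mulr_ge0// ler_pM.
have b2 : psum (Hk k) (fun n => normc (kh N' (2 ^ k) n)) * tail (Hk k) (kphi N' (2 ^ k)) *
  psum (Hk k) (fun n => normc (kpsi N' (2 ^ k) n)) <= 5 / 2 * d * 2 :> R.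
  by rewrite ler_pM ?mulr_ge0// ler_pM.
have b3 : psum (Hk k) (fun n => normc (kh N' (2 ^ k) n)) *
  psum (Hk k) (fun n => normc (kphi N' (2 ^ k) n)) * tail (Hk k) (kpsi N' (2 ^ k)) <=
  5 / 2 * 1 * d :> R.
  by rewrite ler_pM ?mulr_ge0// ler_pM.
have tx2 : 0 <= 2 * (t * rn x) by rewrite mulr_ge0.
apply: (le_trans (ler_wpM2l tx2 (lerD (lerD b1 b2) b3))).
by rewrite le_eqVlt /d; apply/orP; left; apply/eqP; lra.
Qed.

(** On the range of the trapezoid the sum is negligible by [kh_phiop_psiop]; on
    that of its complement, each term is at most [3 alpha] by [phiop_T_qop], and
    the coefficients have total mass [5 / 2]. *)
Lemma kh_phiop k x :
  rn (psum (Hk k) (fun n => kh N' (2 ^ k) n *: U n (phiop k (T (U (- n) x))))) <=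
  (15 / 2 * alpha + 3072 * t / 2 ^+ k) * rn x.
Proof.
have -> : psum (Hk k) (fun n => kh N' (2 ^ k) n *: U n (phiop k (T (U (- n) x)))) =
  psum (Hk k) (fun n => kh N' (2 ^ k) n *: U n (phiop k (T (psiop k (U (- n) x))))) +
  psum (Hk k) (fun n => kh N' (2 ^ k) n *: U n (phiop k (T (qop k (U (- n) x))))).
  rewrite -psumD; apply: eq_psum => n; rewrite -scalerDr.
  rewrite -(linear_mapD _ _ (act_linear aU _)) -(linear_mapD _ _ (phiop_linear k)).
  by rewrite -(linear_mapD _ _ lT) qopE addrC subrK.
apply: (le_trans (rnD _ _)); apply: (le_trans (lerD (kh_phiop_psiop k x) (lexx _))).
have h : rn (psum (Hk k) (fun n => kh N' (2 ^ k) n *: U n (phiop k (T (qop k (U (- n) x)))))) <=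
  5 / 2 * ((3 * alpha + 256 * t / 2 ^+ k) * rn x).
  apply: (le_trans (rn_psum _ _)) => /=.
  apply: (@le_trans _ _ (psum (Hk k) (fun n => normc (kh N' (2 ^ k) n)) *
    ((3 * alpha + 256 * t / 2 ^+ k) * rn x))).
    rewrite /psum mulr_suml; apply: ler_sum => i _ /=; rewrite rnZ.
    rewrite ler_wpM2l ?normc_ge0// (act_rn aU); apply: (le_trans (phiop_T_qop _ _)).
    by rewrite (act_rn aU).
  apply: ler_wpM2r; last exact: kh_l1.
  apply: mulr_ge0 (rn_ge0 x); apply: addr_ge0; first exact: mulr_ge0 (ler0n R 3) a0.
  apply: divr_ge0; last exact: exprn_ge0.
  exact: mulr_ge0 (ler0n R 256) t0.
apply: (le_trans (lerD (lexx _) h)).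
by rewrite le_eqVlt; apply/orP; left; apply/eqP; lra.
Qed.

End one_operator.
End one_action.

Section commutator.
Variables (U : int -> X -> X) (aU : isometric_action U).

(** The action multiplied by a character: rotating the character by [j] moves
    the triangle around the circle. *)
Definition twist (j : int) (n : int) (x : X) : X := chi N'.*2 (n * j) *: U n x.

Lemma twist_action j : isometric_action (twist j).
Proof.
split=> [n a x y|n x|m n x|x]; rewrite /twist.
- by rewrite (act_linear aU) scalerDr !scalerA mulrC.
- by rewrite rnZ normc_chi mul1r (act_rn aU).
- rewrite (linear_mapZ _ _ (act_linear aU _)) scalerA -chiD (act_add aU).
  by congr (chi _ _ *: _); ring.
- by rewrite mul0r chi0 scale1r (act0 aU).
Qed.

(** [kphi_partition], evaluated at the action. *)
Lemma sum_phiop_twist k x : psum N' (fun j => phiop (twist j) k x) = x.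
Proof.
have M0 : (0 < (Hk k).*2)%N by rewrite double_gt0.
rewrite /phiop /op /psum exchange_big/= -[RHS](act0 aU).
rewrite -[RHS](@psum_pdelta_window _ (Hk k) (fun n => U n x) 0 (H0 k)); last by have := H0 k; lia.
apply: eq_bigr => i _; rewrite subr0 (pdelta_window (H0 k)); last first.
  by have := wix_bound i; have := H0 k; lia.
rewrite -(@kphi_partition R _ _ N4 (pow0 k) _ (wix_bound i)) /psum scaler_suml.
by apply: eq_bigr => j _; rewrite /twist scalerA mulrC.
Qed.

Variables (T : X -> X) (t alpha delta : R).
Hypothesis lT : linear_map T.
Hypothesis t0 : 0 <= t.
Hypothesis Tt : forall x, rn (T x) <= t * rn x.
Hypothesis a0 : 0 <= alpha.
Hypothesis complX : rapidly_complete.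
Hypothesis T_near : forall y e, 0 < e -> exists (S : X -> X) (s : R),
  [/\ linear_map S, forall x, rn (S x) <= s * rn x,
      forall n x, S (U n x) = U n (S x) & rn (T y - S y) <= alpha * rn y + e].
Hypothesis N20 : 20 * pi <= N'%:R :> R.
Hypothesis d0 : 0 <= delta.
Hypothesis T_delta : forall n x, rn (U n (T (U (- n) x)) - T x) <= delta * rn x.

(** The coefficients [kh] differ from those of [z - 1] by [kw], so the conjugate
    of [T] by [U 1] minus [T] is the sum of a [kh]-part and a [kw]-part. Cutting
    the former by the [2 N'] rotated triangles and applying [kh_phiop] to each
    gives [2 N' * 15 / 2 * alpha]; the latter is at most half of [delta] by
    [kw_l1] because [kw] sums to 0. *)
Lemma commutator_estimate x :
  rn (U 1 (T (U (- 1) x)) - T x) <= (15 * N'%:R * alpha + delta / 2) * rn x.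
Proof.
have x0 := rn_ge0 x.
apply: (@le_pow2_lim _ _ _ (N'.*2%:R * (3072 * t) * rn x) 0) => k _.
pose Z n := U n (T (U (- n) x)).
have H4 : (4 <= Hk k)%N by rewrite (leq_trans N4)// leq_pmulr.
have ZE : Z 1 - T x = psum (Hk k) (fun n => kh N' (2 ^ k) n *: Z n) +
    psum (Hk k) (fun n => kw N' (2 ^ k) n *: (Z n - T x)).
  have -> : psum (Hk k) (fun n => kw N' (2 ^ k) n *: (Z n - T x)) =
    psum (Hk k) (fun n => kw N' (2 ^ k) n *: Z n).
    under eq_psum do rewrite scalerBr.
    rewrite psumB; have := @psum_kw R N' (2 ^ k); rewrite /psum -scaler_suml.
    by move=> ->; rewrite ?scale0r ?subr0.
  rewrite -psumD.
  have -> : T x = Z 0 by rewrite /Z oppr0 !(act0 aU).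
  rewrite -(@psum_pdelta_window _ (Hk k) Z 1 (H0 k)); last by lia.
  rewrite -(@psum_pdelta_window _ (Hk k) Z 0 (H0 k)); last by lia.
  rewrite -psumB; apply: eq_psum => n.
  by rewrite -scalerDl -scalerBl subr0 /kh subrK.
rewrite -/(Z 1) ZE; apply: (le_trans (rnD _ _)).
have p2 : rn (psum (Hk k) (fun n => kw N' (2 ^ k) n *: (Z n - T x))) <= 1 / 2 * (delta * rn x).
  apply: (le_trans (rn_psum _ _)) => /=.
  apply: (@le_trans _ _ (psum (Hk k) (fun n => normc (kw N' (2 ^ k) n)) * (delta * rn x))).
    rewrite /psum mulr_suml; apply: ler_sum => i _ /=.
    by rewrite rnZ ler_wpM2l ?normc_ge0// T_delta.
  by rewrite ler_wpM2r ?mulr_ge0// kw_l1.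
have p1 : rn (psum (Hk k) (fun n => kh N' (2 ^ k) n *: Z n)) <=
    N'.*2%:R * ((15 / 2 * alpha + 3072 * t / 2 ^+ k) * rn x).
  have -> : psum (Hk k) (fun n => kh N' (2 ^ k) n *: Z n) =
    psum N' (fun j => psum (Hk k) (fun n =>
      kh N' (2 ^ k) n *: twist j n (phiop (twist j) k (T (twist j (- n) x))))).
    rewrite /psum exchange_big/=; apply: eq_bigr => i _; set n := wix i.
    rewrite /Z -[T (U (- n) x)](sum_phiop_twist k) /psum.
    rewrite (linear_map_sum _ _ _ (act_linear aU _)) scaler_sumr.
    apply: eq_bigr => j _; congr (_ *: _); rewrite {2}/twist [in RHS]/twist.
    rewrite (linear_mapZ _ _ lT) (linear_mapZ _ _ (phiop_linear (twist_action _) _)).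
    rewrite (linear_mapZ _ _ (act_linear aU _)) scalerA -chiD.
    by rewrite -mulrDl subrr mul0r chi0 scale1r.
  apply: (le_trans (rn_psum _ _)).
  apply: (@le_trans _ _ (psum N' (fun=> (15 / 2 * alpha + 3072 * t / 2 ^+ k) * rn x))); last first.
    by rewrite /psum sumr_const card_ord [leRHS]mulr_natl.
  apply: ler_sum => j _ /=; apply: (kh_phiop (twist_action _)) => //.
  move=> y e e0; have [S [s [lS Ss SU Se]]] := T_near y e0; exists S, s; split => // n z.
  by rewrite /twist (linear_mapZ _ _ lS) SU.
apply: (le_trans (lerD p1 p2)); rewrite -!muln2 !natrM.
by rewrite le_eqVlt; apply/orP; left; apply/eqP; lra.
Qed.

End commutator.
End local_estimate.

(** * Powers of the modulus *)

Section power_continuity.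
Context {R : realType}.
Local Notation C := R[i].

Lemma powR_continuous_gt0 (p x : R) : 0 < x ->
  y `^ p @[y --> x] --> x `^ p.
Proof.
move=> x0; have dx : derivable (fun y : R^o => y `^ p : R^o) x 1.
  by apply: derivable_powR; rewrite in_itv/= x0.
exact: (differentiable_continuous (proj1 (derivable1_diffP _ _) dx)).
Qed.

Lemma powR_norm_continuous (p : R) : 0 < p -> continuous (fun x : R => `|x| `^ p).
Proof.
move=> p0 x; have [->|x0] := eqVneq x 0; last first.
  apply: (@cvg_comp _ _ _ (fun x : R => `|x|) (fun y => y `^ p)).
    exact: (@norm_continuous _ R^o).
  by apply: powR_continuous_gt0; rewrite normr_gt0.
apply/(@cvgrPdist_lt _ R^o) => e e0; rewrite normr0 powR0 ?gt_eqF//.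
have d0 : 0 < e `^ p^-1 by rewrite powR_gt0.
near=> y.
rewrite sub0r normrN ger0_norm ?powR_ge0//.
have -> : e = (e `^ p^-1) `^ p by rewrite -powRrM mulVf ?gt_eqF// powRr1// ltW.
apply: gt0_ltr_powR; rewrite ?nnegrE ?powR_ge0//.
Unshelve. all: by end_near. Qed.

Lemma cvg_normc (T : Type) (F : set_system T) (FF : Filter F) (u : T -> C) (z : C) :
  complex.Re (u t) @[t --> F] --> complex.Re z ->
  complex.Im (u t) @[t --> F] --> complex.Im z ->
  normc (u t) @[t --> F] --> normc z.
Proof.
move=> hr hi.
have E w : normc w = Num.sqrt (complex.Re w ^+ 2 + complex.Im w ^+ 2) by case: w.
under eq_cvg do rewrite E.
rewrite E; apply: (@cvg_comp _ _ _ _ Num.sqrt); last exact: sqrt_continuous.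
by apply: cvgD; rewrite expr2; under eq_cvg do rewrite expr2; apply: cvgM.
Qed.

Lemma cvg_normc_powR (T : Type) (F : set_system T) (FF : Filter F) (u : T -> C) (z : C) p :
  0 < p -> complex.Re (u t) @[t --> F] --> complex.Re z ->
  complex.Im (u t) @[t --> F] --> complex.Im z ->
  normc (u t) `^ p @[t --> F] --> normc z `^ p.
Proof.
move=> p0 hr hi.
have h := cvg_normc FF hr hi.
under eq_cvg => t do rewrite -[normc (u t)]ger0_norm ?normc_ge0//.
rewrite -[normc z]ger0_norm ?normc_ge0//.
apply: (@cvg_comp _ _ _ (fun t => normc (u t)) (fun x : R => `|x| `^ p)); first exact: h.
exact: powR_norm_continuous.
Qed.

Lemma normc_ge_absRe (z : C) : `|complex.Re z| <= normc z.
Proof. by case: z => a b /=; rewrite -sqrtr_sqr ler_wsqrtr// lerDl sqr_ge0. Qed.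

Lemma normc_ge_absIm (z : C) : `|complex.Im z| <= normc z.
Proof. by case: z => a b /=; rewrite -sqrtr_sqr ler_wsqrtr// lerDr sqr_ge0. Qed.

End power_continuity.

Section pnorm.
Context d (T : measurableType d) (R : realType).
Variables (mu : {measure set T -> \bar R}) (p : R).
Hypothesis p1 : 1 <= p.
Local Notation C := R[i].

Let p0 : 0 < p. Proof. exact: lt_le_trans p1. Qed.

Definition Ip (f : T -> C) : \bar R := (\int[mu]_x ((normc (f x) `^ p)%:E))%E.

Lemma Ip_ge0 f : (0 <= Ip f)%E.
Proof. by apply: integral_ge0 => x _; rewrite lee_fin powR_ge0. Qed.

Lemma cLnorm_Ip f : (cLnorm mu p f `^ p = Ip f)%E.
Proof.
rewrite /cLnorm powR_Lnorm; last by rewrite gt_eqF.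
apply: eq_integral => x _ /=.
by rewrite ger0_norm ?normc_ge0// poweR_EFin.
Qed.

Lemma cLnormE f : (cLnorm mu p f = Ip f `^ p^-1)%E.
Proof.
rewrite -cLnorm_Ip -poweRrM ?mulfV ?gt_eqF// poweRe1// cLnorm_ge0//.
Qed.

(** Bounds on the norm are proved on the integral, which is where Fatou's lemma
    and dominated convergence apply. *)
Lemma Ip_le f (c : R) : 0 <= c -> (cLnorm mu p f <= c%:E)%E = (Ip f <= (c `^ p)%:E)%E.
Proof.
move=> c0; apply/idP/idP => h.
  rewrite -cLnorm_Ip -poweR_EFin; apply: gt0_ler_poweR => //; first exact: ltW.
    by rewrite in_itv/= cLnorm_ge0 leey.
  by rewrite in_itv/= lee_fin c0 leey.
rewrite cLnormE (_ : c%:E = ((c `^ p)%:E `^ p^-1)%E); last first.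
  by rewrite poweR_EFin -powRrM mulfV ?gt_eqF// powRr1.
apply: gt0_ler_poweR => //; first by rewrite invr_ge0 ltW.
  by rewrite in_itv/= Ip_ge0 leey.
by rewrite in_itv/= lee_fin powR_ge0 leey.
Qed.

Lemma measurable_normc_powR (f : T -> C) : cmeasurable f ->
  measurable_fun setT (fun x => (normc (f x) `^ p)%:E).
Proof.
move=> mf; apply/measurable_EFinP.
apply: (@measurableT_comp _ _ _ _ _ _ (@powR R ^~ p)) => //.
exact: cmeasurable_normc.
Qed.

Lemma cmeasurableN (f : T -> C) : cmeasurable f -> cmeasurable (- f).
Proof. by move=> mf; rewrite -scaleN1r; exact: cmeasurableZ. Qed.

Lemma cmeasurableB (f g : T -> C) : cmeasurable f -> cmeasurable g -> cmeasurable (f - g).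
Proof. by move=> mf mg; apply: cmeasurableD => //; exact: cmeasurableN. Qed.

Lemma cmeasurable_real (f : T -> R) : measurable_fun setT f ->
  cmeasurable (fun x => (f x)%:C : C).
Proof. by move=> mf; split => //=; exact: measurable_cst. Qed.

Lemma le_Ip f g : cmeasurable f -> cmeasurable g ->
  (forall x, normc (f x) <= normc (g x)) -> (Ip f <= Ip g)%E.
Proof.
move=> mf mg fg; apply: ge0_le_integral => //.
- by move=> x _; rewrite lee_fin powR_ge0.
- exact: measurable_normc_powR.
- exact: measurable_normc_powR.
- move=> x _; rewrite lee_fin; apply: ge0_ler_powR; rewrite ?nnegrE ?normc_ge0//.
  exact: ltW.
Qed.

End pnorm.

(** * Completeness of the Lebesgue spaces *)

Section completeness.
Context d (T : measurableType d) (R : realType).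
Variables (mu : {measure set T -> \bar R}) (p : R).
Hypothesis p1 : 1 <= p.
Local Notation C := R[i].

Let p0 : 0 < p. Proof. exact: lt_le_trans p1. Qed.

Lemma fatou_le (f : (T -> \bar R)^nat) (g : T -> \bar R) (B : \bar R) :
  (forall n, measurable_fun setT (f n)) -> (forall n x, (0 <= f n x)%E) ->
  (forall x, f n x @[n --> \oo] --> g x) ->
  (forall n, (\int[mu]_x f n x <= B)%E) -> (\int[mu]_x g x <= B)%E.
Proof.
move=> mf f0 fg fB.
have -> : (\int[mu]_x g x = \int[mu]_x limn_einf (f^~ x))%E.
  by apply: eq_integral => x _; rewrite (cvg_limn_einf_sup (fg x)).1.
apply: (le_trans (fatou mu measurableT mf (fun n x _ => f0 n x))).
rewrite limn_einf_lim; apply: lime_le; first exact: is_cvg_einfs.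
near=> n; apply: le_trans (fB n); apply: ereal_inf_lbound; exists n => //=.
Unshelve. all: by end_near. Qed.

Lemma cLnormB_chain (f : nat -> T -> C) (c : R) n m :
  (forall k, cmeasurable (f k)) ->
  (forall k, (cLnorm mu p (f k.+1 - f k)%R <= (c / 2 ^+ k)%:E)%E) ->
  (cLnorm mu p (f (n + m)%N - f n)%R <= (2 * c / 2 ^+ n - 2 * c / 2 ^+ (n + m))%:E)%E.
Proof.
move=> mf fc; elim: m => [|m IH].
  by rewrite addn0 !subrr cLnorm0.
rewrite addnS -(subrKA (f (n + m)%N)).
apply: (le_trans (cLnormD mu p1 _ _)); [exact: cmeasurableB..|].
apply: (le_trans (leeD (fc _) IH)).
rewrite -EFinD lee_fin le_eqVlt; apply/orP; left; apply/eqP.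
by rewrite exprS; field; rewrite !expf_neq0.
Qed.

Lemma cLnorm_sum (f : nat -> T -> C) (c : R) n :
  (forall k, cmeasurable (f k)) ->
  (forall k, (cLnorm mu p (f k) <= (c / 2 ^+ k)%:E)%E) ->
  (cLnorm mu p (\sum_(k < n) f k)%R <= (2 * c - 2 * c / 2 ^+ n)%:E)%E /\
  cmeasurable (\sum_(k < n) f k).
Proof.
move=> mf fc; elim: n => [|n [IH mS]].
  by rewrite big_ord0 (cLnorm0 mu p1) expr0 divr1 subrr; split => //; split; exact: measurable_cst.
rewrite big_ord_recr/=; split; last exact: cmeasurableD.
apply: (le_trans (cLnormD mu p1 _ _)) => //.
apply: (le_trans (leeD IH (fc n))).
rewrite -EFinD lee_fin le_eqVlt; apply/orP; left; apply/eqP.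
by rewrite exprS; field; rewrite !expf_neq0.
Qed.

Lemma series_cvg_bounded (u : R^nat) (B : R) :
  (forall n, \sum_(k < n) `|u k.+1 - u k| <= B) -> cvgn u.
Proof.
move=> uB; have h : cvgn (series (fun k => u k.+1 - u k)).
  apply: (@normed_cvg _ R^o); apply: nondecreasing_is_cvgn.
    by apply: nondecreasing_series => n _ _ /=.
  by exists B => _ [n _ <-]; have := uB n; rewrite -(big_mkord xpredT (fun k => `|u k.+1 - u k|)).
have -> : u = (fun n => u 0%N + series (fun k => u k.+1 - u k) n).
  by apply/funext => n; rewrite /series/= telescope_sumr// addrC subrK.
by apply: is_cvgD => //; exact: is_cvg_cst.
Qed.

(** Riesz-Fischer: the sum of the moduli of the increments has finite norm, so
    the sequence converges almost everywhere; Fatou's lemma then bounds the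
    distance to the limit. *)
Lemma Lp_rapid (f : nat -> T -> C) (c : R) : 0 <= c ->
  (forall k, cmeasurable (f k)) ->
  (forall k, (cLnorm mu p (f k.+1 - f k)%R <= (c / 2 ^+ k)%:E)%E) ->
  exists g, cmeasurable g /\ forall n, (cLnorm mu p (f n - g)%R <= (2 * c / 2 ^+ n)%:E)%E.
Proof.
move=> c0 mf fc.
pose D k x : C := (normc (f k.+1 x - f k x))%:C.
have mD k : cmeasurable (D k).
  by apply: cmeasurable_real; apply: cmeasurable_normc; exact: cmeasurableB.
have Dc k : (cLnorm mu p (D k) <= (c / 2 ^+ k)%:E)%E.
  rewrite (_ : cLnorm mu p (D k) = cLnorm mu p (f k.+1 - f k)%R)//.
  rewrite !(cLnormE mu p1); congr (_ `^ _)%E; apply: eq_integral => x _.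
  by rewrite /D normcC ger0_norm ?normc_ge0.
pose G n x := \sum_(k < n) normc (f k.+1 x - f k x).
have GE n : \sum_(k < n) D k = (fun x => (G n x)%:C).
  apply/funext => x; rewrite fct_sumE /G rmorph_sum//.
have G0 n x : 0 <= G n x by apply: sumr_ge0 => k _; exact: normc_ge0.
have mG n : cmeasurable (fun x => (G n x)%:C : C).
  by rewrite -GE; have [] := cLnorm_sum n mD Dc.
have GI n : (Ip mu p (fun x => (G n x)%:C) <= ((2 * c) `^ p)%:E)%E.
  rewrite -Ip_le// ?mulr_ge0// -GE; have [h _] := cLnorm_sum n mD Dc.
  apply: (le_trans h); rewrite lee_fin gerBl divr_ge0 ?mulr_ge0 ?exprn_ge0//.
pose u n x := (normc (G n x)%:C `^ p)%:E : \bar R.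
have umono x : {homo (fun n => u n x) : n m / (n <= m)%N >-> (n <= m)%E}.
  move=> n m nm; rewrite /u lee_fin !normcC !ger0_norm//.
  apply: ge0_ler_powR; rewrite ?nnegrE//; first exact: ltW.
  rewrite /G -!(big_mkord xpredT (fun k => normc (f k.+1 x - f k x))).
  by rewrite [leRHS](big_cat_nat (n := n))//= lerDl sumr_ge0// => k _; exact: normc_ge0.
pose L x := limn (fun n => u n x).
have uL x : u n x @[n --> \oo] --> L x by exact: ereal_nondecreasing_is_cvgn.
have mu_ n : measurable_fun setT (u n) by exact: measurable_normc_powR.
have u0 n x : (0 <= u n x)%E by rewrite lee_fin powR_ge0.
have LI : (\int[mu]_x L x <= ((2 * c) `^ p)%:E)%E by exact: (fatou_le mu_ u0 uL GI).
have mL : measurable_fun setT L.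
  by apply: (emeasurable_fun_cvg u) => // x _; exact: uL.
have L0 x : (0 <= L x)%E by apply: lime_ge; [exact: uL|exact: nearW].
have iL : mu.-integrable setT L.
  apply/integrableP; split => //; rewrite (eq_integral L) => [|x _]; last by rewrite gee0_abs.
  exact: le_lt_trans LI (ltry _).
pose A := [set x | L x \is a fin_num].
have mA : measurable A by rewrite -[A]setTI; exact: emeasurable_fin_num.
have AeA : {ae mu, forall x, A x}.
  by apply: filterS (integrable_ae measurableT iL) => x /(_ I).
have Abd x : A x -> forall n, G n x <= (fine (L x)) `^ p^-1.
  move=> Ax n; have : (u n x <= L x)%E.
    by apply: lime_ge; [exact: uL|exists n => // m /= nm; exact: umono].
  rewrite -[L x]fineK// /u lee_fin normcC ger0_norm// => h.
  rewrite -[G n x](@powRr1 _) // -(mulfV (lt0r_neq0 p0)) powRrM.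
  by rewrite /=; apply: ge0_ler_powR; rewrite ?nnegrE ?powR_ge0 ?invr_ge0 ?(ltW p0)// fine_ge0.
have cvR x : A x -> cvgn (fun n => complex.Re (f n x)).
  move=> Ax; apply: (@series_cvg_bounded _ ((fine (L x)) `^ p^-1)) => n.
  apply: le_trans (Abd x Ax n); apply: ler_sum => k _.
  by rewrite -raddfB; exact: normc_ge_absRe.
have cvI x : A x -> cvgn (fun n => complex.Im (f n x)).
  move=> Ax; apply: (@series_cvg_bounded _ ((fine (L x)) `^ p^-1)) => n.
  apply: le_trans (Abd x Ax n); apply: ler_sum => k _.
  by rewrite -raddfB; exact: normc_ge_absIm.
pose h n x : C := (\1_A x)%:C * f n x.
have hA n x : A x -> h n x = f n x by move=> Ax; rewrite /h indicE mem_set// mul1r.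
have hNA n x : ~ A x -> h n x = 0 by move=> Ax; rewrite /h indicE memNset// mul0r.
pose g x : C := limn (fun n => complex.Re (h n x)) +i* limn (fun n => complex.Im (h n x)).
have hgR x : complex.Re (h n x) @[n --> \oo] --> complex.Re (g x).
  have [Ax|nAx] := pselect (A x).
    by rewrite /g/=; under eq_fun do rewrite (hA _ _ Ax); exact: cvR.
  rewrite /g/=; under eq_fun do rewrite (hNA _ _ nAx); exact: is_cvg_cst.
have hgI x : complex.Im (h n x) @[n --> \oo] --> complex.Im (g x).
  have [Ax|nAx] := pselect (A x).
    by rewrite /g/=; under eq_fun do rewrite (hA _ _ Ax); exact: cvI.
  rewrite /g/=; under eq_fun do rewrite (hNA _ _ nAx); exact: is_cvg_cst.
have mh n : cmeasurable (h n).
  have [fr fi] := mf n; split.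
    rewrite (_ : (fun x => _) = (fun x => \1_A x * complex.Re (f n x))).
      by apply: measurable_funM => //; exact: measurable_indic.
    by apply/funext => x; rewrite /h; case: (f n x) => a b /=; rewrite mul0r subr0.
  rewrite (_ : (fun x => _) = (fun x => \1_A x * complex.Im (f n x))).
    by apply: measurable_funM => //; exact: measurable_indic.
  by apply/funext => x; rewrite /h; case: (f n x) => a b /=; rewrite mul0r addr0.
have mg : cmeasurable g.
  split.
    by apply: (@measurable_fun_cvg _ _ _ _ (fun n x => complex.Re (h n x))) => [n|x _];
       [have [] := mh n|exact: hgR].
  by apply: (@measurable_fun_cvg _ _ _ _ (fun n x => complex.Im (h n x))) => [n|x _];
     [have [] := mh n|exact: hgI].
exists g; split=> // n.
have -> : cLnorm mu p (f n - g)%R = cLnorm mu p (h n - g)%R.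
  apply: eq_cLnorm; [|exact: cmeasurableB..].
  by apply: filterS AeA => x Ax; rewrite !fctE hA.
have cn0 : 0 <= 2 * c / 2 ^+ n by rewrite divr_ge0 ?mulr_ge0 ?exprn_ge0.
rewrite Ip_le//.
apply: (@fatou_le (fun m x => (normc (h n x - h (n + m)%N x) `^ p)%:E)).
- by move=> m; have := measurable_normc_powR p (cmeasurableB (mh n) (mh (n + m)%N)).
- by move=> m x; rewrite lee_fin powR_ge0.
- move=> x; apply/cvg_EFin; first exact: nearW.
  have sh (v : R^nat) (l : R) : v m @[m --> \oo] --> l -> v (n + m)%N @[m --> \oo] --> l.
    rewrite -(cvg_shiftn n) (_ : [sequence v (m + n)%N]_m = (fun m => v (n + m)%N))//.
    by apply/funext => m; rewrite /= addnC.
  apply: cvg_normc_powR => //.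
    under eq_cvg do rewrite raddfB/=.
    by rewrite !fctE raddfB/=; apply: cvgB; [exact: cvg_cst|exact: (sh _ _ (hgR x))].
  under eq_cvg do rewrite raddfB/=.
  by rewrite !fctE raddfB/=; apply: cvgB; [exact: cvg_cst|exact: (sh _ _ (hgI x))].
- move=> m; apply: (@le_trans _ _ (Ip mu p (f (n + m)%N - f n)%R)).
    apply: (@le_Ip _ _ _ _ _ p1 (h n - h (n + m)%N)); [exact: cmeasurableB..|].
    move=> x; rewrite !fctE; have [Ax|nAx] := pselect (A x).
      by rewrite !hA// normcB.
    by rewrite !hNA// subrr normc0 normc_ge0.
  rewrite -Ip_le//; apply: (le_trans (cLnormB_chain n m mf fc)).
  by rewrite lee_fin gerBl divr_ge0 ?mulr_ge0 ?exprn_ge0.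
Qed.

Lemma Lp_rapidly_complete : @rapidly_complete R (Lp mu p1).
Proof.
move=> u c uc.
have rnL (f : Lpfun mu p1) : (rn (Lp_class f))%:E = cLnorm mu p f.
  by rewrite -cLnorm_fin /rn -[`|_|]/(Lp_norm _) Lp_norm_class.
have LB (x y : Lp mu p1) : x - y = Lp_class (repr x - repr y).
  by rewrite -{1}[x]Lp_reprK -{1}[y]Lp_reprK -scaleN1r addrC -Lp_class_linear scaleN1r addrC.
have c0 : 0 <= c.
  have := uc 0%N; rewrite expr0 divr1; apply: le_trans; exact: rn_ge0.
have mr (x : Lp mu p1) : cmeasurable (repr x : T -> C) by have /cLfunP[] := LpfunP (repr x).
have uc' k : (cLnorm mu p ((repr (u k.+1) : T -> C) - repr (u k))%R <= (c / 2 ^+ k)%:E)%E.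
  by have := uc k; rewrite LB -lee_fin rnL.
have [g [mg gc]] := @Lp_rapid (fun k => repr (u k)) c c0 (fun k => mr (u k)) uc'.
have gL : g \in cLfunp mu p1.
  apply/cLfunP; split => //.
  rewrite -[g](subKr (repr (u 0%N) : T -> C)).
  apply: (le_lt_trans (cLnormD mu p1 _ _)) => //.
    by apply: cmeasurableN; exact: cmeasurableB.
  rewrite -scaleN1r cLnormZ ?normcN ?normc1 ?mul1e//; last exact: cmeasurableB.
  rewrite lte_add_pinfty//.
    by have /cLfunP[] := LpfunP (repr (u 0%N)).
  by apply: (le_lt_trans (gc 0%N)); rewrite ltry.
exists (Lp_class (MkLpfun gL)) => n.
have -> : u n - Lp_class (MkLpfun gL) = Lp_class (repr (u n) - MkLpfun gL).
  rewrite -{1}[u n]Lp_reprK -scaleN1r addrC -Lp_class_linear scaleN1r addrC//.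
by rewrite -lee_fin rnL; exact: gc.
Qed.

End completeness.

(** * Uniform convexity *)

Section convexity.
Context {R : realType}.
Local Notation C := R[i].
Variables (p q : R).
Hypothesis p1 : 1 < p.
Hypothesis q1 : 1 < q.
Hypothesis pq : p^-1 + q^-1 = 1.

Let p0 : 0 < p. Proof. exact: lt_trans p1. Qed.
Let q0 : 0 < q. Proof. exact: lt_trans q1. Qed.

Lemma conjugate_divE : q / p = q - 1.
Proof.
have -> : p^-1 = 1 - q^-1 by rewrite -pq addrK.
by rewrite mulrBr mulr1 divff// gt_eqF.
Qed.

Lemma conjugate_mulE : (q - 1) * p = q.
Proof. by rewrite -conjugate_divE divfK// gt_eqF. Qed.

(** Young's inequality with the second factor equal to 1. *)
Lemma bernoulli_le (x : R) : 0 <= x -> 1 + q * (x - 1) <= x `^ q.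
Proof.
move=> x0; have := conjugate_powR x0 ler01 q0 p0.
rewrite addrC => /(_ pq); rewrite mulr1 powR1 => h.
have : q * x <= q * (x `^ q / q + 1 / p) by rewrite ler_wpM2l// ltW.
rewrite mulrDr mulrCA divff ?gt_eqF// mulr1 mulrA mulr1 conjugate_divE; lra.
Qed.

(** Strictness comes from that of [1 + y < exp y] at [y = (q - 1) ln x] and
    [y = - ln x]. *)
Lemma bernoulli_lt (x : R) : 1 < x -> 1 + q * (x - 1) < x `^ q.
Proof.
move=> x1; have x0 : 0 < x by exact: lt_trans x1.
have L0 : 0 < ln x by exact: ln_gt0.
have h1 : 1 + (q - 1) * ln x < expR ((q - 1) * ln x).
  by apply: expR_gt1Dx; rewrite mulf_neq0 ?gt_eqF// subr_gt0.
have h2 : 1 - ln x < expR (- ln x) by apply: expR_gt1Dx; rewrite oppr_eq0 gt_eqF.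
have e1 : x * expR ((q - 1) * ln x) = x `^ q.
  rewrite /powR gt_eqF// -{1}(lnK x0) -expRD; congr expR; ring.
have e2 : x * expR (- ln x) = 1.
  by rewrite -{1}(lnK x0) -expRD subrr expR0.
have k1 : x * (1 + (q - 1) * ln x) < x `^ q by rewrite -e1 ltr_pM2l.
have k2 : x * (1 - ln x) < 1 by rewrite -[ltRHS]e2 ltr_pM2l.
have q10 : 0 < q - 1 by rewrite subr_gt0.
have k3 : (q - 1) * (x * (1 - ln x)) < (q - 1) * 1 by rewrite ltr_pM2l.
have -> : 1 + q * (x - 1) = x * (1 + (q - 1) * ln x) + (q - 1) * (x * (1 - ln x)) - (q - 1) by ring.
lra.
Qed.

Lemma powR_midpoint (x y : R) : 0 <= x -> 0 <= y ->
  ((x + y) / 2) `^ q <= (x `^ q + y `^ q) / 2.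
Proof.
move=> x0 y0; have [m0|m0] := eqVneq ((x + y) / 2) 0.
  by rewrite m0 powR0 ?gt_eqF// divr_ge0// addr_ge0// powR_ge0.
set m := (x + y) / 2 in m0 *.
have m1 : 0 < m by rewrite lt_neqAle eq_sym m0 divr_ge0// addr_ge0.
have hx := bernoulli_le (divr_ge0 x0 (ltW m1)).
have hy := bernoulli_le (divr_ge0 y0 (ltW m1)).
have ex : m `^ q * (x / m) `^ q = x `^ q.
  by rewrite -(powRM q (ltW m1) (divr_ge0 x0 (ltW m1))) mulrC divfK// gt_eqF.
have ey : m `^ q * (y / m) `^ q = y `^ q.
  by rewrite -(powRM q (ltW m1) (divr_ge0 y0 (ltW m1))) mulrC divfK// gt_eqF.
have s2 : x / m + y / m = 2 by rewrite -mulrDl (_ : x + y = 2 * m) ?mulfK// /m; lra.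
have mq : 0 <= m `^ q by exact: powR_ge0.
have : m `^ q * (1 + q * (x / m - 1) + (1 + q * (y / m - 1))) <=
       m `^ q * ((x / m) `^ q + (y / m) `^ q).
  by rewrite ler_wpM2l// lerD.
rewrite [in X in _ <= X]mulrDr ex ey.
have -> : 1 + q * (x / m - 1) + (1 + q * (y / m - 1)) = 2 + q * (x / m + y / m - 2) by ring.
rewrite s2 subrr mulr0 addr0; lra.
Qed.

(** The convexity gap of [x `^ q] at 1 for the increments [t] and [- t]. *)
Let psi (t : R) := ((1 + t) `^ q + (1 - t) `^ q) / 2 - 1.

Lemma psi_gt0 t : 0 < t -> t <= 1 -> 0 < psi t.
Proof.
move=> t0 t1; have h1 : 1 < 1 + t by lra.
have := bernoulli_lt h1.
have h2 : 0 <= 1 - t by lra.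
have := bernoulli_le h2; rewrite /psi; lra.
Qed.

Lemma psi_le t0 t : 0 <= t0 -> t0 <= t -> t <= 1 -> psi t0 <= psi t.
Proof.
move=> h0 ht t1; have t00 : 0 <= t by lra.
(* by evenness, [1 - t0] and [1 + t0] lie between [1 - t] and [1 + t] *)
have [->|tt] := eqVneq t t0; first by [].
have tpos : 0 < t by rewrite lt_neqAle t00 andbT eq_sym; apply: contra_neq tt => t_0; lra.
have a0 : 0 <= (1 + t0 / t) / 2 by rewrite divr_ge0 ?addr_ge0 ?divr_ge0.
have r1 : t0 / t <= 1 by rewrite ler_pdivrMr// mul1r.
pose l : R := (1 + t0 / t) / 2.
have l0 : 0 <= l by [].
have l1 : l <= 1 by rewrite /l; lra.
have cv (x y : R) : 0 <= x -> 0 <= y -> (l * x + (1 - l) * y) `^ q <= l * x `^ q + (1 - l) * y `^ q.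
  move=> x0 y0.
  have l01 : 0 <= l <= 1 by rewrite l0.
  have := @convex_powR R q (ltW q1) (Itv01 l0 l1) x y.
  rewrite !inE/= !in_itv/= !andbT => /(_ x0 y0).
  by rewrite !convRE.
have e1 : 1 + t0 = l * (1 + t) + (1 - l) * (1 - t).
  by rewrite /l; field; rewrite gt_eqF.
have e2 : 1 - t0 = l * (1 - t) + (1 - l) * (1 + t).
  by rewrite /l; field; rewrite gt_eqF.
have p1t : 0 <= 1 + t by lra.
have m1t : 0 <= 1 - t by lra.
have := cv _ _ p1t m1t; have := cv _ _ m1t p1t; rewrite -e1 -e2 /psi.
set A := (1 + t) `^ q; set B := (1 - t) `^ q => H1 H2.
lra.
Qed.

(** The uniform convexity of the modulus to the power [q] on the unit disk:
    two points of which one is 1 differ either in modulus or in argument. *)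
Lemma gap_disk (eta : R) : 0 < eta -> eta <= 1 -> exists2 delta : R, 0 < delta &
  forall u : C, normc u <= 1 -> eta <= normc (1 - u) ->
  delta <= (1 + normc u `^ q) / 2 - normc ((1 + u) / 2) `^ q.
Proof.
move=> e0 e1.
pose c := eta ^+ 2 / 16.
have c0 : 0 < c by rewrite divr_gt0// exprn_gt0.
have c1 : c < 1.
  by rewrite /c ltr_pdivrMr// mul1r; apply: (@le_lt_trans _ _ 1); rewrite ?exprn_ile1 ?(ltW e0)// ltr1n.
pose k := 1 - (1 - c) `^ (q / 2).
have k0 : 0 < k.
  have : (1 - c) `^ (q / 2) < 1 `^ (q / 2).
    by apply: gt0_ltr_powR; rewrite ?nnegrE ?divr_gt0//; lra.
  by rewrite powR1 /k subr_gt0.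
have ps0 : 0 < psi (eta / 4) by apply: psi_gt0; lra.
pose d := (1 / 2 : R) `^ q.
have d0 : 0 < d by rewrite powR_gt0.
exists (d * Num.min (psi (eta / 4)) k).
  by rewrite mulr_gt0// lt_min ps0.
move=> u u1 ue; set r := normc u in u1 *.
have r0 : 0 <= r by exact: normc_ge0.
pose s := (1 + r) / 2.
have s12 : 1 / 2 <= s by rewrite /s; lra.
have s1 : s <= 1 by rewrite /s; lra.
have s0 : 0 < s by lra.
have sd : d <= s `^ q by apply: ge0_ler_powR; rewrite ?nnegrE ?(ltW q0)//; lra.
have ms : normc ((1 + u) / 2) <= s.
  have -> : (1 + u) / 2 = (1 / 2 : R)%:C * (1 + u).
    by rewrite mulrC; congr (_ * _); rewrite rmorphM/= rmorph1 mul1r fmorphV rmorph_nat.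
  rewrite normcM normcC ger0_norm// /s.
  have := le_normcD 1 u; rewrite normc1 -/r; lra.
have m0 : 0 <= normc ((1 + u) / 2) by exact: normc_ge0.
have [rsmall|rlarge] := leP (eta / 2) (1 - r).
  pose t := (1 - r) / (1 + r).
  have r10 : 0 < 1 + r by lra.
  have t4 : eta / 4 <= t.
    rewrite /t ler_pdivlMr//; have : eta / 4 * (1 + r) <= eta / 4 * 2 by rewrite ler_wpM2l//; lra.
    lra.
  have t1 : t <= 1 by rewrite /t ler_pdivrMr//; lra.
  have E1 : s * (1 + t) = 1 by rewrite /s /t; field; rewrite gt_eqF.
  have E2 : s * (1 - t) = r by rewrite /s /t; field; rewrite gt_eqF.
  have P1 : s `^ q * (1 + t) `^ q = 1.
    by rewrite -powRM ?E1 ?powR1//; lra.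
  have P2 : s `^ q * (1 - t) `^ q = r `^ q.
    by rewrite -powRM ?E2//; lra.
  have P3 : normc ((1 + u) / 2) `^ q <= s `^ q.
    by apply: ge0_ler_powR; rewrite ?nnegrE ?(ltW q0)//; lra.
  have P4 : s `^ q * psi t = (1 + r `^ q) / 2 - s `^ q.
    have -> : s `^ q * psi t = (s `^ q * (1 + t) `^ q + s `^ q * (1 - t) `^ q) / 2 - s `^ q.
      by rewrite /psi; ring.
    by rewrite P1 P2.
  have P5 : psi (eta / 4) <= psi t by apply: psi_le; lra.
  have P6 : d * Num.min (psi (eta / 4)) k <= s `^ q * psi t.
    apply: (@le_trans _ _ (d * psi (eta / 4))).
      by rewrite ler_pM2l// ge_min lexx.
    by apply: ler_pM => //; exact: ltW.
  lra.
have P1 : s `^ q <= (1 + r `^ q) / 2.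
  by have := powR_midpoint ler01 r0; rewrite powR1.
have M2 : normc ((1 + u) / 2) ^+ 2 <= s ^+ 2 * (1 - c).
  have : eta / 2 <= normc (r%:C - u).
    have h : normc (1 - u) <= normc ((1 - r)%:C) + normc (r%:C - u).
      apply: le_trans (le_normcD _ _); rewrite le_eqVlt; apply/orP; left; apply/eqP.
      by congr normc; rewrite rmorphB/=; ring.
    by move: h; rewrite normcC ger0_norm; lra.
  have nsq (z : C) : normc z ^+ 2 = complex.Re z ^+ 2 + complex.Im z ^+ 2.
    by case: z => a b /=; rewrite sqr_sqrtr// addr_ge0 ?sqr_ge0.
  have ru : complex.Re u ^+ 2 + complex.Im u ^+ 2 = r ^+ 2 by rewrite -nsq.
  move=> h; have : (eta / 2) ^+ 2 <= normc (r%:C - u) ^+ 2.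
    by rewrite ler_sqr ?nnegrE ?normc_ge0//; lra.
  rewrite !nsq.
  have xr : complex.Re u <= r.
    by apply: le_trans (normc_ge_absRe u); exact: ler_norm.
  have -> : (1 + u) / 2 = (1 / 2 : R)%:C * (1 + u).
    by rewrite mulrC; congr (_ * _); rewrite rmorphM/= rmorph1 mul1r fmorphV rmorph_nat.
  move: ru xr; case: (u) => x y /= ru xr.
  rewrite !mul0r !subr0 ?addr0 ?add0r ?oppr0 ?sub0r ?sqrrN => h2.
  have cE : c * 16 = eta ^+ 2 by rewrite /c; lra.
  have s2 : s ^+ 2 <= 1 by rewrite exprn_ile1//; lra.
  have cs : c * s ^+ 2 <= c by rewrite ler_piMr// ltW.
  rewrite /s in cs *; nra.
have P2 : normc ((1 + u) / 2) `^ q <= s `^ q * (1 - c) `^ (q / 2).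
  have E (x : R) : 0 <= x -> x `^ q = (x ^+ 2) `^ (q / 2).
    by move=> x0; rewrite -powR_mulrn// -powRrM mulrCA divff ?mulr1.
  rewrite !E//; last exact: ltW.
  rewrite -powRM ?sqr_ge0//; last lra.
  by apply: ge0_ler_powR; rewrite ?nnegrE ?mulr_ge0 ?sqr_ge0 ?divr_ge0 ?(ltW q0)//; lra.
have P6 : d * Num.min (psi (eta / 4)) k <= s `^ q * k.
  apply: (@le_trans _ _ (d * k)); last by rewrite ler_wpM2r// ltW.
  by rewrite ler_pM2l// ge_min lexx orbT.
move: P6; rewrite /k mulrBr mulr1; lra.
Qed.

(** By homogeneity one of the points can be taken to be 1, the other one in the
    unit disk. If they are at distance less than [eta], then [eta ^ q <= eps]
    does it; otherwise [gap_disk] provides a convexity gap that a large [K]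
    makes dominate. *)
Lemma powR_uniformly_convex (eps : R) : 0 < eps -> exists2 K : R, 0 <= K &
  forall a b : C, normc (a - b) `^ q + K * normc ((a + b) / 2) `^ q <=
    (eps + K / 2) * (normc a `^ q + normc b `^ q).
Proof.
move=> e0.
pose eta := Num.min 1 (eps `^ q^-1).
have eta0 : 0 < eta by rewrite lt_min ltr01 powR_gt0.
have eta1 : eta <= 1 by rewrite ge_min lexx.
have etaq : eta `^ q <= eps.
  apply: (@le_trans _ _ ((eps `^ q^-1) `^ q)).
    by apply: ge0_ler_powR; rewrite ?nnegrE ?powR_ge0 ?(ltW q0) ?(ltW eta0)// ge_min lexx orbT.
  by rewrite -powRrM mulVf ?gt_eqF// powRr1// ltW.
have [delta d0 gap] := gap_disk eta0 eta1.
pose K := 2 `^ q / delta.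
have K0 : 0 <= K by rewrite divr_ge0 ?powR_ge0 ?ltW.
exists K => //.
have disk (u : C) : normc u <= 1 -> normc (1 - u) `^ q + K * normc ((1 + u) / 2) `^ q <=
    (eps + K / 2) * (1 + normc u `^ q).
  move=> u1.
  have uq : 0 <= normc u `^ q by exact: powR_ge0.
  have [small|large] := ltP (normc (1 - u)) eta.
    have h1 : normc (1 - u) `^ q <= eps.
      apply: le_trans etaq; apply: ge0_ler_powR; rewrite ?nnegrE ?normc_ge0 ?(ltW q0)//; exact: ltW.
    have h2 : normc ((1 + u) / 2) `^ q <= (1 + normc u `^ q) / 2.
      apply: (@le_trans _ _ (((1 + normc u) / 2) `^ q)); last first.
        by have := powR_midpoint ler01 (normc_ge0 u); rewrite powR1.
      apply: ge0_ler_powR; rewrite ?nnegrE ?normc_ge0 ?(ltW q0)//.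
        by rewrite divr_ge0// addr_ge0// normc_ge0.
      have -> : (1 + u) / 2 = (1 / 2 : R)%:C * (1 + u).
        by rewrite mulrC; congr (_ * _); rewrite rmorphM/= rmorph1 mul1r fmorphV rmorph_nat.
      rewrite normcM normcC ger0_norm//; have := le_normcD 1 u; rewrite normc1; lra.
    have := ler_wpM2l K0 h2; have : 0 <= eps * normc u `^ q by rewrite mulr_ge0// ltW.
    lra.
  have h1 : normc (1 - u) `^ q <= 2 `^ q.
    apply: ge0_ler_powR; rewrite ?nnegrE ?normc_ge0 ?(ltW q0)//.
    by have := le_normcD 1 (- u); rewrite normc1 normcN; lra.
  have h2 := gap u u1 large.
  have h3 : 2 `^ q <= K * ((1 + normc u `^ q) / 2 - normc ((1 + u) / 2) `^ q).
    apply: (@le_trans _ _ (K * delta)); last by rewrite ler_wpM2l.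
    by rewrite /K divfK// gt_eqF.
  have : 0 <= eps * (1 + normc u `^ q) by rewrite mulr_ge0 ?(ltW e0)// addr_ge0.
  lra.
have half (a b : C) : a != 0 -> normc b <= normc a ->
  normc (a - b) `^ q + K * normc ((a + b) / 2) `^ q <= (eps + K / 2) * (normc a `^ q + normc b `^ q).
  move=> a0 ba.
  have na : 0 < normc a.
    by rewrite lt_neqAle normc_ge0 andbT eq_sym; apply: contra a0 => /eqP/eq0_normc ->.
  have u1 : normc (b / a) <= 1 by rewrite normcM normcV ler_pdivrMr ?mul1r.
  have aq : 0 <= normc a `^ q by exact: powR_ge0.
  have sc (z : C) : normc a `^ q * normc z `^ q = normc (a * z) `^ q.
    by rewrite normcM powRM ?normc_ge0.
  have aba : a * (b / a) = b by rewrite mulrC divfK.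
  have e1 : normc a `^ q * normc (1 - b / a) `^ q = normc (a - b) `^ q.
    by rewrite sc mulrBr mulr1 aba.
  have e2 : normc a `^ q * normc ((1 + b / a) / 2) `^ q = normc ((a + b) / 2) `^ q.
    by rewrite sc mulrA mulrDr mulr1 aba.
  have e3 : normc a `^ q * normc (b / a) `^ q = normc b `^ q by rewrite sc aba.
  have := ler_wpM2l aq (disk _ u1); rewrite mulrDr e1 mulrCA e2 => h.
  by apply: (le_trans h); rewrite mulrCA mulrDr mulr1 e3.
move=> a b; have [ab|ba] := leP (normc b) (normc a).
  have [a0|a0] := eqVneq a 0; last exact: half.
  have b0 : b = 0.
    by apply: eq0_normc; apply/eqP; rewrite eq_le normc_ge0 andbT; move: ab; rewrite a0 normc0.
  by rewrite a0 b0 subrr addr0 mul0r !normc0 powR0 ?gt_eqF// addr0 !mulr0 addr0.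
rewrite normcB (addrC a) (addrC (normc a `^ q)); apply: half; last exact: ltW.
by apply: contraTneq ba => ->; rewrite normc0 -leNgt normc_ge0.
Qed.

(** The duality map: the gradient of the modulus to the power [q], over [q]. *)
Definition dual (z : C) : C := (normc z `^ (q - 2))%:C * z^*%C.

Lemma dual0 : dual 0 = 0.
Proof. by rewrite /dual conjc0 mulr0. Qed.

Lemma normc_dual z : normc (dual z) = normc z `^ (q - 1).
Proof.
rewrite /dual normcM normcC normc_conj ger0_norm ?powR_ge0//.
have [->|z0] := eqVneq z 0; first by rewrite normc0 mulr0 powR0// subr_eq0 gt_eqF.
have nz : normc z != 0 by apply: contra z0 => /eqP/eq0_normc ->.
have -> : q - 1 = (q - 2) + 1 by ring.
by rewrite [_ `^ (q - 2 + 1)]powRD ?nz ?implybT// powRr1 ?normc_ge0.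
Qed.

Lemma normc_dual_powR z : normc (dual z) `^ p = normc z `^ q.
Proof. by rewrite normc_dual -powRrM conjugate_mulE. Qed.

Lemma Re_dual_self z : complex.Re (dual z * z) = normc z `^ q.
Proof.
have -> : dual z * z = (normc z `^ (q - 2) * normc z ^+ 2)%:C.
  by rewrite /dual rmorphM/= normc_sqr; ring.
rewrite /=; have [->|z0] := eqVneq z 0.
  by rewrite normc0 expr0n/= mulr0 powR0// gt_eqF.
have nz : normc z != 0 by apply: contra z0 => /eqP/eq0_normc ->.
by rewrite -powR_mulrn ?normc_ge0// -powRD ?nz ?implybT// subrK.
Qed.

(** The modulus to the power [q] lies above its tangent planes, by Young's
    inequality. *)
Lemma powR_gradient a b :
  normc a `^ q + q * complex.Re (dual a * (b - a)) <= normc b `^ q.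
Proof.
rewrite mulrBr raddfB/= Re_dual_self mulrBr.
have h1 : complex.Re (dual a * b) <= normc (dual a) * normc b.
  by rewrite -normcM; apply: le_trans (normc_ge_absRe _); exact: ler_norm.
have h2 := conjugate_powR (normc_ge0 (dual a)) (normc_ge0 b) p0 q0 pq.
rewrite normc_dual_powR in h2.
have h3 : q * complex.Re (dual a * b) <= q * (normc a `^ q / p + normc b `^ q / q).
  by rewrite ler_pM2l//; exact: le_trans h2.
have E : q * (normc a `^ q / p + normc b `^ q / q) = (q / p) * normc a `^ q + normc b `^ q.
  by field; rewrite !gt_eqF.
rewrite E conjugate_divE in h3; lra.
Qed.

End convexity.

(** * Duality between two Lebesgue spaces *)

Section pairing.
Context d (T : measurableType d) (R : realType).
Variables (mu : {measure set T -> \bar R}).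
Local Notation C := R[i].

Section one_exponent.
Variables (q : R) (q1 : 1 <= q).
Implicit Types f g : Lpfun mu q1.

Let q0 : 0 < q. Proof. exact: lt_le_trans q1. Qed.

Lemma Lpfun_measurable f : cmeasurable f.
Proof. by have /cLfunP[] := LpfunP f. Qed.

Definition nrm f : R := fine (cLnorm mu q f).

Lemma nrmE f : (nrm f)%:E = cLnorm mu q f. Proof. exact: cLnorm_fin. Qed.

Lemma nrm_ge0 f : 0 <= nrm f.
Proof. by rewrite fine_ge0// cLnorm_ge0. Qed.

Definition energy f : R := \int[mu]_x (normc (f x) `^ q).

Lemma energyE f : energy f = nrm f `^ q.
Proof.
have h : (energy f)%:E = Ip mu q f.
  rewrite /energy /Rintegral fineK// ge0_fin_numE ?Ip_ge0//.
  by rewrite -/(Ip mu q f) -cLnorm_Ip// -nrmE poweR_EFin ltry.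
apply: EFin_inj; rewrite h -cLnorm_Ip// -nrmE poweR_EFin//.
Qed.

Lemma energy_integrable f : mu.-integrable setT (EFin \o (fun x => normc (f x) `^ q)).
Proof.
apply/integrableP; split; first exact/measurable_normc_powR/Lpfun_measurable.
have -> : (\int[mu]_x `|(EFin \o (fun x => (normc (f x) `^ q)%R)) x| = Ip mu q f)%E.
  by apply: eq_integral => x _; rewrite /= ger0_norm// powR_ge0.
by rewrite -cLnorm_Ip// -nrmE poweR_EFin ltry.
Qed.

Lemma mk_Lpfun (u : T -> C) : cmeasurable u -> (Ip mu q u < +oo)%E -> u \in cLfunp mu q1.
Proof.
move=> mu' ui; apply/cLfunP; split => //.
by rewrite cLnormE// poweR_lty.
Qed.

Lemma abs_Lpfun_subproof f : (fun x => (normc (f x))%:C : C) \in cLfunp mu q1.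
Proof.
apply: mk_Lpfun; first exact/cmeasurable_real/cmeasurable_normc/Lpfun_measurable.
rewrite (_ : Ip _ _ _ = Ip mu q f); last first.
  by apply: eq_integral => x _; rewrite normcC ger0_norm ?normc_ge0.
by rewrite -cLnorm_Ip// -nrmE poweR_EFin ltry.
Qed.

Definition abs_Lpfun f : Lpfun mu q1 := MkLpfun (abs_Lpfun_subproof f).

End one_exponent.

Section two_exponents.
Variables (p q : R) (p1 : 1 < p) (q1 : 1 < q).
Hypothesis pq : p^-1 + q^-1 = 1.
Implicit Types (f : Lpfun mu (ltW p1)) (g : Lpfun mu (ltW q1)).

Let p0 : 0 < p. Proof. exact: lt_trans p1. Qed.
Let q0 : 0 < q. Proof. exact: lt_trans q1. Qed.

Lemma hoelder_normc f g :
  (\int[mu]_x ((normc (f x) * normc (g x))%:E) <= (nrm f * nrm g)%:E)%E.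
Proof.
have mf := cmeasurable_normc (Lpfun_measurable f).
have mg := cmeasurable_normc (Lpfun_measurable g).
have := hoelder mu mf mg p0 q0 pq; rewrite Lnorm1 EFinM !nrmE.
apply: le_trans; rewrite le_eqVlt; apply/orP; left; apply/eqP.
by apply: eq_integral => x _ /=; rewrite ger0_norm// mulr_ge0// normc_ge0.
Qed.

Lemma prod_integrable f g :
  mu.-integrable setT (EFin \o (fun x => normc (f x) * normc (g x))).
Proof.
have mf := cmeasurable_normc (Lpfun_measurable f).
have mg := cmeasurable_normc (Lpfun_measurable g).
apply/integrableP; split; first by apply/measurable_EFinP; exact: measurable_funM.
apply: le_lt_trans (ltry (nrm f * nrm g)); apply: le_trans (hoelder_normc f g).
rewrite le_eqVlt; apply/orP; left; apply/eqP.
by apply: eq_integral => x _ /=; rewrite ger0_norm// mulr_ge0// normc_ge0.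
Qed.

Lemma measurable_Re_prod (u v : T -> C) : cmeasurable u -> cmeasurable v ->
  measurable_fun setT (fun x => complex.Re (u x * v x)).
Proof.
move=> [ur ui] [vr vi].
rewrite (_ : (fun x => _) = (fun x => complex.Re (u x) * complex.Re (v x) -
  complex.Im (u x) * complex.Im (v x))); last first.
  by apply/funext => x; case: (u x) => a b; case: (v x).
by apply: measurable_funB; exact: measurable_funM.
Qed.

Lemma pair_integrable f g :
  mu.-integrable setT (EFin \o (fun x => complex.Re (f x * g x))).
Proof.
apply: le_integrable (prod_integrable f g) => //.
  apply/measurable_EFinP; apply: measurable_Re_prod; exact: Lpfun_measurable.
move=> x _ /=; rewrite lee_fin -normcM (ger0_norm (normc_ge0 _)).
exact: normc_ge_absRe.
Qed.

(** The real part of the duality between [L^p] and [L^q]; working with real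
    parts only loses nothing, since [f] can be multiplied by [i]. *)
Definition pairing f g : R := \int[mu]_x complex.Re (f x * g x).

Lemma pairingDr f g g' : pairing f (g + g') = pairing f g + pairing f g'.
Proof.
rewrite /pairing -RintegralD//; [|exact: pair_integrable..].
by apply: eq_Rintegral => x _; rewrite /= fctE mulrDr raddfD.
Qed.

Lemma pairingDl f f' g : pairing (f + f') g = pairing f g + pairing f' g.
Proof.
rewrite /pairing -RintegralD//; [|exact: pair_integrable..].
by apply: eq_Rintegral => x _; rewrite /= fctE mulrDl raddfD.
Qed.

Lemma pairingZ (a : C) f g : pairing (a *: f) g = pairing f (a *: g).
Proof.
by apply: eq_Rintegral => x _; rewrite /= !fctE mulrCA mulrA.
Qed.

Lemma pairingZr (c : R) f g : pairing f (c%:C *: g) = c * pairing f g.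
Proof.
rewrite /pairing -RintegralZl//; last exact: pair_integrable.
apply: eq_Rintegral => x _; rewrite /= fctE mulrCA.
by case: (f x * g x) => a b /=; rewrite mul0r subr0.
Qed.

Lemma pairing_le f g : `|pairing f g| <= nrm f * nrm g.
Proof.
apply: (le_trans (le_normr_Rintegral _ _)) => //; first exact: pair_integrable.
apply: (@le_trans _ _ (\int[mu]_x (normc (f x) * normc (g x)))).
  apply: le_Rintegral => //.
  - exact: integrable_norm (pair_integrable f g).
  - exact: prod_integrable.
  - by move=> x _; rewrite -normcM; exact: normc_ge_absRe.
rewrite -lee_fin; apply: le_trans (hoelder_normc f g).
rewrite /Rintegral fineK//; apply: integrable_fin_num => //; exact: prod_integrable.
Qed.

Lemma dual_Lpfun_subproof g : (fun x => dual q (g x)) \in cLfunp mu (ltW p1).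
Proof.
have mg := Lpfun_measurable g; have mn := cmeasurable_normc mg.
apply: mk_Lpfun.
  have mp : measurable_fun setT (fun x => normc (g x) `^ (q - 2)).
    exact: (measurableT_comp (measurable_powR (q - 2)) mn).
  case: mg => mr mi; split.
    rewrite (_ : (fun x => _) = (fun x => normc (g x) `^ (q - 2) * complex.Re (g x))).
      exact: measurable_funM.
    by apply/funext => x; rewrite /dual; case: (g x) => a b /=; rewrite mul0r subr0.
  rewrite (_ : (fun x => _) = (fun x => normc (g x) `^ (q - 2) * - complex.Im (g x))).
    by apply: measurable_funM => //; exact: measurableT_comp.
  by apply/funext => x; rewrite /dual; case: (g x) => a b /=; rewrite mul0r addr0.
rewrite (_ : Ip _ _ _ = Ip mu q g).
  by rewrite -cLnorm_Ip ?(ltW q1)// -nrmE poweR_EFin ltry.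
by apply: eq_integral => x _; rewrite (normc_dual_powR p1 q1 pq).
Qed.

Definition dual_Lpfun g : Lpfun mu (ltW p1) := MkLpfun (dual_Lpfun_subproof g).

Lemma nrm_dual g : nrm (dual_Lpfun g) `^ p = nrm g `^ q.
Proof.
rewrite -!energyE; apply: eq_Rintegral => x _.
by rewrite (normc_dual_powR p1 q1 pq).
Qed.

Lemma pairing_dual g : pairing (dual_Lpfun g) g = nrm g `^ q.
Proof.
by rewrite -energyE; apply: eq_Rintegral => x _; rewrite /= (Re_dual_self q1).
Qed.

Lemma energy_gradient g g' :
  energy g + q * pairing (dual_Lpfun g) (g' - g) <= energy g'.
Proof.
rewrite /energy /pairing -RintegralZl//; last exact: pair_integrable.
have i1 := energy_integrable g.
have i2 : mu.-integrable setT (EFin \o (fun x => q * complex.Re (dual_Lpfun g x * (g' - g) x))).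
  exact: (integrableZl measurableT q (pair_integrable _ _)).
rewrite -RintegralD//; apply: le_Rintegral => //.
- exact: (integrableD measurableT i1 i2).
- exact: energy_integrable.
- by move=> x _ /=; exact: (powR_gradient p1 q1 pq).
Qed.

Lemma energy_uniformly_convex (eps : R) : 0 < eps -> exists2 K : R, 0 <= K &
  forall g g', energy (g - g') + K * energy (2^-1%:C *: (g + g')) <=
    (eps + K / 2) * (energy g + energy g').
Proof.
move=> e0; have [K K0 UC] := powR_uniformly_convex p1 q1 pq e0; exists K => // g g'.
have i1 := energy_integrable (g - g').
have i2 : mu.-integrable setT (EFin \o (fun x => K * normc ((2^-1%:C *: (g + g')) x) `^ q)).
  exact: (integrableZl measurableT K (energy_integrable _)).
have i3 := integrableD measurableT (energy_integrable g) (energy_integrable g').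
rewrite /energy -RintegralZl//; last exact: energy_integrable.
rewrite -RintegralD// -RintegralD//; [|exact: energy_integrable..].
rewrite -RintegralZl//; apply: le_Rintegral => //.
- exact: (integrableD measurableT i1 i2).
- exact: (integrableZl measurableT (eps + K / 2) i3).
- move=> x _; rewrite /= !fctE.
  have -> : 2^-1%:C *: (g x + g' x) = (g x + g' x) / 2.
    rewrite -[LHS]/(2^-1%:C * (g x + g' x)).
    by rewrite fmorphV rmorph_nat mulrC.
  exact: UC.
Qed.

End two_exponents.
End pairing.

Section classes.
Context d (T : measurableType d) (R : realType).
Variables (mu : {measure set T -> \bar R}) (p : R) (p1 : 1 <= p).
Implicit Types f g : Lpfun mu p1.

Lemma rn_Lp_class f : rn (Lp_class f) = nrm f.
Proof. by rewrite /rn -[`|_|]/(Lp_norm _) Lp_norm_class. Qed.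

Lemma Lp_classB f g : Lp_class (f - g) = Lp_class f - Lp_class g.
Proof. by rewrite -scaleN1r addrC Lp_class_linear scaleN1r addrC. Qed.

Lemma Lp_class_scale a f : Lp_class (a *: f) = a *: Lp_class f.
Proof. by rewrite -[LHS]Lp_classZ. Qed.

Lemma Lp_class_add f g : Lp_class (f + g) = Lp_class f + Lp_class g.
Proof. by rewrite -[LHS]Lp_classD. Qed.

End classes.

(** * Riesz representation *)

Section riesz.
Context d (T : measurableType d) (R : realType).
Variables (mu : {measure set T -> \bar R}).
Local Notation C := R[i].
Variables (p q : R) (p1 : 1 < p) (q1 : 1 < q).
Hypothesis pq : p^-1 + q^-1 = 1.
Local Notation Lq := (Lpfun mu (ltW q1)).

Let p0 : 0 < p. Proof. exact: lt_trans p1. Qed.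
Let q0 : 0 < q. Proof. exact: lt_trans q1. Qed.

(** Away from 0 this is the continuity of [dual]; at 0, where [q - 2] may be
    negative, it follows from the size [normc_dual]. *)
Lemma cvg_dual (a b : C) (s : R^nat) : s n @[n --> \oo] --> (0 : R) ->
  complex.Re (dual q (a + (s n)%:C * b) * b) @[n --> \oo] --> complex.Re (dual q a * b).
Proof.
move=> s0.
have RE (z : C) : complex.Re (dual q z * b) = normc z `^ (q - 2) *
    (complex.Re z * complex.Re b + complex.Im z * complex.Im b).
  by rewrite /dual; case: z => x y; case: b => u v /=; ring.
have hR : complex.Re (a + (s n)%:C * b) @[n --> \oo] --> complex.Re a.
  have E n : complex.Re (a + (s n)%:C * b) = complex.Re a + s n * complex.Re b.
    by clear; case: a b => [x y] [u v] /=; ring.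
  under eq_cvg do rewrite E.
  have : complex.Re a + s n * complex.Re b @[n --> \oo] --> complex.Re a + 0 * complex.Re b.
    by apply: cvgD; [exact: cvg_cst|apply: cvgMl].
  by rewrite mul0r addr0.
have hI : complex.Im (a + (s n)%:C * b) @[n --> \oo] --> complex.Im a.
  have E n : complex.Im (a + (s n)%:C * b) = complex.Im a + s n * complex.Im b.
    by clear; case: a b => [x y] [u v] /=; ring.
  under eq_cvg do rewrite E.
  have : complex.Im a + s n * complex.Im b @[n --> \oo] --> complex.Im a + 0 * complex.Im b.
    by apply: cvgD; [exact: cvg_cst|apply: cvgMl].
  by rewrite mul0r addr0.
have [a0|a0] := eqVneq a 0.
  rewrite {2}a0 dual0 mul0r /=.
  have q10 : 0 < q - 1 by rewrite subr_gt0.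
  have h : normc (a + (s n)%:C * b) `^ (q - 1) * normc b @[n --> \oo] --> (0 : R).
    rewrite -(mul0r (normc b)); apply: cvgMl.
    have -> : 0 = normc a `^ (q - 1) by rewrite a0 normc0 powR0// gt_eqF.
    exact: cvg_normc_powR.
  apply: (@squeeze_cvgr _ _ _ _ (fun n => - (normc (a + (s n)%:C * b) `^ (q - 1) * normc b))
    (fun n => normc (a + (s n)%:C * b) `^ (q - 1) * normc b)) => //.
    apply: nearW => n; rewrite -ler_norml -(normc_dual q1) -normcM.
    exact: normc_ge_absRe.
  by rewrite -oppr0; exact: cvgN.
under eq_cvg do rewrite RE.
rewrite RE; apply: cvgM.
  apply: (@cvg_comp _ _ _ (fun n => normc (a + (s n)%:C * b)) (fun x => x `^ (q - 2))).
    exact: (cvg_normc _ hR hI).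
  apply: powR_continuous_gt0; rewrite lt_neqAle normc_ge0 andbT eq_sym.
  by apply: contra a0 => /eqP/eq0_normc ->.
by apply: cvgD; apply: cvgMl.
Qed.

Variables (l : Lq -> R) (B : R).
Hypothesis B0 : 0 <= B.
Hypothesis lD : forall f g, l (f + g) = l f + l g.
Hypothesis lZ : forall (c : R) f, l (c%:C *: f) = c * l f.
Hypothesis lB : forall f, `|l f| <= B * nrm f.

Let lN f : l (- f) = - l f.
Proof. by rewrite -scaleN1r (_ : -1 = (-1)%:C) ?lZ ?mulN1r// rmorphN1. Qed.

Let lsub f g : l (f - g) = l f - l g.
Proof. by rewrite lD lN. Qed.

(** Minimizing this functional over [L^q] yields the representing function as
    the dual of the minimizer. *)
Definition riesz_energy (g : Lq) : R := energy g - q * l g.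
Local Notation J := riesz_energy.

Let C0 : R := (q - 1) * (2 * B) `^ p / 2.

(** Young's inequality absorbs the linear term into half of the energy. *)
Lemma riesz_energy_coercive g : energy g / 2 - C0 <= J g.
Proof.
have n0 := nrm_ge0 g.
have := conjugate_powR (mulr_ge0 (ler0n R 2) B0) n0 p0 q0 pq.
rewrite -energyE => h.
have : q * (2 * B * nrm g) <= q * ((2 * B) `^ p / p + energy g / q) by rewrite ler_pM2l.
have -> : q * ((2 * B) `^ p / p + energy g / q) = (q / p) * (2 * B) `^ p + energy g.
  by field; rewrite !gt_eqF.
rewrite (conjugate_divE q1 pq) => h2.
have h3 : q * l g <= q * (B * nrm g).
  by rewrite ler_pM2l//; apply: le_trans (lB g); exact: ler_norm.
rewrite /J /C0; move: (energy g) (nrm g) (l g) h2 h3 => E n lg h2 h3; lra.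
Qed.

Lemma energy_ge0 (g : Lq) : 0 <= energy g.
Proof. by rewrite energyE powR_ge0. Qed.

Let I0 : R := inf (range J).

Let J_ge g : I0 <= J g.
Proof.
apply: ge_inf; last by exists g.
exists (- C0) => _ [f _ <-].
have := riesz_energy_coercive f; have := energy_ge0 f.
by move: (energy f) (J f) => E j; lra.
Qed.

Let J_near e : 0 < e -> exists g, J g < I0 + e.
Proof.
move=> e0; have [|_ [g _ <-] ge] := @inf_adherent R (range J) e e0; last by exists g.
split; first by exists (J 0), 0.
exists (- C0) => _ [f _ <-].
have := riesz_energy_coercive f; have := energy_ge0 f.
by move: (energy f) (J f) => E j; lra.
Qed.

Let near_minimizers (eps K W e tau dd Ea Eb Em la lb : R) :
  0 < tau -> 0 <= W -> 0 <= K -> eps = tau / (4 * (W + 1)) -> e <= tau / (2 * (K + 1)) ->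
  dd + K * Em <= (eps + K / 2) * (Ea + Eb) -> Ea <= W -> Eb <= W ->
  Ea - q * la < I0 + e -> Eb - q * lb < I0 + e ->
  I0 <= Em - q * (2^-1 * (la + lb)) -> dd <= tau.
Proof.
move=> t0 W0 K0 epsE eC h EaW EbW ga gb gm.
have eps0 : 0 < eps by rewrite epsE divr_gt0// mulr_gt0//; lra.
have K1 : 0 < K + 1 by lra.
have k1 : K * ((Ea + Eb) / 2 - Em) <= K * e by rewrite ler_wpM2l//; lra.
have k2 : K * e <= tau / 2.
  apply: (@le_trans _ _ ((K + 1) * (tau / (2 * (K + 1))))).
    have : K * e <= K * (tau / (2 * (K + 1))) by rewrite ler_wpM2l.
    have : 0 <= tau / (2 * (K + 1)) by rewrite divr_ge0 ?mulr_ge0// ltW.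
    lra.
  by rewrite le_eqVlt; apply/orP; left; apply/eqP; field; rewrite gt_eqF.
have k3 : eps * (Ea + Eb) <= tau / 2.
  apply: (@le_trans _ _ (eps * (2 * (W + 1)))).
    by rewrite ler_pM2l//; lra.
  rewrite le_eqVlt epsE; apply/orP; left; apply/eqP; field; rewrite gt_eqF//; lra.
lra.
Qed.

(** By uniform convexity, near-minimizers are close to each other. *)
Let J_cauchy n : exists e : R, [/\ 0 < e, e <= 1 / 2 ^+ n &
  forall g g', J g < I0 + e -> J g' < I0 + e -> nrm (g - g') <= 1 / 2 ^+ n].
Proof.
pose tau : R := (1 / 2 ^+ n) `^ q.
have pn0 : 0 < 1 / 2 ^+ n :> R by rewrite divr_gt0// exprn_gt0.
have t0 : 0 < tau by rewrite powR_gt0.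
pose W : R := 2 * (I0 + 1 + C0).
have Wb g : J g < I0 + 1 -> energy g <= W.
  have := riesz_energy_coercive g; rewrite /W.
  by move: (energy g) (J g) => E j; lra.
have W0 : 0 <= W.
  by have [g /Wb] := J_near ltr01; apply: le_trans; exact: energy_ge0.
pose eps := tau / (4 * (W + 1)).
have eps0 : 0 < eps by rewrite divr_gt0// mulr_gt0//; lra.
have [K K0 UC] := energy_uniformly_convex mu p1 q1 pq eps0.
pose e := Num.min 1 (Num.min (1 / 2 ^+ n) (tau / (2 * (K + 1)))).
have eA : e <= 1 by rewrite /e ge_min lexx.
have eB : e <= 1 / 2 ^+ n by rewrite /e ge_min ge_min lexx orbT.
have eC : e <= tau / (2 * (K + 1)) by rewrite /e !ge_min lexx !orbT.
have K1 : 0 < K + 1 by lra.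
exists e; split => //.
  by rewrite /e !lt_min ltr01 pn0/= divr_gt0// mulr_gt0.
move=> g g' gI gI'.
have Eg : energy g <= W by apply: Wb; apply: lt_le_trans gI _; rewrite lerD2l.
have Eg' : energy g' <= W by apply: Wb; apply: lt_le_trans gI' _; rewrite lerD2l.
have := UC g g'; set m := _ *: _ => h.
have lm : l m = 2^-1 * (l g + l g') by rewrite /m lZ lD.
have Jm := J_ge m.
have : energy (g - g') <= tau.
  move: h Eg Eg' gI gI' Jm; rewrite /J lm.
  move: (energy (g - g')) (energy g) (energy g') (energy m) (l g) (l g').
  by move=> dd Ea Eb Em la lb h1 h2 h3 h4 h5; exact: (@near_minimizers eps K W e tau dd Ea Eb Em la lb).
rewrite energyE /tau => h4.
have pp (x : R) : 0 <= x -> (x `^ q) `^ q^-1 = x.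
  by move=> x0; rewrite -powRrM mulfV ?gt_eqF// powRr1.
rewrite -(pp _ (nrm_ge0 _)) -(pp _ (ltW pn0)).
by apply: ge0_ler_powR; rewrite ?nnegrE ?powR_ge0 ?invr_ge0 ?(ltW q0).
Qed.

Let approx_minimizer (D P E0 En l0 ln dn th : R) n :
  E0 + q * P <= En -> - (D * dn) <= P -> ln - l0 <= B * dn ->
  En - q * ln < I0 + th -> D * dn <= D * (2 / 2 ^+ n) -> B * dn <= B * (2 / 2 ^+ n) ->
  th <= 1 / 2 ^+ n -> E0 - q * l0 <= I0 + (1 + q * (D + B) * 2) / 2 ^+ n.
Proof.
move=> h1 h2 h3 h4 h5 h6 h7.
have h8 : q * (- (D * (2 / 2 ^+ n))) <= q * P by rewrite ler_pM2l//; lra.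
have h9 : q * (ln - l0) <= q * (B * (2 / 2 ^+ n)) by rewrite ler_pM2l//; lra.
have -> : I0 + (1 + q * (D + B) * 2) / 2 ^+ n =
  I0 + 1 / 2 ^+ n + q * (D * (2 / 2 ^+ n)) + q * (B * (2 / 2 ^+ n)) by ring.
lra.
Qed.

(** Near-minimizers form a rapidly Cauchy sequence by uniform convexity. At its
    limit, [energy] is bounded by its lower semicontinuity, that is, by the
    gradient inequality. *)
Lemma riesz_minimizer : exists g0, forall g, J g0 <= J g.
Proof.
have [eta etaP] := choice J_cauchy.
pose theta := fix th n := if n is n'.+1 then Num.min (th n') (eta n) else eta 0%N.
have theta0 n : 0 < theta n.
  elim: n => [|n IH] /=; first by have [] := etaP 0%N.
  by rewrite lt_min IH; have [] := etaP n.+1.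
have theta_eta n : theta n <= eta n by case: n => //= n; rewrite ge_min lexx orbT.
have thetaS n : theta n.+1 <= theta n by rewrite /= ge_min lexx.
have [u uP] := choice (fun n => J_near (theta0 n)).
have u_step n : nrm (u n.+1 - u n) <= 1 / 2 ^+ n.
  have [_ _] := etaP n; apply.
    by apply: lt_le_trans (uP n.+1) _; rewrite lerD2l (le_trans (thetaS n)).
  by apply: lt_le_trans (uP n) _; rewrite lerD2l.
have [x ux] : exists x : Lp mu (ltW q1), forall n, rn (Lp_class (u n) - x) <= 2 * 1 / 2 ^+ n.
  apply: (@Lp_rapidly_complete _ _ _ mu _ (ltW q1)) => n.
  by rewrite -Lp_classB rn_Lp_class.
pose g0 : Lq := repr x.
have ug n : nrm (u n - g0) <= 2 / 2 ^+ n.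
  by have := ux n; rewrite -[x]Lp_reprK -Lp_classB rn_Lp_class mulr1.
exists g0 => g; apply: le_trans (J_ge g).
pose D := nrm (dual_Lpfun p1 pq g0).
apply: (@le_pow2_lim _ _ _ (1 + q * (D + B) * 2) 0) => n _.
have h1 := energy_gradient p1 pq g0 (u n).
have h2 := pairing_le pq (dual_Lpfun p1 pq g0) (u n - g0).
have h3 := lB (u n - g0).
have h4 : theta n <= 1 / 2 ^+ n.
  by apply: (le_trans (theta_eta n)); have [] := etaP n.
have h5 := uP n.
have h6 : D * nrm (u n - g0) <= D * (2 / 2 ^+ n) by rewrite ler_wpM2l ?nrm_ge0.
have h7 : B * nrm (u n - g0) <= B * (2 / 2 ^+ n) by rewrite ler_wpM2l.
move: h2 h3; rewrite !ler_norml lsub => /andP[h2 _] /andP[_ h3].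
move: h1 h2 h3 h5 h6 h7; rewrite /J -/D.
move: (pairing _ _) (energy g0) (energy (u n)) (l g0) (l (u n)) (nrm _).
by move=> P E0 En l0 ln dn *; apply: (@approx_minimizer D P E0 En l0 ln dn (theta n) n).
Qed.

(** The dual of the minimizer [g0] represents [l]: the gradient inequality for
    [energy] at [g0 + s g] gives [l g <= pairing (dual (g0 + s g)) g] for small
    [s > 0], and dominated convergence lets [s] go to 0. *)
Lemma riesz_representation : exists f : Lpfun mu (ltW p1), forall g, l g = pairing f g.
Proof.
have [g0 g0min] := riesz_minimizer.
pose s n : R := n.+1%:R^-1.
have s0 n : 0 < s n by rewrite invr_gt0 ltr0n.
have s1 n : s n <= 1 by rewrite invf_le1 ?ler1n ?ltr0n.
have key g n : l g <= pairing (dual_Lpfun p1 pq (g0 + (s n)%:C *: g)) g.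
  set gs := g0 + _.
  have h1 := energy_gradient p1 pq gs g0.
  have E1 : g0 - gs = (- s n)%:C *: g.
    by rewrite /gs opprD addrA subrr add0r -scaleNr rmorphN.
  have E2 : l gs = l g0 + s n * l g by rewrite /gs lD lZ.
  have h2 : energy g0 - q * l g0 <= energy gs - q * (l g0 + s n * l g).
    by rewrite -E2; exact: g0min.
  rewrite E1 (pairingZr pq) in h1.
  have qs0 : 0 < q * s n by rewrite mulr_gt0.
  rewrite -(ler_pM2l qs0); move: h1 h2.
  by move: (energy gs) (energy g0) (l g0) (l g) (pairing _ _) => *; lra.
have lim_le g : l g <= pairing (dual_Lpfun p1 pq g0) g.
  pose F n x := complex.Re (dual q (g0 x + (s n)%:C * g x) * g x).
  pose G x := complex.Re (dual q (g0 x) * g x).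
  pose W : Lq := abs_Lpfun g0 + abs_Lpfun g.
  have FE n : pairing (dual_Lpfun p1 pq (g0 + (s n)%:C *: g)) g = \int[mu]_x F n x by [].
  have GE : pairing (dual_Lpfun p1 pq g0) g = \int[mu]_x G x by [].
  have iF n : mu.-integrable setT (EFin \o F n).
    exact: (pair_integrable pq (dual_Lpfun p1 pq (g0 + (s n)%:C *: g)) g).
  have iG : mu.-integrable setT (EFin \o G) by exact: (pair_integrable pq (dual_Lpfun p1 pq g0) g).
  have WE x : normc (W x) = normc (g0 x) + normc (g x).
    have -> : W x = (normc (g0 x) + normc (g x))%:C by rewrite rmorphD.
    by rewrite normcC ger0_norm// addr_ge0 ?normc_ge0.
  have FG x : F n x @[n --> \oo] --> G x.
    by apply: cvg_dual; exact: cvg_harmonic.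
  have cv : (\int[mu]_x (F n x)%:E)%E @[n --> \oo] --> (\int[mu]_x (G x)%:E)%E.
    apply: (@dominated_cvg _ _ _ mu setT measurableT (fun n => EFin \o F n) (EFin \o G)
      (EFin \o (fun x => normc (W x) `^ q))) => //.
    - by move=> n; have /integrableP[] := iF n.
    - by move=> x _; apply/cvg_EFin; [exact: nearW|exact: FG].
    - exact: energy_integrable.
    - move=> n x _; change (`|F n x|%:E <= (normc (W x) `^ q)%:E)%E.
      rewrite lee_fin; apply: (le_trans (normc_ge_absRe _)).
      rewrite normcM (normc_dual q1) -(mulr_powRB1 (normc_ge0 _) q0) mulrC.
      have gW : normc (g x) <= normc (W x) by rewrite WE lerDr normc_ge0.
      apply: ler_pM => //; rewrite ?normc_ge0 ?powR_ge0//.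
      apply: ge0_ler_powR; rewrite ?nnegrE ?normc_ge0 ?subr_ge0 ?(ltW q1)//.
      rewrite WE; apply: (le_trans (le_normcD _ _)); rewrite lerD2l normcM normcC.
      by rewrite ger0_norm ?(ltW (s0 n))// ler_piMl ?normc_ge0.
  have cv2 : \int[mu]_x F n x @[n --> \oo] --> \int[mu]_x G x.
    by apply: fine_cvg; rewrite fineK//; exact: integrable_fin_num.
  rewrite GE -(cvg_lim _ cv2)//; apply: limr_ge; first exact: cvgP cv2.
  by apply: nearW => n; rewrite -FE; exact: key.
exists (dual_Lpfun p1 pq g0) => g; apply/eqP; rewrite eq_le lim_le/=.
have := lim_le (- g); rewrite lN.
by rewrite -(scaleN1r g) (_ : -1 = (-1)%:C) ?(pairingZr pq) ?mulN1r ?lerN2// rmorphN1.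
Qed.

End riesz.

(** * Strong continuity of translations *)

Section indicators.
Context d (T : measurableType d) (R : realType).
Variables (mu : {measure set T -> \bar R}) (p : R).
Hypothesis p1 : 1 <= p.
Local Notation C := R[i].

Definition cindic (A : set T) : T -> C := fun x => (\1_A x)%:C.

Lemma cmeasurable_cindic A : measurable A -> cmeasurable (cindic A).
Proof. by move=> mA; apply: cmeasurable_real; exact: measurable_indic. Qed.

Lemma Ip_cindicB A B : measurable A -> measurable B ->
  (Ip mu p (cindic A - cindic B)%R <= mu (A `\` B) + mu (B `\` A))%E.
Proof.
move=> mA mB; have p0 : 0 < p by exact: lt_le_trans p1.
have mAB : measurable (A `\` B) by exact: measurableD.
have mBA : measurable (B `\` A) by exact: measurableD.
rewrite -(setIT (A `\` B)) -(setIT (B `\` A)) -!integral_indic//.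
rewrite -ge0_integralD//.
- apply: ge0_le_integral => //.
  + by move=> x _; rewrite lee_fin powR_ge0.
  + by apply: measurable_normc_powR; apply: cmeasurableB; exact: cmeasurable_cindic.
  + apply: emeasurable_funD; apply/measurable_EFinP; exact: measurable_indic.
  + move=> x _; rewrite -EFinD lee_fin !fctE /cindic !indicE -rmorphB normcC.
    rewrite !in_setD; case: (x \in A); case: (x \in B) => /=.
    * by rewrite subrr normr0 powR0 ?gt_eqF// addr0.
    * by rewrite subr0 normr1 powR1 addr0.
    * by rewrite sub0r normrN normr1 powR1 add0r.
    * by rewrite subrr normr0 powR0 ?gt_eqF// addr0.
- by apply/measurable_EFinP; exact: measurable_indic.
- by apply/measurable_EFinP; exact: measurable_indic.
Qed.

End indicators.

Section translation_continuity.
Context (R : realType) (G : topologicalGroupType) (hG : hausdorff_space G).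
Context (mu : leftHaarMeasure G R) (p : R) (p1 : 1 <= p).
Local Notation C := R[i].
Implicit Types (u v : borel G -> C) (A K : set (borel G)).

Let p0 : 0 < p. Proof. exact: lt_le_trans p1. Qed.

(** Stated for functions instead of classes because indicator functions and
    simple functions enter the approximation. *)
Definition shiftable u : Prop := cmeasurable u /\ forall e : R, 0 < e ->
  \forall t \near (1%g : G), (cLnorm mu p (translate t u - u)%R <= e%:E)%E.

Lemma open_measurable_borel A : open A -> measurable A.
Proof. exact: sub_sigma_algebra. Qed.

Lemma compact_measurable_borel K : compact K -> measurable K.
Proof.
move=> cK; have clK : closed K by exact: (@compact_closed (borel G)).
rewrite -[K]setCK; apply: measurableC; apply: open_measurable_borel.
exact: closed_openC.
Qed.

Lemma shiftableD u v : shiftable u -> shiftable v -> shiftable (u + v).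
Proof.
move=> [mu_ su] [mv sv]; split; first exact: cmeasurableD.
move=> e e0; have e2 : 0 < e / 2 by rewrite divr_gt0.
apply: filterS2 (su _ e2) (sv _ e2) => t h1 h2.
have -> : translate t (u + v) - (u + v) = (translate t u - u) + (translate t v - v).
  by apply/funext => x; rewrite /translate !fctE; ring.
apply: (le_trans (cLnormD mu p1 _ _)).
- by apply: cmeasurableB => //; exact: cmeasurable_translate.
- by apply: cmeasurableB => //; exact: cmeasurable_translate.
by apply: (le_trans (leeD h1 h2)); rewrite -EFinD lee_fin -splitr.
Qed.

Lemma shiftableZ a u : shiftable u -> shiftable (a *: u).
Proof.
move=> [mu_ su]; split; first exact: cmeasurableZ.
move=> e e0; have a1 : 0 < normc a + 1 by rewrite ltr_pwDr// normc_ge0.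
have e2 : 0 < e / (normc a + 1) by rewrite divr_gt0.
apply: filterS (su _ e2) => t h1.
have -> : translate t (a *: u) - a *: u = a *: (translate t u - u).
  by apply/funext => x; rewrite /translate !fctE scalerBr.
rewrite cLnormZ//; last by apply: cmeasurableB => //; exact: cmeasurable_translate.
apply: (le_trans (lee_wpmul2l _ h1)); first by rewrite lee_fin normc_ge0.
rewrite -EFinM lee_fin mulrA ler_pdivrMr// mulrC ler_pM2l// lerDl//.
Qed.

Lemma shiftable_lim u : cmeasurable u ->
  (forall e : R, 0 < e -> exists2 v, shiftable v & (cLnorm mu p (u - v)%R <= e%:E)%E) ->
  shiftable u.
Proof.
move=> mu_ uv; split=> // e e0.
have e3 : 0 < e / 3 by rewrite divr_gt0.
have [v [mv sv] uvn] := uv _ e3.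
apply: filterS (sv _ e3) => t h.
have -> : translate t u - u = translate t (u - v) + ((translate t v - v) + (v - u)).
  by apply/funext => x; rewrite /translate !fctE; ring.
have muv : cmeasurable (u - v) by exact: cmeasurableB.
have mtv : cmeasurable (translate t v - v).
  by apply: cmeasurableB => //; exact: cmeasurable_translate.
have mvu : cmeasurable (v - u) by exact: cmeasurableB.
apply: (le_trans (cLnormD mu p1 _ _)).
- exact: cmeasurable_translate.
- exact: cmeasurableD.
apply: (@le_trans _ _ ((e / 3)%:E + ((e / 3)%:E + (e / 3)%:E))%E); last first.
  by rewrite -!EFinD lee_fin le_eqVlt; apply/orP; left; apply/eqP; field.
apply: leeD; first by rewrite cLnorm_translate.
apply: (le_trans (cLnormD mu p1 _ _)) => //.
apply: leeD => //.
by rewrite -opprB -scaleN1r cLnormZ// normcN normc1 mul1e.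
Qed.

Lemma translate_cindic t A :
  translate t (cindic R A) =
    cindic R ((fun s : borel G => (t^-1 * s)%g : borel G) @^-1` A).
Proof. by []. Qed.

Let measurable_shift (t : G) A : measurable A ->
  measurable ((fun s : borel G => (t * s)%g : borel G) @^-1` A).
Proof. by move=> mA; rewrite -[_ @^-1` _]setTI; exact: measurable_mulg. Qed.

(** By continuity of the product at [(1, x)] for each [x] in [K], and
    compactness. *)
Lemma compact_shift_open K V : compact K -> open V -> K `<=` V ->
  \forall t \near (1%g : G), (fun s : borel G => (t^-1 * s)%g : borel G) @^-1` K `<=` V.
Proof.
move=> cK oV KV.
have /compact_near_coveringP h := cK.
have hh x : K x -> \forall x' \near x & t \near (1%g : G), V (t * x')%g.
  move=> Kx; have := @mulg_continuous (borel G) (1%g, x) V.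
  rewrite /= mul1g => /(_ (open_nbhs_nbhs _)) []; first by split => //; exact: KV.
  move=> [A B] /= [A1 Bx] AB; exists (B, A) => //= -[y t] /= [By At].
  exact: (AB (t, y)).
apply: filterS (h G (nbhs (1%g : G)) (fun t x => V (t * x)%g) _ hh) => t Wt s /= Ks.
by have := Wt _ Ks; rewrite mulVKg.
Qed.

(** By outer regularity [K] has a neighbourhood [V] with little mass outside
    [K]; for [t] close to 1 both [K] moved by [t] and [K] moved by [t^-1] remain
    in [V], and the two halves of the symmetric difference have the measures of
    their parts outside [K]. *)
Lemma shiftable_compact K : compact K -> shiftable (cindic R K).
Proof.
move=> cK; have mK := compact_measurable_borel cK.
split; first exact: cmeasurable_cindic.
move=> e e0.
have e2 : 0 < e `^ p / 2 by rewrite divr_gt0// powR_gt0.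
have Kfin : mu K \is a fin_num.
  by rewrite ge0_fin_numE//; exact: haar_compact_fin.
have [V [oV KV] muV] : exists2 V, open V /\ K `<=` V & (mu (V `\` K) <= (e `^ p / 2)%:E)%E.
  have E := @haar_outer_regular _ _ mu _ mK.
  have [|_ [V [oV KV] <-] VE] := @lb_ereal_inf_adherent R
    [set mu U | U in [set U | open U /\ K `<=` U]] (e `^ p / 2) e2; first by rewrite -E.
  exists V => //; move: VE; rewrite -E => VE.
  rewrite measureD//; [|exact: open_measurable_borel|].
    by rewrite setIidr// leeBlDl// ltW.
  by apply: (lt_trans VE); rewrite -(fineK Kfin) -EFinD ltry.
have key t : (fun s : borel G => (t^-1 * s)%g : borel G) @^-1` K `<=` V ->
    (mu ((fun s : borel G => (t^-1 * s)%g : borel G) @^-1` K `\` K) <= (e `^ p / 2)%:E)%E.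
  move=> tV; apply: le_trans muV; apply: le_measure.
  - by rewrite inE; apply: measurableD => //; exact: measurable_shift.
  - by rewrite inE; apply: measurableD => //; exact: open_measurable_borel.
  - exact: setSD.
have near1 := compact_shift_open cK oV KV.
have near2 : \forall t \near (1%g : G), (fun s : borel G => (t^-1^-1 * s)%g : borel G) @^-1` K `<=` V.
  have inv1 : (t^-1)%g @[t --> (1%g : G)] --> (1%g : G).
    by rewrite -[X in _ --> X]invg1; exact: invg_continuous.
  exact: inv1 near1.
apply: filterS2 near1 near2 => t h1 h2.
rewrite translate_cindic Ip_le ?(ltW e0)//.
apply: (le_trans (Ip_cindicB mu p1 _ mK)); first exact: measurable_shift.
rewrite [X in (_ <= X%:E)%E]splitr EFinD; apply: leeD; first exact: key.
have mD : measurable (K `\` (fun s : borel G => (t^-1 * s)%g : borel G) @^-1` K).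
  by apply: measurableD => //; exact: measurable_shift.
have := haar_preimage mu t mD; rewrite /= => Eq.
apply: (@le_trans _ _ (mu ((fun s : borel G => (t * s)%g : borel G) @^-1`
  (K `\` (fun s : borel G => (t^-1 * s)%g : borel G) @^-1` K)))).
  by rewrite le_eqVlt; apply/orP; left; apply/eqP/esym.
apply: le_trans (key _ h2); rewrite le_eqVlt; apply/orP; left; apply/eqP; congr (mu _).
by apply/seteqP; split => s /=; rewrite invgK mulKg.
Qed.

(** Outer regularity, then inner regularity of the open set so obtained: finite
    measure suffices to approximate by compact sets in the mean. *)
Lemma shiftable_measurable A : measurable A -> (mu A < +oo)%E -> shiftable (cindic R A).
Proof.
move=> mA Afin; apply: shiftable_lim; first exact: cmeasurable_cindic.
move=> e e0.
have e2 : 0 < e `^ p / 2 by rewrite divr_gt0// powR_gt0.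
have {}Afin : mu A \is a fin_num by rewrite ge0_fin_numE.
have E := @haar_outer_regular _ _ mu _ mA.
have [|_ [V [oV AV] <-] VE] := @lb_ereal_inf_adherent R
  [set mu U | U in [set U | open U /\ A `<=` U]] (e `^ p / 2) e2; first by rewrite -E.
move: VE; rewrite -E => VE.
have mV := open_measurable_borel oV.
have Vfin : mu V \is a fin_num.
  rewrite ge0_fin_numE//; apply: (lt_trans VE); by rewrite -(fineK Afin) -EFinD ltry.
have F := @haar_inner_regular _ _ mu _ oV.
have [|_ [K [cK KV] <-] KE] := @ub_ereal_sup_adherent R
  [set mu K | K in [set K | compact K /\ K `<=` V]] (e `^ p / 2) e2; first by rewrite -F.
move: KE; rewrite -F => KE.
have mK := compact_measurable_borel cK.
exists (cindic R K); first exact: shiftable_compact.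
rewrite Ip_le ?(ltW e0)//; apply: (le_trans (Ip_cindicB mu p1 mA mK)).
rewrite [X in (_ <= X%:E)%E]splitr EFinD; apply: leeD.
  apply: (@le_trans _ _ (mu (V `\` K))).
    by apply: le_measure; rewrite ?inE; [exact: measurableD..|exact: setSD].
  rewrite measureD//; last by rewrite -ge0_fin_numE.
  rewrite setIidr// leeBlDr; last by rewrite ge0_fin_numE//; exact: haar_compact_fin.
  by rewrite -leeBlDl ?ltW.
apply: (@le_trans _ _ (mu (V `\` A))).
  by apply: le_measure; rewrite ?inE; [exact: measurableD..|exact: setSD].
rewrite measureD//; last by rewrite -ge0_fin_numE.
by rewrite setIidr// leeBlDl// ltW.
Qed.


Lemma shiftable0 : shiftable 0.
Proof.
split=> [|e e0]; first by split; exact: measurable_cst.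
apply: nearW => t; rewrite (_ : translate t 0 - 0 = 0) ?(cLnorm0 mu p1) ?lee_fin ?ltW//.
by rewrite subr0.
Qed.

Lemma shiftable_sum I (r : seq I) (F : I -> borel G -> C) :
  (forall i, shiftable (F i)) -> shiftable (\sum_(i <- r) F i).
Proof. by move=> sF; elim/big_ind : _ => //; [exact: shiftable0|exact: shiftableD]. Qed.

Import HBNNSimple.

Lemma shiftable_nnsfun (f : {nnsfun borel G >-> R}) :
  (Ip mu p (fun x => (f x)%:C) < +oo)%E -> shiftable (fun x => (f x)%:C : C).
Proof.
move=> fI.
have -> : (fun x => (f x)%:C : C) =
    \sum_(y <- finmap.enum_fset (fset_set (range f))) y%:C *: cindic R (f @^-1` [set y]).
  apply/funext => x; rewrite fct_sumE fimfunE fsbig_finite//= rmorph_sum.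
  by apply: eq_bigr => y _; rewrite rmorphM.
apply: shiftable_sum => y.
have mi : measurable (f @^-1` [set y]) by exact: measurable_sfunP.
have [->|y0] := eqVneq y 0; first by rewrite scale0r; exact: shiftable0.
apply: shiftableZ; apply: shiftable_measurable => //.
have c0 : 0 < `|y| `^ p by rewrite powR_gt0// normr_gt0.
suff : ((`|y| `^ p)%:E * mu (f @^-1` [set y]) < +oo)%E.
  rewrite ltey => h; rewrite ltey; apply: contraNneq h => ->.
  by rewrite gt0_muley// lte_fin.
apply: le_lt_trans fI; rewrite -[X in mu X]setIT -integral_indic// -ge0_integralZl//.
- apply: ge0_le_integral => //.
  + by apply/measurable_EFinP; apply: measurable_funM => //; exact: measurable_indic.
  + by apply: measurable_normc_powR; apply: cmeasurable_real.
  + move=> x _; rewrite -EFinM lee_fin indicE normcC.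
    have [/set_mem/= <-|_] := boolP (x \in _); first by rewrite mulr1.
    by rewrite mulr0 powR_ge0.
- by apply/measurable_EFinP; exact: measurable_indic.
Qed.

Lemma shiftable_ge0 (u : borel G -> R) : measurable_fun setT u -> (forall x, 0 <= u x) ->
  (Ip mu p (fun x => (u x)%:C) < +oo)%E -> shiftable (fun x => (u x)%:C : C).
Proof.
move=> mU u0 uI; have muC := cmeasurable_real mU.
have mE : measurable_fun setT (EFin \o u) by exact/measurable_EFinP.
pose f := nnsfun_approx measurableT mE.
have fu x : f n x @[n --> \oo] --> u x.
  have h : (EFin \o (fun n => f n x)) n @[n --> \oo] --> (u x)%:E.
    by apply: (@cvg_nnsfun_approx _ _ _ _ measurableT _ mE) => // y _; rewrite /= lee_fin.
  exact: (fine_cvg h).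
have f_le n x : f n x <= u x.
  rewrite -(cvg_lim _ (fu x))//; apply: nondecreasing_cvgn_le; last exact: cvgP (fu x).
  by move=> a b ab; exact/lefP/nd_nnsfun_approx.
have mf n : cmeasurable (fun x => (f n x)%:C : C) by exact: cmeasurable_real.
have sf n : shiftable (fun x => (f n x)%:C : C).
  apply: shiftable_nnsfun; apply: le_lt_trans uI; apply: le_Ip => // x.
  by rewrite !normcC !ger0_norm.
have iu : mu.-integrable setT (fun x => (normc (u x)%:C `^ p)%:E).
  apply/integrableP; split; first exact: measurable_normc_powR.
  rewrite (eq_integral (fun x => (normc (u x)%:C `^ p)%:E))// => x _.
  by rewrite gee0_abs// lee_fin powR_ge0.
have cv : Ip mu p (fun x => (u x - f n x)%:C) @[n --> \oo] --> (\int[mu]_x (cst 0 x))%E.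
  apply: (@dominated_cvg _ _ _ mu setT measurableT
    (fun n x => (normc (u x - f n x)%:C `^ p)%:E) (cst 0%E) (fun x => (normc (u x)%:C `^ p)%:E)).
  - move=> n; apply: measurable_normc_powR; apply: cmeasurable_real.
    exact: measurable_funB.
  - move=> x _; apply/cvg_EFin; first exact: nearW.
    have -> : fine \o (fun n => (normc (u x - f n x)%:C `^ p)%:E) = (fun n => `|u x - f n x| `^ p).
      by apply/funext => n; rewrite -normcC.
    have -> : (0 : R) = `|u x - u x| `^ p by rewrite subrr normr0 powR0// gt_eqF.
    apply: (@cvg_comp _ _ _ (fun n => u x - f n x) (fun y : R => `|y| `^ p)).
      by apply: cvgB => //; exact: cvg_cst.
    exact: powR_norm_continuous.
  - by [].
  - exact: iu.
  - move=> n x _; rewrite gee0_abs ?lee_fin ?powR_ge0//.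
    apply: ge0_ler_powR; rewrite ?nnegrE ?normc_ge0 ?(ltW p0)//.
    by rewrite !normcC !ger0_norm ?subr_ge0// gerBl.
rewrite integral0 in cv.
apply: shiftable_lim => // e e0.
have ep : 0 < e `^ p by rewrite powR_gt0.
have [N _ hN] : \forall n \near \oo, (Ip mu p (fun x => (u x - f n x)%:C) < (e `^ p)%:E)%E.
  exact: cv _ (@nbhs_open_ereal_lt R 0 (fun=> e `^ p) ep).
exists (fun x => (f N x)%:C) => //.
rewrite Ip_le ?(ltW e0)//.
rewrite (_ : _ - _ = (fun x => (u x - f N x)%:C)); first by apply: ltW; apply: hN => /=.
by apply/funext => x; rewrite !fctE rmorphB.
Qed.

Lemma shiftable_real (u : borel G -> R) : measurable_fun setT u ->
  (Ip mu p (fun x => (u x)%:C) < +oo)%E -> shiftable (fun x => (u x)%:C : C).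
Proof.
move=> mU uI.
have half (s : R) : `|s| = 1 -> shiftable (fun x => ((`|u x| + s * u x) / 2)%:C : C).
  move=> s1; have b x : `|s * u x| = `|u x| by rewrite normrM s1 mul1r.
  have mm : measurable_fun setT (fun x => (`|u x| + s * u x) / 2).
    apply: measurable_funM => //; apply: measurable_funD; first exact: measurableT_comp.
    exact: measurable_funM.
  have g0 x : 0 <= (`|u x| + s * u x) / 2.
    rewrite divr_ge0// -b; have := ler_norm (- (s * u x)); rewrite normrN; lra.
  apply: (shiftable_ge0 mm g0).
  apply: le_lt_trans uI; apply: le_Ip => //; [exact: cmeasurable_real..|].
  move=> x; rewrite !normcC ger0_norm// ler_pdivrMr// -b.
  have := ler_norm (s * u x); lra.
have -> : (fun x => (u x)%:C : C) = (fun x => ((`|u x| + 1 * u x) / 2)%:C) +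
    (-1) *: (fun x => ((`|u x| + (-1) * u x) / 2)%:C).
  apply/funext => x; rewrite !fctE scaleN1r -rmorphB; congr (_%:C); lra.
apply: shiftableD; last apply: shiftableZ; apply: half; by rewrite ?normrN1 ?normr1.
Qed.

Lemma shiftable_Lpfun (f : Lpfun mu p1) : shiftable f.
Proof.
have mf := Lpfun_measurable f.
have fI : (Ip mu p f < +oo)%E by rewrite -cLnorm_Ip// -nrmE poweR_EFin ltry.
have -> : (f : borel G -> C) = (fun x => (complex.Re (f x))%:C) +
    'i%C *: (fun x => (complex.Im (f x))%:C).
  by apply/funext => x; rewrite !fctE [LHS]complexE.
case: (mf) => mr mi.
apply: shiftableD; last apply: shiftableZ.
  apply: (shiftable_real mr).
  apply: le_lt_trans fI; apply: le_Ip => [||//|x]; first exact: p1.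
    exact: (cmeasurable_real mr).
  by rewrite normcC normc_ge_absRe.
apply: (shiftable_real mi).
apply: le_lt_trans fI; apply: le_Ip => [||//|x]; first exact: p1.
  exact: (cmeasurable_real mi).
by rewrite normcC normc_ge_absIm.
Qed.

(** Strong continuity of the left regular representation at the unit, through
    compact sets, sets of finite measure, simple functions, and real functions
    of [L^p]. *)
Lemma Lp_translate_continuous1 (x : Lp mu p1) (e : R) : 0 < e ->
  \forall t \near (1%g : G), rn (Lp_translate t x - x) <= e.
Proof.
move=> e0; have [_ h] := shiftable_Lpfun (repr x).
apply: filterS (h _ e0) => t.
have -> : Lp_translate t x - x = Lp_class (translate_Lpfun t (repr x) - repr x).
  by rewrite Lp_classB -Lp_translate_class Lp_reprK.
by rewrite rn_Lp_class -lee_fin nrmE.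
Qed.

End translation_continuity.

(** * Operators nearly commuting with translations *)

Section integer_powers.
Variable G : groupType.
Implicit Types t : G.

Definition intpow t (n : int) : G :=
  match n with Posz k => (t ^+ k)%g | Negz k => (t^-1 ^+ k.+1)%g end.

Lemma intpowS t (n : int) : intpow t (1 + n) = (t * intpow t n)%g.
Proof.
case: n => [n|[|n]].
- by rewrite -PoszD /= expgS.
- by rewrite /= expg1 mulgV expg0.
- rewrite (_ : 1 + Negz n.+1 = Negz n); last by lia.
  by rewrite /= [in RHS]expgS mulVKg.
Qed.

Lemma intpowD t (m n : int) : intpow t (m + n) = (intpow t m * intpow t n)%g.
Proof.
elim: m => [|m IH|m IH]; first by rewrite add0r /= expg0 mul1g.
- rewrite (_ : m.+1%:Z + n = 1 + (m%:Z + n)); last by lia.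
  by rewrite intpowS IH mulgA -intpowS.
- apply: (@mulgI _ t); rewrite mulgA -!intpowS.
  rewrite (_ : 1 + (- m.+1%:Z + n) = - m%:Z + n); last by lia.
  by rewrite IH; congr (intpow t _ * _)%g; lia.
Qed.

End integer_powers.

Section translation_action.
Context (R : realType) (G : topologicalGroupType).
Context (mu : leftHaarMeasure G R) (p : R) (p1 : 1 <= p).
Implicit Types (x y : Lp mu p1) (s t : G).

Lemma Lp_translateM s t x : Lp_translate s (Lp_translate t x) = Lp_translate (s * t)%g x.
Proof.
rewrite -[x]Lp_reprK !Lp_translate_class; congr Lp_class; apply: val_inj.
by apply/funext => r; rewrite /= /translate invgM mulgA.
Qed.

Lemma Lp_translate1 x : Lp_translate 1%g x = x.
Proof.
rewrite -[x]Lp_reprK Lp_translate_class; congr Lp_class; apply: val_inj.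
by apply/funext => r; rewrite /= /translate invg1 mul1g.
Qed.

Lemma rn_translate t x : rn (Lp_translate t x) = rn x.
Proof. by rewrite /rn Lp_translate_norm. Qed.

Lemma translation_action t :
  isometric_action (fun n => Lp_translate (mu := mu) (p1 := p1) (intpow t n)).
Proof.
split=> [n a x y|n x|m n x|x].
- exact: Lp_translate_linear.
- exact: rn_translate.
- by rewrite Lp_translateM intpowD.
- by rewrite /= expg0 Lp_translate1.
Qed.

End translation_action.

Section near_best.
Context (R : realType) (X : normedModType R[i]).
Implicit Types (T A : boundedOp X) (S : set (boundedOp X)).

Lemma boundedOp_additive_scalar T : linear_map T.
Proof. by move=> a x y; rewrite linearP. Qed.

Lemma boundedOp_bound T : exists2 t : R, 0 <= t & forall x, rn (T x) <= t * rn x.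
Proof.
have [M hM] := boundedOpP T.
exists (normc M); first exact: normc_ge0.
move=> x; have := hM x; rewrite !rnE lecE => /andP[_].
case: M {hM} => a b /=; rewrite !mulr0 subr0 => h; apply: (le_trans h).
rewrite ler_wpM2r ?rn_ge0//; exact: (le_trans (ler_norm _) (normc_ge_absRe (a +i* b))).
Qed.

(** [dist_r] only looks at the unit ball; scaling extends its meaning to all
    vectors. *)
Lemma dist_r_near T S (alpha : R) : closed_subspace S ->
  (dist_r T S <= alpha%:E)%E -> forall y (e : R), 0 < e ->
  exists2 A, S A & rn (T y - A y) <= alpha * rn y + e.
Proof.
move=> cS Ta y e e0.
have [A0 SA0 A00] := closed_subspace0 cS.
have [y0|y0] := eqVneq y 0.
  by exists A0 => //; rewrite y0 A00 linear0 subrr rn0 mulr0 add0r ltW.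
have ry : 0 < rn y.
  by rewrite lt_neqAle rn_ge0 andbT eq_sym; apply: contra y0 => /eqP/rn_eq0 ->.
pose z := ((rn y)^-1)%:C *: y.
have rz : rn z = 1.
  by rewrite rnZ normcC ger0_norm ?invr_ge0 ?rn_ge0// mulVf// gt_eqF.
have yz : y = (rn y)%:C *: z.
  by rewrite scalerA -rmorphM/= divff ?gt_eqF// scale1r.
have h : (ereal_inf [set enorm (T z - A z)%R | A in S] <= alpha%:E)%E.
  by apply: le_trans Ta; apply: ereal_sup_ubound; exists z => //=; rewrite rnE rz.
have e1 : 0 < e / rn y by rewrite divr_gt0.
have [A [SA Ae]] : exists A, S A /\ rn (T z - A z) <= alpha + e / rn y.
  apply: contrapT => /forallNP no.
  have : ((alpha + e / rn y)%:E <= alpha%:E)%E.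
    apply: le_trans h; apply: le_ereal_inf_tmp => _ [A SA <-].
    by rewrite lee_fin leNgt; apply/negP => /ltW hA; apply: (no A).
  by rewrite lee_fin gerDl leNgt e1.
exists A => //.
have -> : T y - A y = (rn y)%:C *: (T z - A z).
  rewrite scalerBr -(linear_mapZ _ _ (boundedOp_additive_scalar T)).
  by rewrite -(linear_mapZ _ _ (boundedOp_additive_scalar A)) -yz.
rewrite rnZ normcC ger0_norm ?rn_ge0//.
apply: (le_trans (ler_wpM2l (ltW ry) Ae)).
by rewrite mulrDr mulrCA mulfV ?gt_eqF// mulr1 mulrC.
Qed.

End near_best.

Section conjugation_estimate.
Context (R : realType) (G : topologicalGroupType).
Context (mu : leftHaarMeasure G R) (p : R) (p1 : 1 <= p).
Local Notation X := (Lp mu p1).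
Variables (T : boundedOp X) (alpha : R).
Hypothesis a0 : 0 <= alpha.
Hypothesis T_dist : (dist_r T (CV mu p1) <= alpha%:E)%E.

Let conj_bound (delta : R) : Prop := forall (t : G) x,
  rn (Lp_translate t (T (Lp_translate t^-1%g x)) - T x) <= delta * rn x.

Let conj_bound_half (N' : nat) delta : (4 <= N')%N -> 20 * pi <= N'%:R :> R ->
  0 <= delta -> conj_bound delta -> conj_bound (15 * N'%:R * alpha + delta / 2).
Proof.
move=> N4 N20 d0 db t x.
have [b b0 Tb] := boundedOp_bound T.
have := @commutator_estimate _ _ N' N4 _ (translation_action mu p1 t) T b alpha delta
  (boundedOp_additive_scalar T) b0 Tb a0 (@Lp_rapidly_complete _ _ _ mu _ p1) _ N20 d0 _ x.
rewrite /= expg1; apply.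
- move=> y e e0.
  have [A CA Ae] := dist_r_near (CV_closed_subspace mu p1) T_dist y e0.
  have [c _ cA] := boundedOp_bound A.
  by exists A, c; split => //; exact: boundedOp_additive_scalar.
- move=> n y; rewrite (_ : intpow t (- n) = (intpow t n)^-1%g); first exact: db.
  by apply: (@mulgI _ (intpow t n)); rewrite -intpowD subrr mulgV /= expg0.
Qed.

(** If [delta] bounds the left-hand side for all translations, then so does
    [15 N' alpha + delta / 2], by [commutator_estimate] for the powers of each
    translation. Iterating from the trivial bound, twice that of [T], leaves
    [30 N' alpha], and [N'] is between [20 pi] and [20 pi + 1]. *)
Lemma conjugation_estimate (t : G) x :
  rn (Lp_translate t (T (Lp_translate t^-1%g x)) - T x) <=
  288 * pi * (1 + Num.sqrt 2) * alpha * rn x.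
Proof.
have p2 := pi_ge2 R.
pose N' := (Num.truncn (20 * pi : R)).+1.
have /andP[N1 N2] := truncn_itv (mulr_ge0 (ler0n R 20) (pi_ge0 R)).
have N20 : 20 * pi <= N'%:R :> R by exact: ltW.
have N21 : N'%:R <= 20 * pi + 1 :> R by rewrite /N' -natr1 lerD2r.
have N4 : (4 <= N')%N by rewrite -(ler_nat R); lra.
have [b b0 Tb] := boundedOp_bound T.
have cb n : conj_bound (30 * N'%:R * alpha + 2 * b / 2 ^+ n).
  elim: n => [|n IH].
    move=> s y; apply: (le_trans (rnB _ _)); rewrite rn_translate expr0 divr1.
    have h1 := Tb y; have h2 := Tb (Lp_translate s^-1%g y); rewrite rn_translate in h2.
    have h3 : 0 <= 30 * N'%:R * alpha * rn y by rewrite !mulr_ge0 ?rn_ge0.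
    by rewrite mulrDl; move: h1 h2 h3; move: (rn _) (rn _) (rn _) (_ * alpha) => *; lra.
  have d0 : 0 <= 30 * N'%:R * alpha + 2 * b / 2 ^+ n.
    by rewrite addr_ge0 ?divr_ge0 ?mulr_ge0 ?exprn_ge0.
  have := conj_bound_half N4 N20 d0 IH.
  by congr conj_bound; rewrite exprS; field; rewrite expf_neq0.
have h : rn (Lp_translate t (T (Lp_translate t^-1%g x)) - T x) <= 30 * N'%:R * alpha * rn x.
  apply: (@le_pow2_lim _ _ _ (2 * b * rn x) 0) => n _; apply: (le_trans (cb n t x)).
  by rewrite mulrDl [X in _ + X <= _]mulrAC.
apply: (le_trans h); rewrite ler_wpM2r ?rn_ge0// ler_wpM2r//.
have s2 : 7 / 5 <= Num.sqrt 2 :> R.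
  by rewrite -(ler_pXn2r (n := 2)) ?nnegrE ?sqrtr_ge0// ?sqr_sqrtr//; lra.
have : pi * (7 / 5) <= pi * Num.sqrt 2 :> R by rewrite ler_wpM2l// pi_ge0.
by rewrite mulrDr mulr1 -[288 * pi * _]mulrA; move: (pi * Num.sqrt 2) => *; lra.
Qed.

End conjugation_estimate.

(** * Duality on classes of functions *)

Section duality.
Context d (T : measurableType d) (R : realType).
Variables (mu : {measure set T -> \bar R}).
Variables (p q : R) (p1 : 1 < p) (q1 : 1 < q).
Hypothesis pq : p^-1 + q^-1 = 1.
Implicit Types (x y : Lp mu (ltW p1)) (g : Lpfun mu (ltW q1)).

Let p0 : 0 < p. Proof. exact: lt_trans p1. Qed.
Let q0 : 0 < q. Proof. exact: lt_trans q1. Qed.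

(** Tested on the dual of [f]. *)
Lemma nrm_le_pairing (f : Lpfun mu (ltW p1)) (B : R) :
  (forall g, `|pairing f g| <= B * nrm g) -> 0 <= B -> nrm f <= B.
Proof.
move=> fB B0.
have qp : q^-1 + p^-1 = 1 by rewrite addrC.
pose g : Lpfun mu (ltW q1) := dual_Lpfun q1 qp f.
have n0 := nrm_ge0 f.
have [->//|f0] := eqVneq (nrm f) 0.
have fp : 0 < nrm f by rewrite lt_neqAle eq_sym f0.
have gE : pairing f g = nrm f `^ p.
  rewrite -(pairing_dual q1 qp f); apply: eq_Rintegral => z _.
  by rewrite mulrC.
have ng : nrm g = nrm f `^ (p - 1).
  have h : nrm g `^ q = nrm f `^ p := nrm_dual q1 qp f.
  have -> : nrm g = (nrm g `^ q) `^ q^-1.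
    by rewrite -powRrM mulfV ?gt_eqF// powRr1// nrm_ge0.
  rewrite h -powRrM; congr (_ `^ _); have -> : q^-1 = 1 - p^-1 by rewrite -pq addrC addKr.
  by rewrite mulrBr mulr1 mulfV ?gt_eqF.
have := fB g; rewrite gE ng ger0_norm ?powR_ge0// -(mulr_powRB1 n0 p0).
by rewrite ler_pM2r// powR_gt0.
Qed.

Definition bra x g : R := pairing (repr x) g.

Lemma bra_class f g : bra (Lp_class f) g = pairing f g.
Proof.
congr fine; apply: ae_eq_integral => //.
- by case/integrableP: (pair_integrable pq (repr (Lp_class f)) g).
- by case/integrableP: (pair_integrable pq f g).
- by apply: filterS (repr_Lp_class f) => z -> _.
Qed.

Lemma braD x y g : bra (x + y) g = bra x g + bra y g.
Proof.
by rewrite -{1}[x]Lp_reprK -{1}[y]Lp_reprK -Lp_class_add bra_class (pairingDl pq).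
Qed.

Lemma braZ a x g : bra (a *: x) g = bra x (a *: g).
Proof. by rewrite -{1}[x]Lp_reprK -Lp_class_scale bra_class pairingZ. Qed.

Lemma bra_real (c : R) x g : bra (c%:C *: x) g = c * bra x g.
Proof. by rewrite braZ /bra (pairingZr pq). Qed.

Lemma braN x g : bra (- x) g = - bra x g.
Proof. by rewrite -scaleN1r -(rmorphN1 (real_complex R)) bra_real mulN1r. Qed.

Lemma braB x y g : bra (x - y) g = bra x g - bra y g.
Proof. by rewrite braD braN. Qed.

Lemma rn_repr x : nrm (repr x) = rn x.
Proof. by rewrite -rn_Lp_class Lp_reprK. Qed.

Lemma bra_le x g : `|bra x g| <= rn x * nrm g.
Proof. by rewrite -rn_repr; exact: pairing_le. Qed.

Lemma rn_le_bra x (B : R) : (forall g, `|bra x g| <= B * nrm g) -> 0 <= B -> rn x <= B.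
Proof. by rewrite -rn_repr; exact: nrm_le_pairing. Qed.

Lemma bra_inj x y : (forall g, bra x g = bra y g) -> x = y.
Proof.
move=> xy; apply/subr0_eq/rn_eq0/eqP; rewrite eq_le rn_ge0 andbT.
by apply: rn_le_bra => // g; rewrite braB xy subrr normr0 mul0r.
Qed.

End duality.

Section invariance.
Context (R : realType) (G : topologicalGroupType) (mu : leftHaarMeasure G R).
Variables (p q : R) (p1 : 1 < p) (q1 : 1 < q).
Hypothesis pq : p^-1 + q^-1 = 1.
Implicit Types (x y : Lp mu (ltW p1)) (g : Lpfun mu (ltW q1)).

Lemma bra_translate (t : G) x g :
  bra (Lp_translate t x) g = bra x (translate_Lpfun t^-1%g g).
Proof.
rewrite -[x]Lp_reprK Lp_translate_class !(bra_class pq) /pairing /Rintegral; congr fine.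
pose F (s : borel G) : \bar R := (complex.Re ((repr x : Lpfun mu (ltW p1)) (t^-1 * s)%g * g s))%:E.
pose phi (s : borel G) : borel G := (t * s)%g.
have mphi : measurable_fun setT phi by exact: measurable_mulg.
have mF : measurable_fun setT F.
  apply/measurable_EFinP; apply: measurable_Re_prod; last exact: Lpfun_measurable.
  by apply: cmeasurable_translate; exact: Lpfun_measurable.
have iFphi : mu.-integrable (phi @^-1` setT) (F \o phi).
  have := pair_integrable pq (repr x) (translate_Lpfun t^-1%g g).
  rewrite preimage_setT; congr (_.-integrable _ _); apply/funext => s.
  by rewrite /F /phi /= /translate mulKg invgK.
have := integral_pushforward mphi mF iFphi measurableT.
rewrite preimage_setT => h.
rewrite -[LHS]/(\int[mu]_s F s)%E.
have -> : (\int[mu]_s F s = \int[pushforward mu phi]_s F s)%E.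
  apply: eq_measure_integral => A mA _; exact/esym/(@haar_preimage _ _ mu t).
rewrite h; apply: eq_integral => s _.
by rewrite /F /phi /= /translate mulKg invgK.
Qed.
End invariance.

(** * Averaging over the group *)

Section real_mean.
Context (R : realType) (G : topologicalGroupType) (mu : leftHaarMeasure G R).
Local Notation C := R[i].
Variables (m : (borel G -> C) -> C) (hm : left_invariant_mean mu m).
Implicit Types (phi psi : borel G -> R).

Definition bounded_continuous phi : Prop :=
  continuous phi /\ exists c : R, forall s, `|phi s| <= c.

Definition real_mean phi : R := complex.Re (m (fun s => (phi s)%:C)).

Lemma ess_bounded_real phi c : (forall s, `|phi s| <= c) ->
  ess_bounded_by mu c (fun s => (phi s)%:C : C).
Proof.
move=> hc K cK; rewrite (_ : _ `&` _ = set0); first exact: negligible_set0.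
apply/seteqP; split => // s [_ h].
have {}h : ~ (normc (phi s)%:C <= c) := h.
by apply: h; rewrite normcC.
Qed.

Lemma Linfty_real phi : bounded_continuous phi -> Linfty mu (fun s => (phi s)%:C : C).
Proof.
move=> [cphi [c hc]]; split; last by exists c; exact: ess_bounded_real.
apply: cmeasurable_real; apply: (measurability _ (RGenOpens.measurableE R)).
move=> _ [_ [a [b ->]] <-]; rewrite setTI; apply: sub_sigma_algebra.
by move/continuousP : cphi; apply; exact: interval_open.
Qed.

Lemma real_meanD phi psi : bounded_continuous phi -> bounded_continuous psi ->
  real_mean (fun s => phi s + psi s) = real_mean phi + real_mean psi.
Proof.
move=> /Linfty_real p1 /Linfty_real p2; rewrite /real_mean -raddfD/=.
rewrite -[X in X + _]mul1r -(mean_linear hm)//; congr (complex.Re (m _)).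
by apply/funext => s; rewrite !fctE scale1r rmorphD.
Qed.

Lemma bounded_continuous0 : bounded_continuous (fun=> 0).
Proof. by split; [exact: cst_continuous|exists 0 => s; rewrite normr0]. Qed.

Lemma mean0 : m (fun=> 0) = 0.
Proof.
have h := Linfty_real bounded_continuous0.
have E : -1 *: (fun=> 0) + (fun=> 0) = (fun=> 0) :> (borel G -> C).
  by apply/funext => s; rewrite !fctE scaler0 addr0.
by have := mean_linear hm (-1) h h; rewrite E mulN1r addNr.
Qed.

Lemma real_meanZ c phi : bounded_continuous phi ->
  real_mean (fun s => c * phi s) = c * real_mean phi.
Proof.
move=> /Linfty_real h; rewrite /real_mean.
have E : (fun s => (c * phi s)%:C) = c%:C *: (fun s => (phi s)%:C) + (fun=> 0).
  by apply/funext => s; rewrite !fctE addr0 rmorphM.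
have h0 : Linfty mu (fun=> 0) := Linfty_real bounded_continuous0.
rewrite E (mean_linear hm)// mean0.
by case: (m _) => a b /=; rewrite mul0r subr0 addr0.
Qed.

Lemma real_mean_le phi c : bounded_continuous phi -> (forall s, `|phi s| <= c) ->
  `|real_mean phi| <= c.
Proof.
move=> /Linfty_real h hc; apply: (le_trans (normc_ge_absRe _)).
by apply: (mean_bounded hm) => //; exact: ess_bounded_real.
Qed.

Lemma real_mean_cst c : real_mean (fun=> c) = c.
Proof.
have h1 : bounded_continuous (fun=> 1).
  by split; [exact: cst_continuous|exists 1 => s; rewrite normr1].
have := real_meanZ c h1; rewrite [in RHS]/real_mean (mean1 hm)/= !mulr1 => {2}<-.
by congr real_mean; apply/funext => s; rewrite mulr1.
Qed.

Lemma real_mean_translate (t : G) phi : bounded_continuous phi ->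
  real_mean (fun s => phi (t^-1 * s)%g) = real_mean phi.
Proof.
by move=> /Linfty_real h; rewrite /real_mean -(mean_left_invariant hm t h).
Qed.

End real_mean.

Section averaging.
Context (R : realType) (G : topologicalGroupType) (hG : hausdorff_space G).
Context (mu : leftHaarMeasure G R).
Variables (p q : R) (p1 : 1 < p) (q1 : 1 < q).
Hypothesis pq : p^-1 + q^-1 = 1.
Local Notation C := R[i].
Local Notation X := (Lp mu (ltW p1)).
Local Notation Y := (Lpfun mu (ltW q1)).
Variables (m : (borel G -> C) -> C) (hm : left_invariant_mean mu m).
Variables (T : boundedOp X) (K : R).
Hypothesis K0 : 0 <= K.
Implicit Types (x y : X) (g : Y).

Definition conjugate (t : G) x : X := Lp_translate t (T (Lp_translate t^-1%g x)).

Hypothesis T_conj : forall t x, rn (conjugate t x - T x) <= K * rn x.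

Lemma Lp_translate_continuous x (s : G) (e : R) : 0 < e ->
  \forall t \near s, rn (Lp_translate t x - Lp_translate s x) <= e.
Proof.
move=> e0.
have cs : (s^-1 * t)%g @[t --> (s : borel G)] --> (1%g : borel G).
  by rewrite -[X in _ --> X](mulVg s); exact: (@mulg_continuousr G s^-1%g s).
have near_s : \forall t \near s, rn (Lp_translate (s^-1 * t)%g x - x) <= e.
  exact: (cs [set t | rn (Lp_translate t x - x) <= e] (Lp_translate_continuous1 hG x e0)).
apply: filterS near_s => t /= h.
by rewrite -(rn_translate s^-1%g) Lp_translateB !Lp_translateM mulVg Lp_translate1.
Qed.

Lemma conjugate_continuous x (s : G) (e : R) : 0 < e ->
  \forall t \near s, rn (conjugate t x - conjugate s x) <= e.
Proof.
move=> e0; have [b b0 Tb] := boundedOp_bound T.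
have e1 : 0 < e / 2 / (b + 1) by rewrite !divr_gt0// ltr_wpDl.
have e2 : 0 < e / 2 by rewrite divr_gt0.
have h1 := Lp_translate_continuous (T (Lp_translate s^-1%g x)) s e2.
have h2 : \forall t \near s, rn (Lp_translate t^-1%g x - Lp_translate s^-1%g x) <= e / 2 / (b + 1).
  exact: (@invg_continuous G s) _ (Lp_translate_continuous x s^-1%g e1).
apply: filterS2 h1 h2 => t h1 h2.
apply: (le_trans (rn_dist_triangle (Lp_translate t (T (Lp_translate s^-1%g x))) _ _)).
rewrite [X in _ <= X]splitr; apply: lerD; last exact: h1.
rewrite /conjugate -Lp_translateB rn_translate.
rewrite -(linear_mapB _ _ (boundedOp_additive_scalar T)).
apply: (le_trans (Tb _)); apply: (@le_trans _ _ ((b + 1) * (e / 2 / (b + 1)))).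
  by apply: ler_pM; rewrite ?rn_ge0 ?lerDl.
by rewrite mulrC divfK// gt_eqF// ltr_wpDl.
Qed.

Lemma conjugate_linear t : linear_map (conjugate t).
Proof. by move=> a x y; rewrite /conjugate Lp_translate_linear linearP Lp_translate_linear. Qed.

Lemma rn_conjugate t x (b : R) : (forall z, rn (T z) <= b * rn z) -> rn (conjugate t x) <= b * rn x.
Proof. by move=> Tb; rewrite /conjugate rn_translate (le_trans (Tb _))// rn_translate. Qed.

Definition orbit_fun x g (t : borel G) : R := bra (conjugate t x) g.

(** Continuity is what makes this function measurable for the Borel sets, so
    that the mean applies to it. *)
Lemma orbit_fun_bounded_continuous x g : bounded_continuous (orbit_fun x g).
Proof.
have [b b0 Tb] := boundedOp_bound T; split; last first.
  exists (b * rn x * nrm g) => s; apply: (le_trans (bra_le pq _ _)).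
  by rewrite ler_wpM2r ?nrm_ge0// rn_conjugate.
move=> s; apply/(@cvgrPdist_le _ R^o) => e e0.
have n1 : 0 < nrm g + 1 by rewrite ltr_wpDl// nrm_ge0.
have e1 : 0 < e / (nrm g + 1) by rewrite divr_gt0.
apply: filterS (conjugate_continuous x s e1) => t h.
rewrite /orbit_fun -(braB pq) (le_trans (bra_le pq _ _))// rn_distC.
apply: (@le_trans _ _ (e / (nrm g + 1) * (nrm g + 1))); last by rewrite divfK// gt_eqF.
by apply: ler_pM; rewrite ?rn_ge0 ?nrm_ge0 ?lerDl.
Qed.

(** The average of the conjugates of [T] is taken weakly: averaging the pairings
    with each [g] gives a bounded functional of [g], which is represented by an
    element of [L^p]. *)
Lemma average_exists x : exists y, forall g, bra y g = real_mean m (orbit_fun x g).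
Proof.
have [b b0 Tb] := boundedOp_bound T.
have [] := @riesz_representation _ _ _ mu p q p1 q1 pq (fun g => real_mean m (orbit_fun x g)) (b * rn x).
- by rewrite mulr_ge0 ?rn_ge0.
- move=> f g; rewrite -(real_meanD hm); [|exact: orbit_fun_bounded_continuous..].
  by congr (real_mean m); apply/funext => t; rewrite /orbit_fun /bra (pairingDr pq).
- move=> c g; rewrite -(real_meanZ hm); last exact: orbit_fun_bounded_continuous.
  by congr (real_mean m); apply/funext => t; rewrite /orbit_fun /bra (pairingZr pq).
- move=> g; apply: (real_mean_le hm); first exact: orbit_fun_bounded_continuous.
  move=> t; apply: (le_trans (bra_le pq _ _)).
  by rewrite ler_wpM2r ?nrm_ge0// rn_conjugate.
- by move=> f hf; exists (Lp_class f) => g; rewrite (bra_class pq) hf.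
Qed.

Definition average x : X := projT1 (cid (average_exists x)).

Lemma bra_average x g : bra (average x) g = real_mean m (orbit_fun x g).
Proof. exact: (projT2 (cid (average_exists x))). Qed.

Lemma average_linear : linear_map average.
Proof.
move=> a x y; apply: (bra_inj pq) => g.
rewrite (braD pq) (braZ pq) !bra_average -(real_meanD hm); [|exact: orbit_fun_bounded_continuous..].
congr (real_mean m); apply/funext => t.
by rewrite /orbit_fun conjugate_linear (braD pq) (braZ pq).
Qed.

(** Conjugating by a translation shifts the orbit function, which does not
    change its mean. *)
Lemma average_translate (t : G) x : average (Lp_translate t x) = Lp_translate t (average x).
Proof.
apply: (bra_inj pq) => g; rewrite (bra_translate pq) !bra_average.
rewrite -[RHS](real_mean_translate hm t); last exact: orbit_fun_bounded_continuous.
congr (real_mean m); apply/funext => s; rewrite /orbit_fun -(bra_translate pq).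
by rewrite /conjugate !Lp_translateM mulVKg invgM invgK.
Qed.

Lemma average_near x : rn (T x - average x) <= K * rn x.
Proof.
apply: (rn_le_bra pq) => [g|]; last by rewrite mulr_ge0 ?rn_ge0.
have bc1 : bounded_continuous (fun _ : borel G => bra (T x) g).
  by split; [exact: cst_continuous|exists `|bra (T x) g|].
have bc2 : bounded_continuous (fun s => -1 * orbit_fun x g s).
  have [c1 [c c2]] := orbit_fun_bounded_continuous x g; split.
    by move=> s; apply: cvgM; [exact: cvg_cst|exact: c1].
  by exists c => s; rewrite normrM normrN1 mul1r.
have E : bra (T x - average x) g = real_mean m (fun s => bra (T x) g + -1 * orbit_fun x g s).
  rewrite (real_meanD hm)// (real_mean_cst hm) (real_meanZ hm); last first.
    exact: orbit_fun_bounded_continuous.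
  by rewrite (braB pq) bra_average mulN1r.
have bd s : `|bra (T x) g + -1 * orbit_fun x g s| <= K * rn x * nrm g.
  rewrite mulN1r -(braB pq); apply: (le_trans (bra_le pq _ _)).
  by rewrite ler_wpM2r ?nrm_ge0// rn_distC.
rewrite E; apply: (real_mean_le hm) => //; split; last by exists (K * rn x * nrm g).
by move=> s; apply: cvgD; [exact: cvg_cst|exact: (proj1 bc2)].
Qed.

End averaging.

(** * Distances to the convolution operators *)

Section bounded_operators.
Context (R : realType) (X : normedModType R[i]).
Implicit Types (T : boundedOp X) (S : set (boundedOp X)).

Lemma boundedOp_of (A : X -> X) (b : R) : linear_map A ->
  (forall x, rn (A x) <= b * rn x) -> exists A' : boundedOp X, forall x, A' x = A x.
Proof.
move=> lA bA.
pose L := GRing.isLinear.Build R[i] X X *:%R A lA.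
pose A' : {linear X -> X} := HB.pack A L.
have bA' : exists M : R[i], forall x, `|A' x| <= M * `|x|.
  by exists b%:C => x; rewrite !rnE -rmorphM lecR; exact: bA.
by exists (MkBoundedOp bA').
Qed.

Lemma opnorm_le (T : X -> X) (c : R) : 0 <= c -> (forall x, rn (T x) <= c * rn x) ->
  (opnorm T <= c%:E)%E.
Proof.
move=> c0 Tc; apply: ge_ereal_sup => _ [x /= x1 <-]; rewrite lee_fin.
apply: (le_trans (Tc x)); rewrite ler_piMr//.
by move: x1; rewrite rnE -[1 in X in X -> _](rmorph1 (real_complex R)) lecR.
Qed.

Lemma dist_r_ge0 T S : closed_subspace S -> (0 <= dist_r T S)%E.
Proof.
move=> cS; have [A SA A0] := closed_subspace0 cS.
apply: (@le_trans _ _ (ereal_inf [set enorm (T 0 - A 0)%R | A in S])).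
  by apply: le_ereal_inf_tmp => _ [B _ <-]; rewrite lee_fin; exact: rn_ge0.
by apply: ereal_sup_ubound; exists 0; rewrite //= normr0.
Qed.

Lemma dist_r_fin T S : closed_subspace S -> exists alpha : R, dist_r T S = alpha%:E.
Proof.
move=> cS; have [b b0 Tb] := boundedOp_bound T; have [A SA A0] := closed_subspace0 cS.
have h0 := dist_r_ge0 T cS.
exists (fine (dist_r T S)); rewrite fineK// ge0_fin_numE//.
apply: (@le_lt_trans _ _ b%:E); last exact: ltry.
apply: ge_ereal_sup => _ [x /= x1 <-].
apply: (@le_trans _ _ (enorm (T x - A x)%R)); first by apply: ereal_inf_lbound; exists A.
rewrite A0 subr0 lee_fin; apply: (le_trans (Tb x)); rewrite ler_piMr//.
by move: x1; rewrite rnE -[1 in X in X -> _](rmorph1 (real_complex R)) lecR.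
Qed.

End bounded_operators.

Theorem theorem4p9 (R : realType) (G : topologicalGroupType)
    (lcG : locally_compact [set: G]) (hG : hausdorff_space G)
    (mu : leftHaarMeasure G R) (p : R) (p_gt1 : 1 < p) :
  reflexive_space (CV mu (ltW p_gt1)) /\
  (amenable mu ->
   hyperreflexive_with (CV mu (ltW p_gt1)) (288 * pi * (1 + Num.sqrt 2))).
Proof.
have cCV := CV_closed_subspace mu (ltW p_gt1).
split.
  move=> T T0 t x.
  have h y : Lp_translate t (T (Lp_translate t^-1%g y)) = T y.
    apply/subr0_eq/rn_eq0/eqP; rewrite eq_le rn_ge0 andbT.
    have T0' : (dist_r T (CV mu (ltW p_gt1)) <= (0 : R)%:E)%E by rewrite T0.
    by have := conjugation_estimate (lexx 0) T0' t y; rewrite mulr0 mul0r.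
  by rewrite -h Lp_translateM mulVg Lp_translate1.
move=> [m hm] T.
have [alpha aE] := dist_r_fin T cCV.
have a0 : 0 <= alpha by rewrite -lee_fin -aE; exact: dist_r_ge0.
rewrite aE; set c : R := 288 * pi * _.
have c0 : 0 <= c.
  apply: mulr_ge0; first exact: mulr_ge0 (ler0n R 288) (pi_ge0 R).
  exact: addr_ge0 ler01 (sqrtr_ge0 _).
have ca0 : 0 <= c * alpha by rewrite mulr_ge0.
have T_conj (t : G) x : rn (conjugate T t x - T x) <= c * alpha * rn x.
  by apply: conjugation_estimate => //; rewrite aE.
pose q := p / (p - 1).
have p10 : 0 < p - 1 by rewrite subr_gt0.
have p0 : 0 < p := lt_trans ltr01 p_gt1.
have q1 : 1 < q by rewrite ltr_pdivlMr// mul1r gtrBl.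
have pq : p^-1 + q^-1 = 1 by rewrite /q invf_div; field; rewrite gt_eqF.
pose A := average hG q1 pq hm T.
have lA : linear_map A by exact: average_linear.
have nearA x : rn (T x - A x) <= c * alpha * rn x.
  by apply: average_near.
have [b b0 Tb] := boundedOp_bound T.
have bA x : rn (A x) <= (b + c * alpha) * rn x.
  rewrite -[A x](subKr (T x)); apply: (le_trans (rnB _ _)); rewrite mulrDl.
  by apply: lerD.
have [A' A'E] := boundedOp_of lA bA.
have CVA' : CV mu (ltW p_gt1) A'.
  by move=> t x; rewrite !A'E; exact: average_translate.
apply: (@le_trans _ _ (opnorm (fun x => T x - A' x)%R)).
  by apply: ereal_inf_lbound; exists A'.
rewrite -EFinM; apply: opnorm_le => // x.
by rewrite A'E; exact: nearA.
Qed.
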